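(* Let $p$ be an odd prime, $n\ge 1$, and let $F$ be a field with $\operatorname{char}(F)\ne p$ and $\mu_p\not\subseteq F$. Let $L=F(\mu_p)$, $J=F(p)(\mu_p)$, $\mathcal G=\mathrm{Gal}(L(p)/F)$, $G_F=\mathrm{Gal}(F(p)/F)$, $G_L=\mathrm{Gal}(L(p)/L)$, $\Gamma_F=\mathrm{Gal}(J/L)$, and $N=\mathrm{Gal}(L(p)/F(p))$. Let $\theta:\mathcal G\to(\mathbb Z/p^n\mathbb Z)^*$ be the unique character such that $\theta|_N=\alpha|_N$ and $\theta|_{G_L}=1$, where $\alpha:\mathcal G\to(\mathbb Z/p^n\mathbb Z)^*$ is the cyclotomic character, and let $\widetilde{\mu_{p^n}}=(\mu_{p^n})_{\theta^{-1}}$. Then $\widetilde{\mu_{p^n}}$ is a $G_F$-module (that is, $N$ acts trivially on it), and (i) $H^1(G_F,\widetilde{\mu_{p^n}})\cong H^1(G_L,\mu_{p^n})^{(\theta)}\cong (L^*/L^{*p^n})^{(\theta)}$; (ii) there is an injection $H^2(G_F,\widetilde{\mu_{p^n}})\hookrightarrow H^2(G_L,\mu_{p^n})^{(\theta)}$; (iii) for all $i\ge0$, $H^i(G_F,\widetilde{\mu_{p^n}})\cong H^i(\Gamma_F,\mu_{p^n})$ as groups, but $\mathcal G$ acts trivially on $H^i(G_F,\widetilde{\mu_{p^n}})$, while $\mathcal G$ acts via $\theta$ on $H^i(\Gamma_F,\mu_{p^n})$.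
   Context: For a field $K$, $K(p)$ denotes the maximal $p$-extension of $K$ (compositum of all finite Galois extensions of $K$ of $p$-power degree, in a fixed algebraic closure). $\mu_k$ is the group of $k$-th roots of unity; one has $\mu_{p^n}\subseteq J\subseteq L(p)$. The cyclotomic character $\alpha:\mathcal G\to(\mathbb Z/p^n\mathbb Z)^*$ is given by $g(\omega)=\omega^{\alpha(g)}$ for $g\in\mathcal G$, $\omega\in\mu_{p^n}$. (The character $\theta$ exists and is unique; in fact $\theta=\alpha^{p^{n-1}}$.) For a profinite group $G$, a discrete $p^n$-torsion $G$-module $A$ and a continuous character $\chi:G\to(\mathbb Z/p^n\mathbb Z)^*$: the eigenmodule is $A^{(\chi)}=\{a\in A\mid g\cdot a=\chi(g)a \text{ for all } g\in G\}$; $G$ acts on $A$ via $\chi$ if $A^{(\chi)}=A$; the twisted module $A_\chi$ equals $A$ as a group, with the new action $g*a=\chi(g)(g\cdot a)$. Here eigenmodules are taken with respect to the natural action of $\mathcal G$. Cohomology is continuous cohomology with discrete coefficients. $G_F$ is identified with $\mathcal G/N$, and restriction gives an isomorphism $\Gamma_F\cong G_F$. $\mathcal G$ acts on $H^i(G_L,\mu_{p^n})$ by the usual conjugation action (as $G_L$ is normal in $\mathcal G$), on $L^*/L^{*p^n}$ through $\mathrm{Gal}(L/F)$, on $H^i(\Gamma_F,\mu_{p^n})$ by the conjugation action of $\mathrm{Gal}(J/F)$ (in which $\Gamma_F$ is normal), and on $H^i(G_F,\widetilde{\mu_{p^n}})$ by the conjugation action through $G_F$. *)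

(* Defs.v *)
From HB Require Import structures.
From mathcomp Require Import all_boot all_order all_algebra all_fingroup all_field.
From mathcomp Require Import generic_quotient ring_quotient.
From mathcomp Require Import boolp classical_sets functions topology function_spaces.

Set Implicit Arguments.
Unset Strict Implicit.
Unset Printing Implicit Defensive.

Import GRing.Theory.

Local Open Scope classical_set_scope.
Local Open Scope ring_scope.
Local Open Scope quotient_scope.

Section Subgroup.
Variables (A : zmodType) (S : zmodClosed A).

Record zsub := ZSub { zsub_val : A; zsub_valP : zsub_val \in S }.

HB.instance Definition _ := [isSub for zsub_val].
HB.instance Definition _ := [Choice of zsub by <:].
HB.instance Definition _ := [SubChoice_isSubZmodule of zsub by <:].

End Subgroup.

Notation zquot := Quotient.quot.

Lemma zmod_morphism0 (A B : zmodType) (f : A -> B) : zmod_morphism f -> f 0 = 0.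
Proof. by move=> fB; rewrite -[X in f X](subrr 0) fB subrr. Qed.

Section QuotientMap.
Variables (A B : zmodType) (I : zmodClosed A) (J : zmodClosed B) (f : A -> B).
Hypothesis fB : zmod_morphism f.
Hypothesis fIJ : forall x, x \in I -> f x \in J.

Definition quot_map_fun (c : zquot I) : zquot J := \pi_(zquot J) (f (repr c)).

Lemma quot_map_pi x : quot_map_fun (\pi_(zquot I) x) = \pi_(zquot J) (f x).
Proof.
apply/eqP; rewrite -Quotient.idealrBE -fB fIJ //.
by rewrite Quotient.idealrBE reprK.
Qed.

Lemma quot_map_is_zmod_morphism : zmod_morphism quot_map_fun.
Proof.
move=> c d; rewrite -[c]reprK -[d]reprK -raddfB !quot_map_pi.
by rewrite fB raddfB.
Qed.

HB.instance Definition _ := GRing.isZmodMorphism.Build (zquot I) (zquot J)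
  quot_map_fun quot_map_is_zmod_morphism.

Definition quot_map : {additive zquot I -> zquot J} := quot_map_fun.

End QuotientMap.

Definition zmod_iso (A B : zmodType) : Prop :=
  exists f : {additive A -> B}, bijective f.

Definition zmod_embeds (A B : zmodType) : Prop :=
  exists f : {additive A -> B}, injective f.

HB.mixin Record Group_isTopGroup G of monoid.Group G & Topological G := {
  mulg_continuous : continuous (fun x : G * G => (x.1 * x.2)%g);
  invg_continuous : continuous (fun x : G => (x^-1)%g)
}.

#[short(type="topGroupType")]
HB.structure Definition TopGroup :=
  {G of monoid.Group G & Topological G & Group_isTopGroup G}.

Record character (G : topGroupType) (m : nat) := Character {
  character_fun :> G -> {unit 'Z_m};
  characterM : {morph character_fun : x y / (x * y)%g};
  character_continuous :
    continuous (character_fun : G -> discrete_topology {unit 'Z_m})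
}.

Record gmodule (G : topGroupType) (A : zmodType) := GModule {
  gact :> G -> A -> A;
  gact1 : forall a, gact 1%g a = a;
  gactM : forall g h a, gact (g * h)%g a = gact g (gact h a);
  gactB : forall g, zmod_morphism (gact g);
  gact_stab_open : forall a, open [set g | gact g a = a]
}.

(* [a *+ u] for [u : {unit 'Z_m}] uses the representative of [u] in [0, m); it
   is the action of [u] on [a] as soon as [a *+ m = 0]. *)
Definition unit_scale (A : zmodType) m (u : {unit 'Z_m}) (a : A) : A :=
  a *+ (FinRing.uval u : 'Z_m).

Definition twist (G : topGroupType) m (A : zmodType) (M : gmodule G A)
  (chi : G -> {unit 'Z_m}) (g : G) (a : A) : A := unit_scale (chi g) (M g a).

Section Eigenmodule.
Variables (G : topGroupType) (m : nat) (A : zmodType).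
Variables (act : G -> {additive A -> A}) (chi : G -> {unit 'Z_m}).

Definition eigen_pred : {pred A} :=
  fun a => `[< forall g, act g a = unit_scale (chi g) a >].

Fact eigen_closed : zmod_closed eigen_pred.
Proof.
split=> [|a b /asboolP Ha /asboolP Hb]; apply/asboolP => g.
  by rewrite /unit_scale raddf0 mul0rn.
by rewrite /unit_scale raddfB mulrnBl Ha Hb.
Qed.

HB.instance Definition _ := GRing.isZmodClosed.Build A eigen_pred eigen_closed.

Definition eigenmodule : zmodType := zsub eigen_pred.

Definition acts_via : Prop := forall a, a \in eigen_pred.

End Eigenmodule.

(* [face 0] drops the first entry, [face i.+1] the last one, and [face k]
   multiplies the entries [k - 1] and [k] (counted from 0) for [0 < k <= i]. *)
Definition face (T : groupType) i (k : nat) (x : 'I_i.+1 -> T) (j : 'I_i) : T :=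
  if (j.+1 < k)%N then x (widen_ord (leqnSn i) j)
  else if j.+1 == k then (x (widen_ord (leqnSn i) j) * x (lift ord0 j))%g
  else x (lift ord0 j).

Definition locally_constant (G : topGroupType) (A : zmodType) i
    (f : ('I_i -> G) -> A) : Prop :=
  continuous (f : {ptws 'I_i -> G} -> discrete_topology A).

#[global] Instance ptws_filter (G : topologicalType) i (x : {ptws 'I_i -> G}) :
  Filter (nbhs x).
Proof. exact: nbhs_filter. Qed.

Section LocallyConstant.
Variables (G : topGroupType) (A : zmodType) (i : nat).
Implicit Types (f : ('I_i -> G) -> A) (x : {ptws 'I_i -> G}).

Lemma locally_constantP f :
  locally_constant f <->
  forall x, \forall y \near x, f y = f x.
Proof.
split=> fc x.
  have fx : nbhs (f x : discrete_topology A) [set f x] by exact/principal_filterP.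
  exact: fc x _ fx.
by move=> U /principal_filterP Ufx; apply: filterS (fc x) => y /= ->.
Qed.

Lemma locally_constant0 : locally_constant (0 : ('I_i -> G) -> A).
Proof. by apply/locally_constantP => x; exact: filterE. Qed.

Lemma locally_constantB f h :
  locally_constant f -> locally_constant h -> locally_constant (f - h).
Proof.
move=> fc hc; apply/locally_constantP => x.
move/locally_constantP: fc => /(_ x); move/locally_constantP: hc => /(_ x).
by apply: filterS2 => y hy fy; rewrite -[LHS]/(f y - h y) fy hy.
Qed.

End LocallyConstant.

Section Cohomology.
Variables (G : topGroupType) (A : zmodType) (M : gmodule G A).

Definition coboundary i (f : ('I_i -> G) -> A) : ('I_i.+1 -> G) -> A :=
  fun x => M (x ord0) (f (face 0 x)) +
    \sum_(k < i.+1) f (face k.+1 x) *~ (-1) ^+ k.+1.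

Definition cocycle_pred i : {pred ('I_i -> G) -> A} :=
  fun f => `[< locally_constant f /\ coboundary f = 0 >].

Lemma coboundaryB i : zmod_morphism (@coboundary i).
Proof.
move=> f h; apply/funext => x.
rewrite {1}/coboundary /= gactB.
under eq_bigr do rewrite mulrzBl.
by rewrite sumrB addrACA -opprD.
Qed.

Fact cocycle_closed i : zmod_closed (@cocycle_pred i).
Proof.
split=> [|f h /asboolP[fc f0] /asboolP[hc h0]]; apply/asboolP; split.
- exact: locally_constant0.
- exact: zmod_morphism0 (@coboundaryB _).
- exact: locally_constantB.
- by rewrite coboundaryB f0 h0 subrr.
Qed.

HB.instance Definition _ i :=
  GRing.isZmodClosed.Build (('I_i -> G) -> A) (@cocycle_pred i)
    (@cocycle_closed i).

Definition cocycle i : zmodType := zsub (@cocycle_pred i).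

Definition is_coboundary i : (('I_i -> G) -> A) -> Prop :=
  match i with
  | 0 => fun f => f = 0
  | j.+1 => fun f =>
      exists2 h : ('I_j -> G) -> A, locally_constant h & f = coboundary h
  end.

Definition coboundary_pred i : {pred cocycle i} :=
  fun z => `[< is_coboundary (val z) >].

Fact coboundary_closed i : zmod_closed (@coboundary_pred i).
Proof.
case: i => [|i]; split=> [|y z /asboolP Hy /asboolP Hz]; apply/asboolP => //=.
- by rewrite Hy Hz subrr.
- exists 0; first exact: locally_constant0.
  by rewrite (zmod_morphism0 (@coboundaryB _)).
- case: Hy Hz => [h hc hE] [k kc kE]; exists (h - k).
    exact: locally_constantB.
  by rewrite coboundaryB hE kE.
Qed.

HB.instance Definition _ i :=
  GRing.isZmodClosed.Build (cocycle i) (@coboundary_pred i)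
    (@coboundary_closed i).

Definition coh i : zmodType := zquot (@coboundary_pred i).

End Cohomology.

Arguments cocycle_pred {G A} M i.
Arguments coboundary_pred {G A} M i.

Section Functoriality.
Variables (G G' : topGroupType) (A A' : zmodType).
Variables (M : gmodule G A) (M' : gmodule G' A').

Record compatible (phi : G' -> G) (psi : A -> A') : Prop := Compatible {
  compatible_continuous : continuous phi;
  compatibleM : {morph phi : x y / (x * y)%g};
  compatibleB : zmod_morphism psi;
  compatible_act : forall x a, psi (M (phi x) a) = M' x (psi a)
}.

Variables (phi : G' -> G) (psi : A -> A') (c : compatible phi psi) (i : nat).

Definition cochain_map i (f : ('I_i -> G) -> A) : ('I_i -> G') -> A' :=
  fun x => psi (f (phi \o x)).

Lemma cochain_mapB j : zmod_morphism (@cochain_map j).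
Proof. by move=> f h; apply/funext => x; exact: (compatibleB c). Qed.

Lemma cochain_map_locally_constant j (f : ('I_j -> G) -> A) :
  locally_constant f -> locally_constant (cochain_map f).
Proof.
move/locally_constantP => fc; apply/locally_constantP => x.
suff phic : continuous
    ((fun y => phi \o y) : {ptws 'I_j -> G'} -> {ptws 'I_j -> G}).
  have near_x : \forall y \near x, f (phi \o y) = f (phi \o x).
    exact: phic x _ (fc (phi \o x)).
  by apply: filterS near_x => y E; rewrite /cochain_map E.
move=> y; apply/cvg_sup => k.
apply: (continuous_comp_initial
  (w := fun z : {ptws 'I_j -> G} => z k)
  (f := (fun y => phi \o y) : {ptws 'I_j -> G'} -> _)) => {}y.
apply: (@continuous_comp {ptws 'I_j -> G'} G' G (fun z => z k) phi y).
  exact: (@proj_continuous _ (fun=> G') k).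
exact: (compatible_continuous c).
Qed.

Lemma coboundary_cochain_map j (f : ('I_j -> G) -> A) :
  coboundary M' (cochain_map f) = cochain_map (coboundary M f).
Proof.
have phi_face k (x : 'I_j.+1 -> G') : phi \o face k x = face k (phi \o x).
  apply/funext => l; rewrite /face /=.
  by case: ifP => // _; case: ifP => // _; rewrite (compatibleM c).
pose psiZ := GRing.isZmodMorphism.Build A A' psi (compatibleB c).
pose psiA : {additive A -> A'} := HB.pack psi psiZ.
apply/funext => x; rewrite /coboundary /cochain_map.
rewrite -[psi]/(psiA : A -> A') raddfD raddf_sum /= (compatible_act c) phi_face.
congr (_ + _); apply: eq_bigr => k _.
by rewrite -[psi]/(psiA : A -> A') raddfMz phi_face.
Qed.

Fact coh_map_cocycle (z : cocycle M i) :
  cochain_map (val z) \in cocycle_pred M' i.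
Proof.
have /asboolP[zc z0] := zsub_valP z; apply/asboolP; split.
  exact: cochain_map_locally_constant.
rewrite coboundary_cochain_map z0.
by rewrite (zmod_morphism0 (@cochain_mapB _)).
Qed.

Definition cocycle_map (z : cocycle M i) : cocycle M' i :=
  ZSub (coh_map_cocycle z).

Fact cocycle_mapB : zmod_morphism cocycle_map.
Proof. by move=> y z; apply/val_inj; rewrite /= cochain_mapB. Qed.

Fact cocycle_map_coboundary (z : cocycle M i) :
  z \in coboundary_pred M i ->
  cocycle_map z \in coboundary_pred M' i.
Proof.
case: z => f fP /asboolP /= Hf; apply/asboolP => /= {fP}; move: f Hf.
case: i => [|j] f /=.
  by move=> ->; exact: zmod_morphism0 (@cochain_mapB _).
case=> h hc ->; exists (cochain_map h).
  exact: cochain_map_locally_constant.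
by rewrite coboundary_cochain_map.
Qed.

Definition coh_map : {additive coh M i -> coh M' i} :=
  quot_map cocycle_mapB cocycle_map_coboundary.

End Functoriality.

(* [g] sends the class of [f] to the class of [x |-> g (f (g^-1 x g))]. *)
Section InnerConjugation.
Variables (G : topGroupType) (A : zmodType) (M : gmodule G A) (g : G).

Fact inner_compatible : compatible M M (fun x => g^-1 * x * g)%g (M g).
Proof.
split=> [x|x y||x a].
- apply: (@continuous_comp G (G * G)%type G (fun x => (g^-1 * x, g)%g)
    (fun z => (z.1 * z.2)%g) x); last exact: mulg_continuous.
  apply: cvg_pair; last exact: cvg_cst.
  apply: (@continuous_comp G (G * G)%type G (fun x => (g^-1, x)%g)
    (fun z => (z.1 * z.2)%g) x); last exact: mulg_continuous.
  by apply: cvg_pair; [exact: cvg_cst|exact: cvg_id].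
- by rewrite !mulgA mulgK.
- exact: gactB.
- by rewrite -!gactM !mulgA mulgV mul1g.
Qed.

Definition inner_conj i : {additive coh M i -> coh M i} :=
  coh_map inner_compatible i.

End InnerConjugation.

(* The multiplicative group of [K] carries the additive notation of [zmodType]:
   [x *+ m] is the m-th power of [x]. *)
Section MultiplicativeGroup.
Variable K : fieldType.

Record mulgrp := MulGrp { mulgrp_val : K; mulgrp_valP : mulgrp_val != 0 }.

HB.instance Definition _ := [isSub for mulgrp_val].
HB.instance Definition _ := [Choice of mulgrp by <:].

Definition mulgrp_one : mulgrp := MulGrp (oner_neq0 K).

Fact mulgrp_mul_subproof (x y : mulgrp) : val x * val y != 0.
Proof. by rewrite mulf_neq0 // mulgrp_valP. Qed.
Definition mulgrp_mul x y := MulGrp (mulgrp_mul_subproof x y).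

Fact mulgrp_inv_subproof (x : mulgrp) : (val x)^-1 != 0.
Proof. by rewrite invr_neq0 // mulgrp_valP. Qed.
Definition mulgrp_inv x := MulGrp (mulgrp_inv_subproof x).

Fact mulgrp_mulA : associative mulgrp_mul.
Proof. by move=> x y z; apply/val_inj; rewrite /= mulrA. Qed.
Fact mulgrp_mulC : commutative mulgrp_mul.
Proof. by move=> x y; apply/val_inj; rewrite /= mulrC. Qed.
Fact mulgrp_mul1 : left_id mulgrp_one mulgrp_mul.
Proof. by move=> x; apply/val_inj; rewrite /= mul1r. Qed.
Fact mulgrp_mulV : left_inverse mulgrp_one mulgrp_inv mulgrp_mul.
Proof. by move=> x; apply/val_inj; rewrite /= mulVf // mulgrp_valP. Qed.

HB.instance Definition _ := GRing.isZmodule.Build mulgrp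
  mulgrp_mulA mulgrp_mulC mulgrp_mul1 mulgrp_mulV.

Variable m : nat.

Definition mu_pred : {pred mulgrp} := fun x => x *+ m == 0.

Fact mu_closed : zmod_closed mu_pred.
Proof.
split=> [|x y /eqP Hx /eqP Hy]; apply/eqP; first exact: mul0rn.
by rewrite mulrnBl Hx Hy subrr.
Qed.

HB.instance Definition _ := GRing.isZmodClosed.Build mulgrp mu_pred mu_closed.

Definition mu : zmodType := zsub mu_pred.

Definition power_pred : {pred mulgrp} := fun x => `[< exists y, x = y *+ m >].

Fact power_closed : zmod_closed power_pred.
Proof.
split=> [|x y /asboolP[x' ->] /asboolP[y' ->]]; apply/asboolP.
  by exists 0; rewrite mul0rn.
by exists (x' - y'); rewrite mulrnBl.
Qed.

HB.instance Definition _ :=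
  GRing.isZmodClosed.Build mulgrp power_pred power_closed.

Definition mod_powers : zmodType := zquot power_pred.

End MultiplicativeGroup.

Section Subfields.
Variable Omega : fieldType.

Record subfield (E : divringClosed Omega) :=
  Subfield { subfield_val : Omega; subfield_valP : subfield_val \in E }.

Section SubfieldInstances.
Variable E : divringClosed Omega.
HB.instance Definition _ := [isSub for @subfield_val E].
HB.instance Definition _ := [Choice of subfield E by <:].
HB.instance Definition _ := [SubChoice_isSubIntegralDomain of subfield E by <:].
HB.instance Definition _ := [SubIntegralDomain_isSubField of subfield E by <:].
End SubfieldInstances.

Section Image.
Variables (F : fieldType) (iota : {rmorphism F -> Omega}).

Definition image_pred : {pred Omega} := fun x => `[< exists a, x = iota a >].

Fact image_closed : divring_closed image_pred.
Proof.
split; first by apply/asboolP; exists 1; rewrite rmorph1.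
- move=> x y /asboolP[a ->] /asboolP[b ->]; apply/asboolP.
  by exists (a - b); rewrite rmorphB.
- move=> x y /asboolP[a ->] /asboolP[b ->]; apply/asboolP.
  by exists (a / b); rewrite fmorph_div.
Qed.

HB.instance Definition _ :=
  GRing.isDivringClosed.Build Omega image_pred image_closed.

Definition image_field : divringClosed Omega := image_pred.

End Image.

Section Adjoin.
Variables (K : divringClosed Omega) (S : set Omega).

Definition adjoin_pred : {pred Omega} := fun x =>
  `[< forall E : divringClosed Omega,
        {subset K <= E} -> (forall y, S y -> y \in E) -> x \in E >].

Fact adjoin_closed : divring_closed adjoin_pred.
Proof.
split; first by apply/asboolP => E _ _; exact: rpred1.
- move=> x y /asboolP Hx /asboolP Hy; apply/asboolP => E KE SE.
  by rewrite rpredB ?Hx ?Hy.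
- move=> x y /asboolP Hx /asboolP Hy; apply/asboolP => E KE SE.
  by rewrite rpred_div ?Hx ?Hy.
Qed.

HB.instance Definition _ :=
  GRing.isDivringClosed.Build Omega adjoin_pred adjoin_closed.

Definition adjoin : divringClosed Omega := adjoin_pred.

End Adjoin.

Definition adjoin_mu (K : divringClosed Omega) (m : nat) : divringClosed Omega :=
  adjoin K [set w | w ^+ m = 1].

(* [x] lies in the image, under some [K]-embedding into [Omega], of a finite
   Galois extension of [K] of p-power degree. *)
Definition in_galois_pext (p : nat) (K : divringClosed Omega) (x : Omega) :=
  exists (E : splittingFieldType (subfield K)) (j : {rmorphism E -> Omega})
         (k : nat),
    [/\ forall a : subfield K, j a%:A = val a,
        galois 1%AS {:E}%AS,
        \dim {:E} = (p ^ k)%N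
      & exists y, x = j y].

Definition max_pext (p : nat) (K : divringClosed Omega) : divringClosed Omega :=
  adjoin K [set x | in_galois_pext p K x].

End Subfields.

Section GaloisGroup.
Variables (Omega : fieldType) (E K : divringClosed Omega).

Definition is_kaut (g : subfield E -> subfield E) : Prop :=
  [/\ zmod_morphism g, GRing.monoid_morphism g, bijective g
    & forall x, val x \in K -> g x = x].

(* The field automorphisms of [E] that are the identity on [K]; this is the
   Galois group when [E] is a Galois extension of [K]. *)
Record galg := GalG { galg_fun :> subfield E -> subfield E;
                    galg_subproof : `[< is_kaut galg_fun >] }.

HB.instance Definition _ := [isSub for galg_fun].
HB.instance Definition _ := [Choice of galg by <:].

Lemma galgP (g : galg) : is_kaut g.
Proof. exact/asboolP/galg_subproof. Qed.

Lemma galgB (g : galg) : zmod_morphism g. Proof. by have [] := galgP g. Qed.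
Lemma galg_mul (g : galg) : GRing.monoid_morphism g.
Proof. by have [] := galgP g. Qed.
Lemma galg_bij (g : galg) : bijective g. Proof. by have [] := galgP g. Qed.
Lemma galg_fix (g : galg) x : val x \in K -> g x = x.
Proof. by have [_ _ _] := galgP g; apply. Qed.

HB.instance Definition _ (g : galg) :=
  GRing.isZmodMorphism.Build (subfield E) (subfield E) g (galgB g).
HB.instance Definition _ (g : galg) :=
  GRing.isMonoidMorphism.Build (subfield E) (subfield E) g (galg_mul g).

Lemma galg_eqP (g h : galg) : g =1 h -> g = h.
Proof. by move=> gh; apply/val_inj/funext. Qed.

Fact galg_one_subproof : `[< is_kaut id >].
Proof. by apply/asboolP; split=> //; exists id. Qed.
Definition galg_one := GalG galg_one_subproof.

Fact galg_comp_subproof (g h : galg) : `[< is_kaut (g \o h) >].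
Proof.
apply/asboolP; split=> [x y|||x Kx] /=; first by rewrite !raddfB.
- by split=> [|x y] /=; rewrite ?rmorph1 ?rmorphM.
- exact: bij_comp (galg_bij g) (galg_bij h).
- by rewrite !galg_fix.
Qed.
Definition galg_comp g h := GalG (galg_comp_subproof g h).

Fact galg_inv_ex (g : galg) :
  {h : galg | cancel g h /\ cancel h g}.
Proof.
apply: cid; have [h gK hK] := galg_bij g.
suff hP : `[< is_kaut h >] by exists (GalG hP).
apply/asboolP; split=> [x y|||x Kx].
- by apply: (can_inj gK); rewrite (galgB g) !hK.
- split=> [|x y]; apply: (can_inj gK); first by rewrite hK (galg_mul g).1.
  by rewrite (galg_mul g).2 !hK.
- exact: Bijective hK gK.
- by apply: (can_inj gK); rewrite hK galg_fix.
Qed.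
Definition galg_inv g := sval (galg_inv_ex g).

Lemma galg_invK (g : galg) : cancel g (galg_inv g).
Proof. by have [] := svalP (galg_inv_ex g). Qed.
Lemma galg_Kinv (g : galg) : cancel (galg_inv g) g.
Proof. by have [] := svalP (galg_inv_ex g). Qed.

Fact galg_compA : associative galg_comp.
Proof. by move=> f g h; exact: galg_eqP. Qed.
Fact galg_comp1g : left_id galg_one galg_comp.
Proof. by move=> g; exact: galg_eqP. Qed.
Fact galg_compg1 : right_id galg_one galg_comp.
Proof. by move=> g; exact: galg_eqP. Qed.
Fact galg_compVg : left_inverse galg_one galg_inv galg_comp.
Proof. by move=> g; apply: galg_eqP => x /=; rewrite galg_invK. Qed.
Fact galg_compgV : right_inverse galg_one galg_inv galg_comp.
Proof. by move=> g; apply: galg_eqP => x /=; rewrite galg_Kinv. Qed.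

HB.instance Definition _ := isGroup.Build galg
  galg_compA galg_comp1g galg_compg1 galg_compVg galg_compgV.

Lemma galg_mulE (g h : galg) x : (g * h)%g x = g (h x). Proof. by []. Qed.
Lemma galg_oneE x : (1%g : galg) x = x. Proof. by []. Qed.

(* Krull topology: the automorphisms that agree with [g] on a finite subset [s]
   of [E] form the coset of [g] modulo the group that fixes K(s). *)
Definition krull_open (U : set galg) : Prop :=
  forall g, U g -> exists s : seq (subfield E),
    forall h : galg, {in s, h =1 g} -> U h.

Fact krull_openT : krull_open setT.
Proof. by move=> g _; exists [::]. Qed.
Fact krull_openI : setI_closed krull_open.
Proof.
move=> U V oU oV g [/oU[s sU] /oV[t tV]]; exists (s ++ t) => h hg.
by split; [apply: sU | apply: tV] => x xs; apply: hg; rewrite mem_cat xs ?orbT.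
Qed.
Fact krull_open_bigU (I : Type) (f : I -> set galg) :
  (forall i, krull_open (f i)) -> krull_open (\bigcup_i f i).
Proof.
by move=> fo g [i _ /(fo i)[s sf]]; exists s => h hg; exists i => //; exact: sf.
Qed.

HB.instance Definition _ := isOpenTopological.Build galg
  krull_openT krull_openI krull_open_bigU.

Lemma galg_nbhsP (g : galg) (U : set galg) :
  nbhs g U <-> exists s : seq (subfield E), forall h : galg, {in s, h =1 g} -> U h.
Proof.
rewrite nbhsE; split=> [[V [oV Vg] VU]|[s sU]].
  by have [s sV] := oV _ Vg; exists s => h /sV /VU.
exists [set h : galg | {in s, h =1 g}] => //; split=> //.
suff: krull_open [set h : galg | {in s, h =1 g}] by [].
by move=> h hg; exists s => k kh x xs; rewrite kh ?hg.
Qed.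

Fact galg_mul_continuous : continuous (fun x : galg * galg => (x.1 * x.2)%g).
Proof.
move=> [g h] U /galg_nbhsP[s sU].
exists ([set k : galg | {in map h s, k =1 g}], [set k : galg | {in s, k =1 h}]).
  by split; apply/galg_nbhsP; [exists (map h s) | exists s].
move=> [g' h'] [/= Hg Hh]; apply: sU => x xs.
by rewrite !galg_mulE Hh // Hg // map_f.
Qed.

Fact galg_inv_continuous : continuous (fun x : galg => (x^-1)%g).
Proof.
move=> g U /galg_nbhsP[s sU]; apply/galg_nbhsP; exists (map (g^-1)%g s) => h hg.
apply: sU => x xs; apply: (can_inj (galg_invK h)).
by rewrite galg_Kinv hg ?map_f // galg_Kinv.
Qed.

HB.instance Definition _ :=
  Group_isTopGroup.Build galg galg_mul_continuous galg_inv_continuous.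

End GaloisGroup.

(* The restriction of [g] to [E'] is the unique automorphism that agrees with
   [g] on [E']; it exists whenever [E'] is contained in [E] and stable under
   [galg E K], see [restrP]. *)
Definition restr (Omega : fieldType) (E E' K : divringClosed Omega)
    (g : galg E K) : galg E' K :=
  xget 1%g [set s : galg E' K |
    forall (x : subfield E') (y : subfield E), val x = val y ->
      val (s x) = val (g y)].
Arguments restr {Omega E} E' {K} g.

Section RestrictionSpec.
Variables (Omega : fieldType) (E E' K : divringClosed Omega).
Hypothesis E'E : {subset E' <= E}.
Hypothesis stab :
  forall (g : galg E K) x, val x \in E' -> val (g x) \in E'.

Definition restr_in (x : subfield E') : subfield E :=
  Subfield (E'E (subfield_valP x)).
Definition restr_fun (g : galg E K) (x : subfield E') : subfield E' :=
  Subfield (stab g (x := restr_in x) (subfield_valP x)).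

Fact restr_funK (g h : galg E K) : cancel h g -> cancel (restr_fun h) (restr_fun g).
Proof.
move=> hK x; apply/val_inj => /=.
have -> : restr_in (restr_fun h x) = h (restr_in x) by apply/val_inj.
by rewrite hK.
Qed.

Fact restr_fun_kaut (g : galg E K) : is_kaut K (restr_fun g).
Proof.
split=> [x y|||x Kx].
- have E1 : restr_in (x - y) = restr_in x - restr_in y by apply/val_inj.
  by apply/val_inj; rewrite raddfB /= E1 raddfB.
- split=> [|x y].
    have E1 : restr_in 1 = 1 by apply/val_inj.
    by apply/val_inj; rewrite /= E1 rmorph1.
  have E1 : restr_in (x * y) = restr_in x * restr_in y by apply/val_inj.
  by apply/val_inj; rewrite /= E1 rmorphM.
- exact: Bijective (restr_funK (galg_invK g)) (restr_funK (galg_Kinv g)).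
- by apply/val_inj; rewrite /= galg_fix.
Qed.

Lemma restrP (g : galg E K) (x : subfield E') (y : subfield E) :
  val x = val y -> val (restr E' g x) = val (g y).
Proof.
pose s := GalG (introT (asboolP _) (restr_fun_kaut g)).
rewrite /restr; case: xgetP => [t _ Ht|/(_ s) Hs]; first exact: Ht.
case: Hs => {}x {}y xy /=; congr (val (g _)); exact/val_inj.
Qed.

End RestrictionSpec.

Definition fixes (Omega : fieldType) (E K : divringClosed Omega) (g : galg E K)
    (E' : divringClosed Omega) : Prop :=
  forall x : subfield E, val x \in E' -> g x = x.

Section GaloisModules.
Variables (Omega : fieldType) (E K : divringClosed Omega) (m : nat).

Fact galg_mulgrp_subproof (g : galg E K) (x : mulgrp (subfield E)) :
  g (val x) != 0.
Proof. by rewrite fmorph_eq0 mulgrp_valP. Qed.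
Definition galg_mulgrp (g : galg E K) (x : mulgrp (subfield E)) :=
  MulGrp (galg_mulgrp_subproof g x).

Lemma galg_mulgrpB g : zmod_morphism (galg_mulgrp g).
Proof. by move=> x y; apply/val_inj; rewrite /= fmorph_div. Qed.

HB.instance Definition _ g := GRing.isZmodMorphism.Build
  (mulgrp (subfield E)) (mulgrp (subfield E)) (galg_mulgrp g) (galg_mulgrpB g).

Fact galg_mu_subproof g (x : mu (subfield E) m) :
  galg_mulgrp g (val x) \in mu_pred m.
Proof.
have /eqP xm : val x *+ m == 0 := zsub_valP x.
by apply/eqP; rewrite -raddfMn xm raddf0.
Qed.
Definition galg_mu g (x : mu (subfield E) m) : mu (subfield E) m :=
  ZSub (galg_mu_subproof g x).

Fact galg_mu1 x : galg_mu 1%g x = x.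
Proof. by apply/val_inj/val_inj. Qed.
Fact galg_muM g h x : galg_mu (g * h)%g x = galg_mu g (galg_mu h x).
Proof. by apply/val_inj/val_inj. Qed.
Fact galg_muB g : zmod_morphism (galg_mu g).
Proof. by move=> x y; apply/val_inj; rewrite /= raddfB. Qed.
Fact galg_mu_stab_open x : open [set g : galg E K | galg_mu g x = x].
Proof.
move=> g gx; exists [:: val (val x)] => h hg; apply/val_inj/val_inj => /=.
rewrite hg ?mem_head //.
by have := congr1 (fun z : mu (subfield E) m => val (val z)) gx.
Qed.

Definition mu_module : gmodule (galg E K) (mu (subfield E) m) :=
  GModule galg_mu1 galg_muM galg_muB galg_mu_stab_open.

Fact galg_power_subproof g x :
  x \in power_pred m -> galg_mulgrp g x \in power_pred m.
Proof.
move=> /asboolP[y ->]; apply/asboolP.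
by exists (galg_mulgrp g y); rewrite raddfMn.
Qed.

Definition galg_mod_powers g :
    {additive mod_powers (subfield E) m -> mod_powers (subfield E) m} :=
  quot_map (galg_mulgrpB g) (galg_power_subproof g).

End GaloisModules.

(* Same action, for [g] in [galg E K] and the normal subgroup [galg E L]. *)
Section GaloisConjugation.
Variables (Omega : fieldType) (E K L : divringClosed Omega) (m : nat).
Hypothesis L_stable :
  forall (g : galg E K) x, val x \in L -> val (g x) \in L.

Fact galg_conj_subproof (g : galg E K) (s : galg E L) :
  `[< is_kaut L ((g^-1)%g \o s \o g) >].
Proof.
apply/asboolP; split=> [x y|||x Lx] /=; first by rewrite !raddfB.
- by split=> [|x y] /=; rewrite ?rmorph1 ?rmorphM.
- exact: bij_comp (bij_comp (galg_bij _) (galg_bij s)) (galg_bij g).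
- by rewrite (galg_fix s) ?L_stable // galg_invK.
Qed.
Definition galg_conj g s : galg E L := GalG (galg_conj_subproof g s).

Fact galg_conj_compatible (g : galg E K) :
  compatible (mu_module E L m) (mu_module E L m) (galg_conj g) (galg_mu g).
Proof.
split=> [s U /galg_nbhsP[t tU]|s t||s x].
- apply/galg_nbhsP; exists (map g t) => h hs; apply: tU => x xt /=.
  by rewrite hs ?map_f.
- by apply: galg_eqP => x; rewrite galg_mulE /= galg_Kinv.
- exact: galg_muB.
- by apply/val_inj/val_inj; rewrite /= galg_Kinv.
Qed.

Definition coh_conj i (g : galg E K) :
    {additive coh (mu_module E L m) i -> coh (mu_module E L m) i} :=
  coh_map (galg_conj_compatible g) i.

End GaloisConjugation.

Section AdjoinMuStable.
Variables (Omega : fieldType) (E K : divringClosed Omega) (m : nat).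

Lemma adjoin_sub (S : set Omega) : {subset K <= adjoin K S}.
Proof. by move=> x Kx; apply/asboolP => M KM _; exact: KM. Qed.

Lemma mem_adjoin (S : set Omega) x : S x -> x \in adjoin K S.
Proof. by move=> Sx; apply/asboolP => M _; apply. Qed.

Lemma adjoin_mu_sub (K' : divringClosed Omega) :
  {subset K <= K'} -> {subset adjoin_mu K m <= adjoin_mu K' m}.
Proof.
move=> KK' x /asboolP Hx; apply/asboolP => M K'M muM.
by apply: Hx => // y /KK'; exact: K'M.
Qed.

Lemma adjoin_mu_stable : {subset adjoin_mu K m <= E} ->
  forall (g : galg E K) x, val x \in adjoin_mu K m -> val (g x) \in adjoin_mu K m.
Proof.
move=> LE g x Lx; set L := adjoin_mu K m.
pose P : {pred Omega} :=
  fun y => `[< exists2 z : subfield E, y = val z & val (g z) \in L >].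
have Pc : divring_closed P.
  split; first by apply/asboolP; exists 1; rewrite ?rmorph1 ?rpred1.
  - move=> y z /asboolP[y' -> Hy] /asboolP[z' -> Hz]; apply/asboolP.
    by exists (y' - z'); rewrite ?rmorphB ?rpredB.
  - move=> y z /asboolP[y' -> Hy] /asboolP[z' -> Hz]; apply/asboolP.
    by exists (y' / z'); rewrite ?fmorph_div ?rpred_div.
pose PF : divringClosed Omega :=
  HB.pack P (GRing.isDivringClosed.Build Omega P Pc).
have KP : {subset K <= PF}.
  move=> y Ky; have Ey : y \in E by apply/LE/adjoin_sub.
  apply/asboolP; exists (Subfield Ey) => //.
  by rewrite galg_fix //=; exact: adjoin_sub.
have muP y : y ^+ m = 1 -> y \in PF.
  move=> ym; have Ey : y \in E by apply/LE/mem_adjoin.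
  apply/asboolP; exists (Subfield Ey) => //; apply: mem_adjoin => /=.
  have ym' : Subfield Ey ^+ m = 1 by apply/val_inj; rewrite rmorphXn rmorph1.
  have /(congr1 val) : g (Subfield Ey) ^+ m = 1 by rewrite -rmorphXn ym' rmorph1.
  by rewrite rmorphXn rmorph1.
have /asboolP/(_ PF KP muP)/asboolP[z xz] := Lx.
by rewrite (val_inj xz).
Qed.

End AdjoinMuStable.

Section Tower.
Variables (Omega : fieldType) (p : nat) (F : divringClosed Omega).

Definition field_L := adjoin_mu F p.
Definition field_J := adjoin_mu (max_pext p F) p.
Definition field_Lp := max_pext p field_L.

Lemma field_L_stable_Lp (g : galg field_Lp F) x :
  val x \in field_L -> val (g x) \in field_L.
Proof. by apply: adjoin_mu_stable => y; exact: adjoin_sub. Qed.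

Lemma field_L_stable_J (g : galg field_J F) x :
  val x \in field_L -> val (g x) \in field_L.
Proof.
by apply: adjoin_mu_stable; apply: adjoin_mu_sub => y; exact: adjoin_sub.
Qed.

End Tower.

(* Main.v *)
(* Let N' be the intersection of N and G_L, i.e. Gal(L(p)/J). The restriction maps
   G_L -> Gamma_F -> G_F are surjective, the second is a topological isomorphism, and
   on G_L the twisted action on mu_{p^n} is the usual one. Hence H^i(G_F, mu~) is
   H^i(Gamma_F, mu), and it inflates to H^i(G_L, mu). Inner conjugation acts trivially
   on cohomology, so in both targets an element g of Gal(L(p)/F) only contributes the
   scalar theta(g) by which its actions on mu and on mu~ differ.

   The powers g^(p^k) of an element g of Gal(L(p)/F) converge to an element of N of order
   dividing p - 1 that agrees with g on L. It follows that G_L -> G_F is surjective,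
   and that a continuous homomorphism f from N' to mu_{p^n} that is invariant under
   conjugation by N vanishes: f is trivial on commutators of N, so the elements x of N
   with f(x^(p - 1)) = 0 form a subgroup V; it contains all these limits, so every
   element of L(p) that is fixed by V has a p-group of conjugations over F and lies in
   F(p), whence V is dense in N.

   In degree 1 a theta-eigenclass on G_L restricts to such a homomorphism on N', so it
   comes from G_F. In degree 2 a cochain on G_L whose coboundary comes from G_F is
   averaged over N / N', which alpha embeds in the units of Z/p^n as a subgroup of order
   prime to p; the average is such a homomorphism on N' and so descends to G_F. The last
   isomorphism of (i) is Kummer theory. *)
From HB Require Import structures.
Require Import Defs.
From mathcomp Require Import all_boot all_order all_algebra all_fingroup all_field.
From mathcomp Require Import generic_quotient ring_quotient cyclic pgroup zify.
From mathcomp Require Import boolp classical_sets functions topology function_spaces.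

Set Implicit Arguments.
Unset Strict Implicit.
Unset Printing Implicit Defensive.

Import GRing.Theory.

Local Open Scope ring_scope.

(** * Extension of embeddings and normal extensions inside [Omega] *)

(** F(p) is defined through abstract finite Galois extensions and their embeddings. The proof works
    instead with ring endomorphisms of Omega over a subfield, which are invertible because Omega is
    algebraic over F: membership in a maximal p-extension becomes [p_closed], and restrictions,
    lifts and conjugates are all compared inside Omega. The vanishing on N' serves both degrees, for
    different reasons. In degree 1 the eigenvalue equation reads alpha(t) f(t^-1 x t) = theta(t)
    f(x) on N', where coboundaries vanish, and for t in N the two scalars cancel. In degree 2 a
    primitive k on G_L of an inflated cocycle need not be N-invariant on N'. Conjugation by t in N,
    however, changes neither the inflated cocycle, since t is trivial on F(p), nor the action on the
    roots of unity, since alpha has abelian values. So, once k is normalised, its conjugates all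
    have the same coboundary and can be averaged. The number p - 1 enters as the exponent that kills
    Gal(L/F); multiplication by it is injective on mu_{p^n}. *)

Lemma algebraic_minimal (E Omega : fieldType) (j : {rmorphism E -> Omega}) x :
  algebraicOver j x ->
  exists m : {poly E}, [/\ irreducible_poly m, m != 0, root (map_poly j m) x
    & forall q, root (map_poly j q) x -> q != 0 -> (size m <= size q)%N].
Proof.
case=> q q0 qx.
have exm : exists k, `[< exists q : {poly E},
    [/\ q != 0, root (map_poly j q) x & size q = k] >].
  by exists (size q); apply/asboolP; exists q.
case: (ex_minnP exm) => k /asboolP[m [m0 mx mk] kmin]; exists m.
have mmin q' : root (map_poly j q') x -> q' != 0 -> (size m <= size q')%N.
  by move=> qx' q0'; rewrite mk kmin //; apply/asboolP; exists q'.
by split=> //; apply/(subfx_irreducibleP mx m0).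
Qed.

Section ExtendEmbedding.
Variables (E : fieldType) (Omega : closedFieldType).
Variables (j j' : {rmorphism E -> Omega}).
Hypothesis algj : forall x, algebraicOver j x.

(* Graphs of ring morphisms from a subfield of [Omega] that extend [j e |-> j' e]. *)
Let partial (G : set (Omega * Omega)) : Prop :=
  [/\ forall e, G (j e, j' e),
      forall u v, G u -> G v -> G (u.1 - v.1, u.2 - v.2),
      forall u v, G u -> G v -> G (u.1 * v.1, u.2 * v.2),
      forall u, G u -> G (u.1^-1, u.2^-1)
    & forall b, G (0, b) -> b = 0].

Let base : set (Omega * Omega) := [set u | exists e, u = (j e, j' e)]%classic.

Let base_partial : partial base.
Proof.
split=> [e|u v [a ->] [b ->]|u v [a ->] [b ->]|u [a ->]|b [a [a0 ->]]].
- by exists e.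
- by exists (a - b); rewrite !rmorphB.
- by exists (a * b); rewrite !rmorphM.
- by exists a^-1; rewrite !fmorphV.
- by move/esym/eqP: a0; rewrite fmorph_eq0 => /eqP ->; rewrite rmorph0.
Qed.

Let maximal_partial : exists2 G, partial G &
  forall H, partial H -> (G `<=` H)%classic -> (H `<=` G)%classic.
Proof.
(* Zorn's lemma is applied to the sets whose union with [base] is partial: the union of the empty
   chain is empty and has to qualify too. *)
have [F FP Ftot|A [PA Amax]] := @Zorn_bigcup (Omega * Omega)
    [set G | partial (G `|` base)]%classic; last first.
  exists (A `|` base)%classic => // H PH AH u Hu; left.
  have HbE : (H `|` base)%classic = H.
    by rewrite setUidl // => v vb; apply: AH; right.
  apply: contrapT => Au; apply: (Amax H); last by rewrite /= HbE.
  by split=> [v Av|/(_ u Hu)//]; apply: AH; left.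
set U := (\bigcup_(X in F) X `|` base)%classic.
have bU : (base `<=` U)%classic by move=> u; right.
have FU X : F X -> (X `|` base `<=` U)%classic.
  by move=> FX u [Xu|bu]; [left; exists X | right].
have one u : U u -> exists Y, [/\ partial Y, Y u & (Y `<=` U)%classic].
  case=> [[X FX Xu]|bu]; last by exists base.
  by exists (X `|` base)%classic; split; [exact: FP| left | exact: FU].
have two u v : U u -> U v ->
    exists Y, [/\ partial Y, Y u, Y v & (Y `<=` U)%classic].
  case=> [[X FX Xu]|bu]; case=> [[Y FY Yv]|bv].
  - have [XY|YX] := Ftot _ _ FX FY.
      exists (Y `|` base)%classic.
      by split; [exact: FP | left; exact: XY | left | exact: FU].
    exists (X `|` base)%classic.
    by split; [exact: FP | left | left; exact: YX | exact: FU].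
  - by exists (X `|` base)%classic; split; [exact: FP|left|right|exact: FU].
  - by exists (Y `|` base)%classic; split; [exact: FP|right|left|exact: FU].
  - by exists base.
split=> [e|u v Uu Uv|u v Uu Uv|u Uu|b Ub].
- by right; exists e.
- by have [Y [[_ YB _ _ _] Yu Yv]] := two _ _ Uu Uv; apply; exact: YB.
- by have [Y [[_ _ YM _ _] Yu Yv]] := two _ _ Uu Uv; apply; exact: YM.
- by have [Y [[_ _ _ YV _] Yu]] := one _ Uu; apply; exact: YV.
- by have [Y [[_ _ _ _ Y0] Yb _]] := one _ Ub; exact: Y0.
Qed.

(** A maximal partial morphism is total: if x has minimal polynomial m over its domain, the image of
    m has a root x' in the closed field, and sending f(x) to the image of f evaluated at x' extends
    the morphism to x. *)
Lemma extend_embedding :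
  exists S : {rmorphism Omega -> Omega}, forall e, S (j e) = j' e.
Proof.
have [G PG Gmax] := maximal_partial.
have [Gb GB GM GV G0] := PG.
have Gfun a b c : G (a, b) -> G (a, c) -> b = c.
  move=> ab ac; apply/eqP; rewrite -subr_eq0; apply/eqP/G0.
  by have /= := GB _ _ ab ac; rewrite subrr.
have G1 : G (1, 1) by have := Gb 1; rewrite !rmorph1.
suff Gtot x : exists b, G (x, b).
  pose s x := projT1 (cid (Gtot x)).
  have sG x : G (x, s x) by rewrite /s; case: cid.
  have sB : zmod_morphism s.
    by move=> x y; apply: Gfun (sG _) (GB _ _ (sG x) (sG y)).
  have sM : GRing.monoid_morphism s.
    split; first exact: Gfun (sG _) G1.
    by move=> x y; apply: Gfun (sG _) (GM _ _ (sG x) (sG y)).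
  pose sZ := GRing.isZmodMorphism.Build _ _ s sB.
  pose sMM := GRing.isMonoidMorphism.Build _ _ s sM.
  exists (HB.pack s sZ sMM : {rmorphism Omega -> Omega}) => e /=.
  exact: Gfun (sG _) (Gb e).
pose D : {pred Omega} := fun a => `[< exists b, G (a, b) >].
have Dc : divring_closed D.
  split; first by apply/asboolP; exists 1.
    move=> a b /asboolP[a' Ga] /asboolP[b' Gb']; apply/asboolP.
    by exists (a' - b'); exact: (GB _ _ Ga Gb').
  move=> a b /asboolP[a' Ga] /asboolP[b' Gb']; apply/asboolP.
  by exists (a' / b'); exact: (GM _ _ Ga (GV _ Gb')).
pose DF : divringClosed Omega :=
  HB.pack D (GRing.isDivringClosed.Build Omega D Dc).
pose K := subfield DF.
have Kex (a : K) : exists b, G (val a, b) by exact/asboolP/(valP a).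
pose s (a : K) := projT1 (cid (Kex a)).
have sG a : G (val a, s a) by rewrite /s; case: cid.
have sB : zmod_morphism s.
  move=> a b; apply: (Gfun (val (a - b))); first exact: sG.
  by rewrite rmorphB; exact: (GB _ _ (sG a) (sG b)).
have sM : GRing.monoid_morphism s.
  split; first by apply: (Gfun (val (1 : K))); [exact: sG | rewrite rmorph1].
  move=> a b; apply: (Gfun (val (a * b))); first exact: sG.
  by rewrite rmorphM; exact: (GM _ _ (sG a) (sG b)).
pose sZ := GRing.isZmodMorphism.Build _ _ s sB.
pose sMM := GRing.isMonoidMorphism.Build _ _ s sM.
pose sR := HB.pack s sZ sMM : {rmorphism K -> Omega}.
pose v : {rmorphism K -> Omega} := val.
have EK e : j e \in DF by apply/asboolP; exists (j' e); exact: Gb.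
pose jK e : K := Subfield (EK e).
have jKB : zmod_morphism jK by move=> a b; apply/val_inj; rewrite /= rmorphB.
have jKM : GRing.monoid_morphism jK.
  split; first by apply/val_inj; rewrite /= rmorph1.
  by move=> a b; apply/val_inj; rewrite /= rmorphM.
pose jZ := GRing.isZmodMorphism.Build _ _ jK jKB.
pose jMM := GRing.isMonoidMorphism.Build _ _ jK jKM.
pose jR := HB.pack jK jZ jMM : {rmorphism E -> K}.
have algx : algebraicOver v x.
  have [q q0 qx] := algj x; exists (map_poly jR q); first by rewrite map_poly_eq0.
  by rewrite -map_poly_comp.
have [m [irr m0 mx mmin]] := algebraic_minimal algx.
have mdvd (f : {poly K}) : root (map_poly v f) x -> m %| f.
  move=> fx; apply: contraT; rewrite /dvdp => r0.
  suff /mmin/(_ r0) : root (map_poly v (f %% m)) x by rewrite leqNgt ltn_modp m0.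
  move: fx; rewrite {1}(divp_eq f m) rmorphD rmorphM /= /root hornerD hornerM.
  by rewrite (eqP mx) mulr0 add0r.
have [x' x'P] : exists x', root (map_poly sR m) x'.
  by apply/closed_rootP; rewrite size_map_poly; have [] := irr; case: size => [|[|]].
pose ev (f : {poly K}) := ((map_poly v f).[x], (map_poly sR f).[x']).
pose H : set (Omega * Omega) := [set u | exists f, u = ev f]%classic.
have evC a : ev a%:P = (val a, s a) by rewrite /ev !map_polyC /= !hornerC.
have GH : (G `<=` H)%classic.
  case=> a b Gab; have Da : a \in DF by apply/asboolP; exists b.
  exists (Subfield Da)%:P; rewrite evC /=; congr (_, _).
  exact: Gfun Gab (sG (Subfield Da)).
have ev0 f : (ev f).1 = 0 -> (ev f).2 = 0.
  move=> /eqP /mdvd mf; rewrite -[LHS]/((map_poly sR f).[x']).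
  rewrite -(divpK mf) [map_poly _ _]rmorphM hornerM.
  by rewrite (eqP x'P : (map_poly sR m).[x'] = 0) mulr0.
have PH : partial H.
  split=> [e|_ _ [f ->] [g ->]|_ _ [f ->] [g ->]|_ [f ->]|b [f fE]].
  - exact/GH/Gb.
  - by exists (f - g); rewrite /ev !rmorphB !hornerD !hornerN.
  - by exists (f * g); rewrite /ev !rmorphM !hornerM.
  - have [fx0|fx0] := eqVneq (ev f).1 0.
      by exists f; rewrite fx0 (ev0 _ fx0) invr0 [RHS]surjective_pairing fx0 ev0.
    (* A single Bezout cofactor of [f] modulo [m] inverts the values of [f] at both roots. *)
    have /Bezout_eq1_coprimepP[[g h] ghE] : coprimep f m.
      rewrite coprimep_sym irreducible_poly_coprime // ?size_poly_eq0 //.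
      apply: contraNN fx0 => mf; rewrite -[eqbLHS]/((map_poly v f).[x]).
      rewrite -(divpK mf) [map_poly _ _]rmorphM hornerM.
      by rewrite (eqP mx : (map_poly v m).[x] = 0) mulr0.
    exists g; have inv1 (w : {rmorphism K -> Omega}) y :
        root (map_poly w m) y -> (map_poly w f).[y]^-1 = (map_poly w g).[y].
      move=> /eqP my; move/(congr1 (fun q => (map_poly w q).[y])): ghE.
      rewrite rmorphD !rmorphM rmorph1 /= hornerD !hornerM hornerC my.
      rewrite mulr0 addr0 => gf.
      have f0 : (map_poly w f).[y] != 0.
        by apply/eqP => f0; move/eqP: gf; rewrite f0 mulr0 eq_sym oner_eq0.
      by apply: (mulIf f0); rewrite mulVf.
    by rewrite /ev /=; congr (_, _); [exact: (inv1 v x mx) | exact: (inv1 sR x' x'P)].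
  - by move: (congr1 fst fE) (congr1 snd fE) => /= /esym/ev0 <-.
by exists (ev 'X).2; apply: (Gmax _ PH GH); exists 'X; rewrite /ev !map_polyX !hornerX.
Qed.

End ExtendEmbedding.

(** The orbit of x consists of roots of one polynomial over F, so it is finite; as f is injective, x
    itself recurs and is a value of f. *)
Lemma endo_bij (F E : fieldType) (k : {rmorphism F -> E}) (f : {rmorphism E -> E}) :
  (forall a, f (k a) = k a) -> (forall x, algebraicOver k x) -> bijective f.
Proof.
move=> fk kalg.
have fsurj x : exists y, f y = x.
  have [q q0 qx] := kalg x.
  have qit i : root (map_poly k q) (iter i f x).
    elim: i => //= i IH.
    have -> : map_poly k q = map_poly f (map_poly k q).
      by rewrite -map_poly_comp; apply: eq_map_poly => a; rewrite /= fk.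
    by rewrite fmorph_root.
  have : looping f x (size q).
    apply: contraT; rewrite -looping_uniq => ut.
    have := @max_poly_roots _ (map_poly k q) (traject f x (size q).+1).
    rewrite map_poly_eq0 size_map_poly size_traject => /(_ q0).
    have -> : all (root (map_poly k q)) (traject f x (size q).+1).
      by apply/allP => _ /trajectP[i _ ->].
    by rewrite ltnNge leqnSn => /(_ isT ut).
  case/trajectP => i ilt; rewrite -(subnKC ilt) addSn -addnS iterD.
  have iterI m : injective (iter m f).
    by elim: m => //= m IH a b /(fmorph_inj f) /IH.
  by move=> /iterI /= <-; eexists.
exists (fun x => projT1 (cid (fsurj x))) => x; last by case: cid.
by apply: (fmorph_inj f); case: cid.
Qed.

Section Preimage.
Variables (E Omega : fieldType) (j : {rmorphism E -> Omega}) (M : divringClosed Omega).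

Definition preim_pred : {pred E} := fun e => j e \in M.

Fact preim_closed : divring_closed preim_pred.
Proof.
split=> [|x y|x y]; rewrite -?[_ \in preim_pred]/(j _ \in M) ?rmorph1 ?rpred1 //.
  by rewrite rmorphB; exact: rpredB.
by rewrite fmorph_div; exact: rpred_div.
Qed.

HB.instance Definition _ := GRing.isDivringClosed.Build E preim_pred preim_closed.

Definition preim_field : divringClosed E := preim_pred.

End Preimage.

Section FiniteExtension.
Variables (Omega : closedFieldType) (K : divringClosed Omega).
Let K0 := subfield K.
Let valK : {rmorphism K0 -> Omega} := val.

(** The last clause says that the image of [E] is generated by [rs] over [K]; quantifying over all
    subfields lets the induction pass it on. *)
Lemma finite_extension (rs : seq Omega) :
  {in rs, forall x, algebraicOver valK x} ->
  exists (E : fieldExtType K0) (j : {rmorphism E -> Omega}),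
    [/\ forall a : K0, j a%:A = val a, {in rs, forall x, exists e, j e = x}
      & forall M : divringClosed Omega, {subset K <= M} -> {subset rs <= M} ->
          forall e, j e \in M].
Proof.
elim: rs => [|x rs IH] alg_rs.
  exists (K0^o : fieldExtType K0), valK; split=> // [a|M KM _ e].
    by rewrite /= mulr1.
  by apply: KM; exact: (valP e).
have [|E [j [jK jrs jM]]] := IH; first by move=> y yr; apply: alg_rs; rewrite inE yr orbT.
have algx : algebraicOver j x.
  have [|q q0 qx] := alg_rs x; first exact: mem_head.
  exists (map_poly (in_alg E) q); first by rewrite map_poly_eq0.
  rewrite -map_poly_comp (_ : map_poly _ q = map_poly valK q) //.
  by apply: eq_map_poly => a; rewrite /= jK.
have [m [irr m0 mx _]] := algebraic_minimal algx.
pose E1 : fieldExtType E := SubFieldExtType mx irr.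
pose E2 : fieldExtType K0 := baseFieldType E1.
pose j1 : {rmorphism E1 -> Omega} := subfx_inj.
pose j2 : {rmorphism E2 -> Omega} := j1.
exists E2, j2; split=> [a|y|M KM xM e].
- rewrite /j2 baseField_scaleE -jK; exact: subfx_inj_base.
- rewrite inE => /predU1P[->|/jrs[e <-]].
    by exists (subfx_root j x m); exact: subfx_inj_root.
  by exists ((e%:A : E1) : E2); exact: subfx_inj_base.
- have [q ->] := subfxE (e : subFExtend j x m).
  rewrite [j2 _](subfx_inj_eval mx m0).
  have jin a : j a \in M.
    by apply: jM => // y yr; apply: xM; rewrite inE yr orbT.
  rewrite rpred_horner ?xM ?mem_head //.
  by apply/polyOverP => i; rewrite coef_map /=.
Qed.

(** The polynomial is given by its distinct roots and need not be irreducible, which makes the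
    notion visibly stable under conjugation and under enlarging [K]. *)
Definition separable_over (x : Omega) : Prop := exists rs : seq Omega,
  [/\ uniq rs, x \in rs & \prod_(r <- rs) ('X - r%:P) \is a polyOver K].

Lemma polyOver_lift (P : {poly Omega}) :
  P \is a polyOver K -> exists q : {poly K0}, map_poly valK q = P.
Proof.
move/polyOverP => PK; exists (\poly_(i < size P) Subfield (PK i)).
apply/polyP => i; rewrite coef_map coef_poly.
by case: ltnP => // iP; rewrite nth_default // rmorph0.
Qed.

Lemma separable_over_algebraic x : separable_over x -> algebraicOver valK x.
Proof.
case=> rs [_ xrs rsK].
have [q qE] := polyOver_lift rsK.
exists q; last by rewrite qE root_prod_XsubC.
rewrite -(map_poly_eq0 valK) qE; apply: monic_neq0; exact: monic_prod_XsubC.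
Qed.

(** The extension generated by [rs] splits the given product, and each generator is a root of a
    polynomial with distinct roots; hence it is Galois. *)
Lemma normal_extension (rs : seq Omega) :
  \prod_(r <- rs) ('X - r%:P) \is a polyOver K ->
  {in rs, forall x, separable_over x} ->
  exists (E : splittingFieldType K0) (j : {rmorphism E -> Omega}),
    [/\ forall a : K0, j a%:A = val a, galois 1%AS {:E}%AS,
      {in rs, forall x, exists e, j e = x}
      & forall M : divringClosed Omega, {subset K <= M} -> {subset rs <= M} ->
          forall e, j e \in M].
Proof.
move=> rsK rsep.
have [x xr|E [j [jK jrs jM]]] := @finite_extension rs.
  exact: separable_over_algebraic (rsep x xr).
have [s sE] : exists s, map j s = rs.
  elim: (rs) jrs => [|x r IH] jr; first by exists [::].
  have [|s <-] := IH; first by move=> y yr; apply: jr; rewrite inE yr orbT.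
  by have [|e <-] := jr x; [exact: mem_head | exists (e :: s)].
have j1 e : (e \in 1%VS) = (j e \in K).
  apply/idP/idP => [/vlineP[a ->]|jeK]; first by rewrite jK; exact: (valP a).
  apply/vlineP; exists (Subfield jeK); apply: (fmorph_inj j).
  by rewrite jK.
have polyOver1 p : (p \is a polyOver 1%VS) = (map_poly j p \is a polyOver K).
  apply/polyOverP/polyOverP => pK i; first by rewrite coef_map -j1.
  by rewrite j1 -coef_map.
have prodE r : map_poly j (\prod_(x <- r) ('X - x%:P)) =
    \prod_(x <- map j r) ('X - x%:P).
  rewrite rmorph_prod big_map; apply: eq_bigr => x _.
  by rewrite rmorphB /= map_polyX map_polyC.
(* The images of the elements of <<1 & s>> form a subfield of Omega that contains [K] and [rs],
   hence all of j(E). *)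
have genE : <<1 & s>>%VS = {:E}%VS.
  apply/eqP; rewrite eqEsubv subvf /=; apply/subvP => e _.
  pose M : {pred Omega} := fun y => `[< exists2 e, e \in <<1 & s>>%VS & y = j e >].
  have Mc : divring_closed M.
    split; first by apply/asboolP; exists 1; rewrite ?rmorph1 ?rpred1.
    - move=> y z /asboolP[a aM ->] /asboolP[b bM ->]; apply/asboolP.
      by exists (a - b); rewrite ?rmorphB ?rpredB.
    - move=> y z /asboolP[a aM ->] /asboolP[b bM ->]; apply/asboolP.
      by exists (a / b); rewrite ?fmorph_div ?rpred_div.
  pose MF : divringClosed Omega :=
    HB.pack M (GRing.isDivringClosed.Build Omega M Mc).
  suff /asboolP[e1 e1M /(fmorph_inj j) eE] : j e \in MF by rewrite eE.
  apply: (jM MF) => y; first move=> Ky.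
    apply/asboolP; exists (Subfield Ky)%:A; last by rewrite jK.
    by rewrite rpredZ // rpred1.
  rewrite -sE => /mapP[a asx ->]; apply/asboolP; exists a => //.
  exact: seqv_sub_adjoin.
have splitE : splitting_field_axiom E.
  exists (\prod_(x <- s) ('X - x%:P)); first by rewrite polyOver1 prodE sE.
  by exists s; rewrite ?eqpxx.
pose ES : splittingFieldType K0 :=
  HB.pack (FieldExt.sort E) (FieldExt_isSplittingField.Build K0 E splitE).
exists ES, j; split=> //.
apply/and3P; split; first exact: sub1v.
- suff : separable (1%AS : {subfield E}) <<1 & s>> by rewrite genE.
  apply: separable_Fadjoin_seq; apply/allP => a asx.
  have /rsep[t [tu at_ tK]] : j a \in rs by rewrite -sE map_f.
  have [q qE] := polyOver_lift tK.
  have jq : map_poly j (map_poly (in_alg E) q) = \prod_(r <- t) ('X - r%:P).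
    by rewrite -map_poly_comp -qE; apply: eq_map_poly => c; rewrite /= jK.
  apply/separable_elementP; exists (map_poly (in_alg E) q); split.
  + by rewrite polyOver1 jq.
  + by rewrite -(fmorph_root j) jq root_prod_XsubC.
  + by rewrite -(separable_map j) jq separable_prod_XsubC.
- apply/splitting_normalField; first exact: sub1v.
  by exists (\prod_(x <- s) ('X - x%:P)); 
    [rewrite polyOver1 prodE sE | exists s; rewrite ?eqpxx].
Qed.
End FiniteExtension.

Lemma adjoin_subset (Omega : fieldType) (K : divringClosed Omega) S
    (M : divringClosed Omega) :
  {subset K <= M} -> (forall x, S x -> x \in M) -> {subset adjoin K S <= M}.
Proof. by move=> KM SM x /asboolP; apply. Qed.

Lemma adjoin_finite (Omega : fieldType) (K : divringClosed Omega) S y :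
  y \in adjoin K S -> exists s : seq Omega,
    (forall x, x \in s -> S x) /\ y \in adjoin K [set x | x \in s]%classic.
Proof.
pose P : {pred Omega} := fun y => `[< exists s : seq Omega,
    (forall x, x \in s -> S x) /\ y \in adjoin K [set x | x \in s]%classic >].
have mono (s t : seq Omega) : {subset s <= t} ->
    {subset adjoin K [set x | x \in s]%classic <= adjoin K [set x | x \in t]%classic}.
  move=> st; apply: adjoin_subset; first exact: adjoin_sub.
  by move=> x /= /st xt; exact: mem_adjoin.
have two x z : x \in P -> z \in P -> exists s : seq Omega,
    [/\ forall x, x \in s -> S x, x \in adjoin K [set x | x \in s]%classic
      & z \in adjoin K [set x | x \in s]%classic].
  move=> /asboolP[s [sS xs]] /asboolP[t [tS zt]]; exists (s ++ t); split.
  - by move=> w; rewrite mem_cat => /orP[/sS|/tS].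
  - by apply: mono xs => w ws; rewrite mem_cat ws.
  - by apply: mono zt => w wt; rewrite mem_cat wt orbT.
have Pc : divring_closed P.
  split; first by apply/asboolP; exists [::]; split=> //; exact: rpred1.
  - move=> x z xP zP; have [s [sS xs zs]] := two x z xP zP.
    by apply/asboolP; exists s; split=> //; exact: rpredB.
  - move=> x z xP zP; have [s [sS xs zs]] := two x z xP zP.
    by apply/asboolP; exists s; split=> //; exact: rpred_div.
pose PF : divringClosed Omega :=
  HB.pack P (GRing.isDivringClosed.Build Omega P Pc).
move=> yS; suff /asboolP : y \in PF by [].
apply: adjoin_subset yS => [x Kx|x Sx]; apply/asboolP.
  by exists [::]; split=> //; exact: adjoin_sub.
by exists [:: x]; split=> [z|]; [rewrite inE => /eqP -> | apply: mem_adjoin; exact: mem_head].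
Qed.

(** * Endomorphisms over a subfield and its maximal p-extension *)

Section Conjugation.
Variables (Omega : closedFieldType) (K : divringClosed Omega).
Let K0 := subfield K.
Let valK : {rmorphism K0 -> Omega} := val.
Hypothesis algK : forall x, algebraicOver valK x.

Section NormalModel.
Variables (E : splittingFieldType K0) (j : {rmorphism E -> Omega}).
Hypothesis jK : forall a : K0, j a%:A = val a.

Lemma galois_extend (phi : gal_of {:E}) : exists s : {rmorphism Omega -> Omega},
  {in K, s =1 id} /\ forall e, s (j e) = j (phi e).
Proof.
have [|s sE] := @extend_embedding E Omega j (j \o phi).
  move=> x; have [q q0 qx] := algK x.
  exists (map_poly (in_alg E) q); first by rewrite map_poly_eq0.
  rewrite -map_poly_comp (_ : map_poly _ q = map_poly valK q) //.
  by apply: eq_map_poly => a; rewrite /= jK.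
exists s; split=> // a Ka.
have := sE (Subfield Ka)%:A; rewrite jK /= => ->.
by rewrite linearZ /= rmorph1 jK.
Qed.

(** An endomorphism over [K] sends roots of a minimal polynomial to roots of it, and these all lie
    in j(E); so it maps j(E) into itself. *)
Lemma galois_restrict (h : {rmorphism Omega -> Omega}) :
  galois 1%AS {:E}%AS -> {in K, h =1 id} ->
  exists2 phi : gal_of {:E}, phi \in 'Gal({:E} / 1%AS)%g &
    forall e, h (j e) = j (phi e).
Proof.
move=> galE hK.
have hj e : exists e', j e' = h (j e).
  have /(galois_factors (sub1v _))/(_ e (memvf _))[r [_ _ mE]] := galE.
  have : root (map_poly j (minPoly 1%AS e)) (h (j e)).
    have -> : map_poly j (minPoly 1%AS e) = map_poly h (map_poly j (minPoly 1%AS e)).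
      apply/polyP => i; rewrite !coef_map /=.
      have /polyOverP/(_ i)/vlineP[a ->] := minPolyOver 1%AS e.
      by rewrite jK hK //; exact: (valP a).
    by rewrite !fmorph_root root_minPoly.
  rewrite mE rmorph_prod /= big_map.
  under eq_bigr do rewrite rmorphB /= map_polyX map_polyC /=.
  rewrite -(big_map (fun x : gal_of _ => j (x e)) predT (fun x => 'X - x%:P)).
  by rewrite root_prod_XsubC => /mapP[x _ ->]; exists (x e).
pose f e := projT1 (cid (hj e)).
have fE e : j (f e) = h (j e) by rewrite /f; case: cid.
have fL : linear f.
  move=> a x y; apply: (fmorph_inj j).
  rewrite fE -(mulr_algl a x) -(mulr_algl a (f x)) !(rmorphD j, rmorphM j).
  rewrite (rmorphD h) (rmorphM h) !fE.
  by rewrite jK hK //; exact: (valP a).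
pose fLin : {linear E -> E} := HB.pack f (GRing.isLinear.Build _ _ _ _ f fL).
have fM : kAut 1%AS {:E}%AS (linfun fLin).
  rewrite kAutfE; apply/kHomP; split=> [x y _ _|x /vlineP[a ->]]; rewrite !lfunE /=.
    by apply: (fmorph_inj j); rewrite fE (rmorphM j) (rmorphM h) (rmorphM j) !fE.
  by apply: (fmorph_inj j); rewrite fE jK hK //; exact: (valP a).
have [phi phiG phiE] := kAut_to_gal fM; exists phi => // e.
by rewrite -phiE ?memvf // lfunE /= fE.
Qed.

End NormalModel.

Lemma separable_family (s : seq Omega) : {in s, forall x, separable_over K x} ->
  exists rs, [/\ {subset s <= rs}, \prod_(r <- rs) ('X - r%:P) \is a polyOver K
    & {in rs, forall x, separable_over K x}].
Proof.
elim: s => [|x s IH] sep_s; first by exists [::]; split=> //; rewrite big_nil rpred1.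
have [|rs [srs rsK rsep]] := IH; first by move=> y ys; apply: sep_s; rewrite inE ys orbT.
have [ts [tu xts tsK]] := sep_s x (mem_head _ _).
exists (ts ++ rs); split.
- move=> y; rewrite inE mem_cat => /predU1P[->|/srs ->]; first by rewrite xts.
  by rewrite orbT.
- by rewrite big_cat rpredM.
- by move=> y; rewrite mem_cat => /orP[yts|/rsep //]; exists ts.
Qed.

(** [y] involves finitely many generators, so it lies in a finite Galois extension. All
    automorphisms of that extension extend to Omega, and the finite Galois correspondence
    applies. *)
Lemma fixed_mem (S : set Omega) y : (forall x, S x -> separable_over K x) ->
  y \in adjoin K S ->
  (forall h : {rmorphism Omega -> Omega}, {in K, h =1 id} -> h y = y) -> y \in K.
Proof.
move=> Ssep /adjoin_finite[s [sS ys]] yfix.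
have [|rs [srs rsK rsep]] := @separable_family s; first by move=> x /sS /Ssep.
have [E [j [jK galE jrs _]]] := normal_extension rsK rsep.
have /asboolP[e ye] : y \in image_field j.
  apply: adjoin_subset ys => [a Ka|x /srs /jrs[e <-]]; apply/asboolP.
    by exists (Subfield Ka)%:A; rewrite jK.
  by exists e.
suff : e \in 1%VS by rewrite ye => /vlineP[a ->]; rewrite jK; exact: (valP a).
have fE := galois_fixedField galE.
suff : e \in fixedField 'Gal({:E} / 1%AS)%g by rewrite fE.
apply/(fixedFieldP (memvf _)) => phi phiG.
have [h [hK hE]] := galois_extend jK phi.
by apply: (fmorph_inj j); rewrite -hE -ye yfix.
Qed.

(* This describes the elements of the maximal p-extension of [K] in a way that is
   visibly stable under conjugation and under enlarging [K]. *)
Definition p_closed (p : nat) (x : Omega) : Prop :=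
  separable_over K x /\
  forall h s : {rmorphism Omega -> Omega}, {in K, h =1 id} -> {in K, s =1 id} ->
    exists r, iter (p ^ r) h (s x) = s x.

Lemma iter_gal (E : splittingFieldType K0) (phi : gal_of {:E}) m e :
  iter m phi e = (phi ^+ m)%g e.
Proof.
elim: m => [|m IH]; first by rewrite gal_id.
by rewrite expgSr galM ?memvf //= IH.
Qed.

(** On a Galois extension of degree p^k an endomorphism acts as a group element, whose p^k-th power
    is trivial. *)
Lemma galois_pext_closed p x : in_galois_pext p K x -> p_closed p x.
Proof.
case=> E [j [k [jK galE dimE [e ->]]]]; split.
  have /(galois_factors (sub1v _))/(_ e (memvf _))[r [_ ur mE]] := galE.
  have jmE : map_poly j (minPoly 1%AS e) =
      \prod_(b <- [seq j ((x : gal_of _) e) | x <- r]) ('X - b%:P).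
    rewrite mE rmorph_prod /= !big_map; apply: eq_bigr => i _.
    by rewrite rmorphB /= map_polyX map_polyC.
  exists [seq j ((x : gal_of _) e) | x <- r]; split.
  - by rewrite (map_comp j (fun x : gal_of _ => x e)) map_inj_uniq //; exact: fmorph_inj.
  - by rewrite -root_prod_XsubC -jmE fmorph_root root_minPoly.
  - rewrite -jmE; apply/polyOverP => i; rewrite coef_map /=.
    have /polyOverP/(_ i)/vlineP[a ->] := minPolyOver 1%AS e.
    by rewrite jK; exact: (valP a).
move=> h s hK sK; exists k.
have [phi phiG phiE] := galois_restrict jK galE hK.
have [psi _ psiE] := galois_restrict jK galE sK.
rewrite psiE.
have itE m : iter m h (j (psi e)) = j (iter m phi (psi e)).
  by elim: m => //= m ->; rewrite phiE.
rewrite itE iter_gal -dimE.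
have <- : #|'Gal({:E} / 1%AS)%g| = \dim {:E}.
  by rewrite -(galois_dim galE) dimv1 divn1.
by rewrite expg_cardG // gal_id.
Qed.

Lemma iter_pow_fix (T : eqType) (f : T -> T) m k x :
  iter m f x = x -> iter (m * k) f x = x.
Proof.
by move=> fx; elim: k => [|k IH]; rewrite ?muln0 // mulnS iterD IH.
Qed.

Lemma separable_conj x (s : {rmorphism Omega -> Omega}) :
  (forall a, a \in K -> s a \in K) -> separable_over K x -> separable_over K (s x).
Proof.
move=> sK [rs [urs xrs rsK]]; exists (map s rs); split.
- by rewrite map_inj_uniq //; exact: fmorph_inj.
- exact: map_f.
- have -> : \prod_(r <- map s rs) ('X - r%:P) = map_poly s (\prod_(r <- rs) ('X - r%:P)).
    rewrite rmorph_prod big_map; apply: eq_bigr => i _.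
    by rewrite rmorphB /= map_polyX map_polyC.
  by apply/polyOverP => i; rewrite coef_map sK //; exact: (polyOverP rsK).
Qed.

(** [rs] lists the conjugates of [x]. An endomorphism maps this finite set injectively into itself,
    so it permutes the factors of the product. *)
Lemma orbit_list x : exists rs : seq Omega, [/\ uniq rs, x \in rs,
    forall y, y \in rs -> exists2 s : {rmorphism Omega -> Omega},
      {in K, s =1 id} & s x = y
    & forall h : {rmorphism Omega -> Omega}, {in K, h =1 id} ->
        map_poly h (\prod_(r <- rs) ('X - r%:P)) = \prod_(r <- rs) ('X - r%:P)].
Proof.
have [q q0 qx] := algK x.
have [R RE] := closed_field_poly_normal (map_poly valK q).
have memR y : (y \in R) = root (map_poly valK q) y.
  by rewrite RE rootZ ?root_prod_XsubC // lead_coef_eq0 map_poly_eq0.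
have conjR (s : {rmorphism Omega -> Omega}) : {in K, s =1 id} -> s x \in R.
  move=> sK; rewrite memR.
  have -> : map_poly valK q = map_poly s (map_poly valK q).
    rewrite -map_poly_comp; apply: eq_map_poly => a.
    by rewrite /= sK //; exact: (valP a).
  by rewrite fmorph_root.
pose O y := `[< exists2 s : {rmorphism Omega -> Omega}, {in K, s =1 id} & s x = y >].
have memO y : (y \in seq.filter O (undup R)) = O y.
  rewrite mem_filter mem_undup; case: (boolP (O y)) => // /asboolP[s sK <-].
  exact: conjR.
exists (seq.filter O (undup R)); split.
- by rewrite filter_uniq ?undup_uniq.
- by rewrite memO; apply/asboolP; exists idfun.
- by move=> y; rewrite memO => /asboolP.
move=> h hK; rewrite rmorph_prod /=.
under eq_bigr do rewrite rmorphB /= map_polyX map_polyC /=.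
rewrite -(big_map h predT (fun y => 'X - y%:P)); apply: perm_big.
have uO : uniq (seq.filter O (undup R)) by rewrite filter_uniq ?undup_uniq.
have uhO : uniq (map h (seq.filter O (undup R))) by rewrite map_inj_uniq //; exact: fmorph_inj.
apply: uniq_perm => //.
suff sub : {subset map h (seq.filter O (undup R)) <= seq.filter O (undup R)}.
  by have [|_ E] := uniq_min_size uhO sub; [rewrite size_map | exact: E].
move=> _ /mapP[y + ->]; rewrite memO => /asboolP[s sK <-].
rewrite memO; apply/asboolP; exists (h \o s) => // a Ka.
by rewrite /= sK ?hK.
Qed.

Lemma iter_rmorphism m (h : {rmorphism Omega -> Omega}) :
  exists g : {rmorphism Omega -> Omega}, g =1 iter m h.
Proof. by elim: m => [|m [g gE]]; [exists idfun | exists (h \o g) => x /=; rewrite gE]. Qed.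

(** The conjugates of [x] generate a Galois extension. If a prime q divides its degree, take an
    automorphism of order q: some p^N-th power of it fixes all conjugates, so q divides p^N. The
    quantifier over [s] in [p_closed] is what covers every conjugate. *)
Lemma closed_galois_pext p x : prime p -> p_closed p x -> in_galois_pext p K x.
Proof.
move=> pr_p [xsep xper].
have [rs [urs xrs rsO rsh]] := orbit_list x.
have rsep : {in rs, forall y, separable_over K y}.
  by move=> y /rsO[s sK <-]; apply: separable_conj xsep => a Ka; rewrite sK.
have rsK : \prod_(r <- rs) ('X - r%:P) \is a polyOver K.
  apply/polyOverP => i; apply: (fixed_mem (S := [set y | y \in rs]%classic)) => //.
    suff /polyOverP : \prod_(r <- rs) ('X - r%:P) \is a
        polyOver (adjoin K [set y | y \in rs]%classic) by apply.
    by rewrite big_seq rpred_prod // => r rrs; rewrite polyOverXsubC mem_adjoin.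
  by move=> h hK; rewrite -coef_map rsh.
have [E [j [jK galE jrs jM]]] := normal_extension rsK rsep.
have [e xe] := jrs x xrs.
have pG : p.-nat #|'Gal({:E} / 1%AS)%g|.
  apply/pnatP => // q pr_q /(Cauchy pr_q)[phi phiG oq].
  have [h [hK hE]] := galois_extend jK phi.
  have [N hN] : exists N, {in rs, forall y, iter (p ^ N) h y = y}.
    have : {in rs, forall y, exists r, iter (p ^ r) h y = y}.
      by move=> y /rsO[s sK <-]; exact: xper.
    elim: (rs) => [|y r IH] Hr; first by exists 0.
    have [|N HN] := IH; first by move=> z zr; apply: Hr; rewrite inE zr orbT.
    have [M HM] := Hr y (mem_head _ _); exists (M + N)%N => z.
    rewrite expnD inE => /predU1P[->|zr]; first exact: iter_pow_fix.
    by rewrite mulnC; apply: iter_pow_fix; exact: HN.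
  have [g gE] := iter_rmorphism (p ^ N) h.
  pose fixg : {pred Omega} := fun y => g y == y.
  have fixg_closed : divring_closed fixg.
    split=> [|y z|y z]; rewrite /in_mem /= /fixg ?rmorph1 //.
      by rewrite rmorphB => /eqP -> /eqP ->.
    by rewrite fmorph_div => /eqP -> /eqP ->.
  pose MF : divringClosed Omega :=
    HB.pack fixg (GRing.isDivringClosed.Build Omega fixg fixg_closed).
  have phi1 : (phi ^+ (p ^ N) = 1)%g.
    apply/eqP/gal_eqP => a _; rewrite gal_id -iter_gal; apply: (fmorph_inj j).
    have itE m : j (iter m phi a) = iter m h (j a).
      by elim: m => //= m <-; rewrite hE.
    rewrite itE -gE; apply/eqP; rewrite -[_ == _]/(j a \in MF).
    apply: jM => [b Kb|b brs]; rewrite -[_ \in _]/(g b == b) gE.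
      by apply/eqP; elim: (p ^ N)%N => //= m ->; exact: hK.
    by rewrite hN.
  have : (q %| p ^ N)%N by rewrite -oq order_dvdn phi1.
  by rewrite Euclid_dvdX // dvdn_prime2 // => /andP[/eqP -> _]; rewrite inE.
have [k kE] := p_natP pG.
exists E, j, k; split=> //; last by exists e.
by rewrite -kE -(galois_dim galE) dimv1 divn1.
Qed.

End Conjugation.

Lemma subfield_inclusion (Omega : fieldType) (K K' : divringClosed Omega) :
  {subset K <= K'} ->
  exists i : {rmorphism subfield K -> subfield K'}, forall a, val (i a) = val a.
Proof.
move=> KK'; pose i (a : subfield K) : subfield K' := Subfield (KK' _ (valP a)).
have iB : zmod_morphism i.
  by move=> a b; apply/val_inj; exact: (rmorphB (val : {rmorphism subfield K -> Omega})).
have iM : GRing.monoid_morphism i.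
  split=> [|a b]; apply/val_inj.
    exact: (rmorph1 (val : {rmorphism subfield K -> Omega})).
  exact: (rmorphM (val : {rmorphism subfield K -> Omega})).
by exists (HB.pack i (GRing.isZmodMorphism.Build _ _ i iB)
  (GRing.isMonoidMorphism.Build _ _ i iM) : {rmorphism _ -> _}).
Qed.

Section SubfieldMonotonicity.
Variables (Omega : closedFieldType) (K K' : divringClosed Omega).
Hypothesis KK' : {subset K <= K'}.

Lemma algebraicOver_subfield x : algebraicOver (val : subfield K -> Omega) x ->
  algebraicOver (val : subfield K' -> Omega) x.
Proof.
case=> q q0 qx; have [i iE] := subfield_inclusion KK'.
exists (map_poly i q); first by rewrite map_poly_eq0.
rewrite -map_poly_comp (_ : map_poly _ q = map_poly val q) //.
by apply: eq_map_poly => a /=; rewrite -iE.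
Qed.

Lemma separable_over_subfield x : separable_over K x -> separable_over K' x.
Proof.
by case=> rs [urs xrs /polyOverP rsK]; exists rs; split=> //; apply/polyOverP => i; exact/KK'.
Qed.

Lemma p_closed_subfield p x : p_closed K p x -> p_closed K' p x.
Proof.
case=> xsep xper; split; first exact: separable_over_subfield.
by move=> h s hK sK; apply: xper => a Ka; [apply: hK | apply: sK]; exact: KK'.
Qed.

End SubfieldMonotonicity.

Lemma separable_root (Omega : closedFieldType) (K : divringClosed Omega) m x :
  m%:R != 0 :> Omega -> x != 0 -> x ^+ m \in K -> separable_over K x.
Proof.
move=> m0 x0 xmK; have m_gt0 : (0 < m)%N by case: m m0 {xmK} => //; rewrite eqxx.
pose q : {poly Omega} := 'X^m - (x ^+ m)%:P.
have qm : q \is monic by exact: monicXnsubC.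
have [rs rsE] := closed_field_poly_normal q.
rewrite (eqP qm) scale1r in rsE.
have xr : x \in rs.
  by rewrite -root_prod_XsubC -rsE /root /q !hornerE subrr.
exists rs; split=> //.
- rewrite -separable_prod_XsubC -rsE unlock /q derivB derivXn derivC subr0.
  rewrite -scaler_nat coprimepZr // coprimep_expr // coprimepX.
  by rewrite /root !hornerE expr0n gtn_eqF // sub0r oppr_eq0 expf_neq0.
- by rewrite -rsE rpredB ?rpredX ?polyOverX ?polyOverC.
Qed.

(** * Normal subfields and the automorphisms induced from Omega *)

Section Automorphisms.
Variables (Omega : closedFieldType) (F : divringClosed Omega).
Hypothesis algF : forall x, algebraicOver (val : subfield F -> Omega) x.
Implicit Types (K E : divringClosed Omega) (h s t : {rmorphism Omega -> Omega}).

Lemma algebraicOver_ext K : {subset F <= K} ->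
  forall x, algebraicOver (val : subfield K -> Omega) x.
Proof. by move=> FK x; exact: algebraicOver_subfield (algF x). Qed.

Lemma rmorphism_inverse s : {in F, s =1 id} ->
  exists t, [/\ cancel s t, cancel t s & {in F, t =1 id}].
Proof.
move=> sF; have [|t sK tK] := @endo_bij _ _ (val : subfield F -> Omega) s _ algF.
  by move=> a; exact/sF/(valP a).
have tB : zmod_morphism t by move=> x y; apply: (can_inj sK); rewrite rmorphB !tK.
have tM : GRing.monoid_morphism t.
  by split=> [|x y]; apply: (can_inj sK); rewrite ?rmorph1 ?rmorphM !tK.
exists (HB.pack t (GRing.isZmodMorphism.Build _ _ t tB)
  (GRing.isMonoidMorphism.Build _ _ t tM) : {rmorphism Omega -> Omega}).
by split=> // a Fa; rewrite -{1}(sF a Fa) /= sK.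
Qed.

(** For an intermediate field this is normality over [F], with endomorphisms of Omega in place of
    polynomials. *)
Definition stable K : Prop :=
  forall s, {in F, s =1 id} -> forall x, x \in K -> s x \in K.

Lemma adjoin_stable K S : stable K ->
  (forall s, {in F, s =1 id} -> forall x, S x -> s x \in adjoin K S) ->
  stable (adjoin K S).
Proof.
move=> stK stS s sF.
suff sub : {subset adjoin K S <= preim_field s (adjoin K S)} by move=> x /sub.
apply: adjoin_subset => x Hx; rewrite -[_ \in _]/(s x \in adjoin K S).
  exact/adjoin_sub/stK.
exact: stS.
Qed.

Lemma stable_base : stable F.
Proof. by move=> s sF x Fx; rewrite sF. Qed.

Lemma adjoin_mu_conj_stable K m : stable K -> stable (adjoin_mu K m).
Proof.
move=> stK; apply: adjoin_stable => // s sF x xm; apply: mem_adjoin => /=.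
by rewrite -rmorphXn xm rmorph1.
Qed.

Lemma p_closed_conj p K s x : {subset F <= K} -> stable K -> {in F, s =1 id} ->
  p_closed K p x -> p_closed K p (s x).
Proof.
move=> FK stK sF [xsep xper]; have [t [sK tK tF]] := rmorphism_inverse sF.
split; first by apply: separable_conj => // a; exact: stK.
move=> h s' hK s'K.
have conjK u : {in K, u =1 id} -> {in K, t \o u \o s =1 id}.
  by move=> uK a Ka /=; rewrite uK ?sK //; exact: stK.
have [r rE] := xper (t \o h \o s) (t \o s' \o s) (conjK h hK) (conjK s' s'K).
have itE m z : iter m h (s z) = s (iter m (t \o h \o s) z).
  by elim: m => //= m ->; rewrite tK.
by exists r; have := congr1 s rE; rewrite -itE /= tK.
Qed.

Lemma max_pext_stable p K : prime p -> {subset F <= K} -> stable K ->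
  stable (max_pext p K).
Proof.
move=> pr_p FK stK; apply: adjoin_stable => // s sF x /galois_pext_closed xp.
apply: mem_adjoin; apply: closed_galois_pext => //; first exact: algebraicOver_ext.
by apply: p_closed_conj => //; exact: xp.
Qed.

Lemma galg_extend K E (g : galg E K) : {subset F <= K} -> {subset K <= E} ->
  exists s, {in K, s =1 id} /\ forall x, s (val x) = val (g x).
Proof.
move=> FK KE.
have FE : {subset F <= E} by move=> x /FK /KE.
have [s sE] := @extend_embedding (subfield E) Omega val (val \o g) (algebraicOver_ext FE).
exists s; split=> // a Ka; have := sE (Subfield (KE a Ka)) => /= ->.
by rewrite galg_fix.
Qed.

Lemma galg_of_rmorphism K E s : {subset F <= K} -> {subset K <= E} ->
  {in K, s =1 id} -> (forall x, x \in E -> s x \in E) ->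
  exists g : galg E K, forall x, val (g x) = s (val x).
Proof.
move=> FK KE sK sE.
pose f (x : subfield E) : subfield E := Subfield (sE _ (valP x)).
have fB : zmod_morphism f.
  by move=> x y; apply/val_inj; rewrite -[LHS]/(s (val (x - y))) !rmorphB.
have fM : GRing.monoid_morphism f.
  split=> [|x y]; apply/val_inj; first by rewrite -[LHS]/(s (val 1)) !rmorph1.
  by rewrite -[LHS]/(s (val (x * y))) !rmorphM.
pose fR : {rmorphism subfield E -> subfield E} :=
  HB.pack f (GRing.isZmodMorphism.Build _ _ f fB) (GRing.isMonoidMorphism.Build _ _ f fM).
have FE : {subset F <= E} by move=> x /FK /KE.
have [k kE] := subfield_inclusion FE.
have fbij : bijective f.
  apply: (@endo_bij _ _ k fR) => [a|x].
    apply/val_inj; rewrite -[LHS]/(s (val (k a))) kE sK //; exact/FK/(valP a).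
  have [q q0 qx] := algF (val x); exists q => //.
  rewrite -(fmorph_root (val : {rmorphism subfield E -> Omega})) -map_poly_comp.
  by rewrite (eq_map_poly (g := val)) // => a; exact: kE.
suff fP : `[< is_kaut K f >] by exists (GalG fP).
apply/asboolP; split=> // x Kx; apply/val_inj; exact: sK.
Qed.

End Automorphisms.

(** The product over the F-conjugates of [x] descends in two steps, from the field generated by the
    conjugates to [L] and from there to [F], since [fixed_mem] needs generators that are separable
    over the base. *)
Lemma separable_tower (Omega : closedFieldType) (F : divringClosed Omega) S x :
  (forall x, algebraicOver (val : subfield F -> Omega) x) ->
  (forall y, S y -> separable_over F y) -> stable F (adjoin F S) ->
  separable_over (adjoin F S) x -> separable_over F x.
Proof.
move=> algF Ssep stL xsep; set L := adjoin F S in stL xsep.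
have FL : {subset F <= L} by exact: adjoin_sub.
have [rs [urs xrs rsO rsh]] := orbit_list algF x.
exists rs; split=> //; apply/polyOverP => i.
have fixP (h : {rmorphism Omega -> Omega}) : {in F, h =1 id} ->
    h (\prod_(r <- rs) ('X - r%:P))`_i = (\prod_(r <- rs) ('X - r%:P))`_i.
  by move=> hF; rewrite -coef_map rsh.
apply: (fixed_mem algF Ssep) => //.
apply: (fixed_mem (algebraicOver_ext algF FL) (S := [set y | y \in rs]%classic)).
- by move=> y /= /rsO[s sF <-]; apply: separable_conj xsep; exact: stL.
- suff /polyOverP : \prod_(r <- rs) ('X - r%:P) \is a
      polyOver (adjoin L [set y | y \in rs]%classic) by apply.
  by rewrite big_seq rpred_prod // => r rrs; rewrite polyOverXsubC mem_adjoin.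
- by move=> h hL; apply: fixP => a Fa; exact/hL/FL.
Qed.

(** Induction on [k]: once some h^(p^r) fixes the p-th power of y, it multiplies y by a p-th root of
    unity, which lies in K; p further repetitions remove this factor. *)
Lemma root_p_closed (Omega : closedFieldType) (K : divringClosed Omega) p k x :
  p%:R != 0 :> Omega -> (forall w : Omega, w ^+ p = 1 -> w \in K) ->
  x != 0 -> x ^+ (p ^ k) \in K -> p_closed K p x.
Proof.
move=> p0 muK x0 xK; split; first by apply: separable_root xK; rewrite // natrX expf_neq0.
move=> h s hK sK.
have : s x ^+ (p ^ k) \in K by rewrite -rmorphXn /= sK.
have : s x != 0 by rewrite fmorph_eq0.
move: (s x) => {xK}{}x {}x0; elim: k x x0 => [|k IH] y y0.
  by rewrite expn0 expr1 => yK; exists 0; exact: hK.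
rewrite expnS exprM => /IH[|r rE]; first by rewrite expf_neq0.
have [g gE] := iter_rmorphism (p ^ r) h.
have gK : {in K, g =1 id}.
  by move=> a Ka; rewrite gE; elim: (p ^ r)%N => //= m ->; exact: hK.
have wK : g y / y \in K.
  by apply: muK; rewrite expr_div_n -rmorphXn /= gE rE divff // expf_neq0.
have gy m : iter m g y = (g y / y) ^+ m * y.
  elim: m => [|m IHm]; first by rewrite expr0 mul1r.
  by rewrite /= IHm rmorphM rmorphXn /= (gK _ wK) exprSr -mulrA divfK.
exists r.+1; rewrite expnS iterM -(eq_iter gE) gy expr_div_n -rmorphXn /= gE rE.
by rewrite divff ?mul1r // expf_neq0.
Qed.

(** * Galois correspondence for finite sets of elements *)

Section FiniteOrbits.
Variables (Omega : fieldType) (E K : divringClosed Omega).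
Hypothesis KE : {subset K <= E}.
Hypothesis algK : forall x : subfield E, algebraicOver (val : subfield K -> Omega) (val x).
Implicit Types (g h : galg E K) (S v : seq (subfield E)).

Lemma galg_orbit_finite x : exists R : seq (subfield E), forall g, g x \in R.
Proof.
have [q q0 qx] := algK x; have [i iE] := subfield_inclusion KE.
pose Q := map_poly i q; have Q0 : Q != 0 by rewrite map_poly_eq0.
have gQ g : root Q (g x).
  have <- : map_poly g Q = Q.
    rewrite -map_poly_comp; apply: eq_map_poly => a; rewrite /= galg_fix // iE.
    exact: (valP a).
  rewrite fmorph_root -(fmorph_root (val : {rmorphism subfield E -> Omega})).
  by rewrite -map_poly_comp (eq_map_poly (g := val)).
suff [R [_ _ RP]] : exists R : seq (subfield E),
    [/\ uniq R, all (root Q) R & forall y, root Q y -> y \in R].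
  by exists R => g; exact: RP.
have bound (R : seq (subfield E)) : uniq R -> all (root Q) R -> (size R < size Q)%N.
  by move=> uR RQ; exact: max_poly_roots.
(* [E] need not be algebraically closed, so its roots of [Q] are collected one at a time until the
   degree bound stops the process. *)
have step k : (exists R : seq (subfield E),
    [/\ uniq R, all (root Q) R & forall y, root Q y -> y \in R]) \/
  exists R : seq (subfield E), [/\ uniq R, all (root Q) R & size R = k].
  elim: k => [|k [|[R [uR RQ Rk]]]]; [by right; exists [::] | by left |].
  have [full|] := pselect (forall y, root Q y -> y \in R); first by left; exists R.
  move=> /existsNP[y /not_implyP[yQ /negP yR]]; right; exists (y :: R).
  by rewrite /= yR uR yQ RQ Rk.
have [//|[R [uR RQ RQs]]] := step (size Q).
by have := bound R uR RQ; rewrite RQs ltnn.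
Qed.

Lemma galg_seq_orbit (H : galg E K -> Prop) S : exists Hs : seq (seq (subfield E)),
  uniq Hs /\ forall v, v \in Hs <-> exists2 h, H h & v = map h S.
Proof.
have [C CP] : exists C : seq (seq (subfield E)), forall g, map g S \in C.
  elim: S => [|x S [C CP]]; first by exists [:: [::]] => g; rewrite inE.
  have [R RP] := galg_orbit_finite x.
  exists [seq a :: v | a <- R, v <- C] => g /=.
  exact: allpairs_f.
pose P v := `[< exists2 h, H h & v = map h S >].
exists [seq v <- undup C | P v]; split; first by rewrite filter_uniq ?undup_uniq.
move=> v; rewrite mem_filter mem_undup; split=> [/andP[/asboolP]//|[h Hh ->]].
by rewrite CP andbT; apply/asboolP; exists h.
Qed.

Lemma map_poly_Poly g v : map_poly g (Poly v) = Poly (map g v).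
Proof.
apply/polyP => i; rewrite coef_map !coef_Poly.
have [iv|iv] := ltnP i (size v); first by rewrite (nth_map 0).
by rewrite !nth_default ?size_map ?raddf0.
Qed.

Lemma Poly_inj_size v w : size v = size w -> Poly v = Poly w -> v = w.
Proof.
move=> vw E1; apply: (eq_from_nth (x0 := 0)) => // i _.
by move/(congr1 (fun q : {poly _} => q`_i)): E1; rewrite !coef_Poly.
Qed.

(* Artin's argument over [E][T], where the polynomial [Poly S] replaces a primitive
   element of the field generated by [S]. *)
Lemma galg_closure (H : galg E K -> Prop) S :
  H 1%g -> (forall g h, H g -> H h -> H (g * h)%g) ->
  exists s' : seq (subfield E),
    (forall y, y \in s' -> forall h, H h -> h y = y) /\
    forall g, {in s', g =1 id} -> exists2 h, H h & {in S, g =1 h}.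
Proof.
move=> H1 HM; have [Hs [uHs HsP]] := galg_seq_orbit H S.
pose P : {poly {poly subfield E}} := \prod_(q <- map (@Poly _) Hs) ('X - q%:P).
have PE g : map_poly (map_poly g) P =
    \prod_(q <- map (@Poly _) (map (map g) Hs)) ('X - q%:P).
  rewrite rmorph_prod !big_map; apply: eq_bigr => v _.
  by rewrite rmorphB /= map_polyX map_polyC /= map_poly_Poly.
exists (flatten (map (@polyseq _) P)); split.
  move=> y /flatten_mapP[q qP yq] h Hh.
  have : map_poly (map_poly h) P = P.
    rewrite PE; apply: perm_big; apply: perm_map.
    have uh : uniq (map (map h) Hs).
      rewrite map_inj_uniq //; apply: inj_map; exact: fmorph_inj.
    have sub : {subset map (map h) Hs <= Hs}.
      move=> _ /mapP[v + ->] => /HsP[h' Hh' ->].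
      by apply/HsP; exists (h * h')%g; [exact: HM | rewrite -map_comp].
    apply: uniq_perm => //.
    by have [|_ E1] := uniq_min_size uh sub; [rewrite size_map | exact: E1].
  move/(nthP 0): qP => [i iP qE]; move/(nthP 0): yq => [k kq yE].
  move/(congr1 (fun Q : {poly {poly subfield E}} => Q`_i`_k)).
  by rewrite !coef_map /= qE yE.
move=> g gs.
have gP : map_poly (map_poly g) P = P.
  apply/polyP => i; rewrite coef_map /=; apply/polyP => k; rewrite coef_map /=.
  have [iP|iP] := ltnP i (size P); last by rewrite (nth_default 0 iP) coef0 raddf0.
  have [kP|kP] := ltnP k (size P`_i); last by rewrite (nth_default 0 kP) raddf0.
  by apply: gs; apply/flatten_mapP; exists P`_i; exact: mem_nth.
(* [g] fixes the coefficients of [P], so it permutes the roots, which encode the tuples [map h S]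
   with [h] in [H]. *)
have : root P (Poly S).
  rewrite root_prod_XsubC; apply/map_f/HsP; exists 1%g => //.
  by rewrite (eq_map (g := id)) ?map_id.
move=> /rootP/(congr1 (map_poly g)).
rewrite -horner_map /= gP map_poly_Poly raddf0 => /rootP.
rewrite root_prod_XsubC => /mapP[v /HsP[h Hh ->] gh]; exists h => // x xS.
have /eq_in_map/(_ x xS) // : map g S = map h S.
by apply: Poly_inj_size gh; rewrite !size_map.
Qed.

(* A nonzero resolvent exists by interpolation at the points [Poly v]. *)
Lemma galg_hilbert90 S (z : galg E K -> subfield E) :
  (forall g, z g != 0) -> (forall g h, z (g * h)%g = z g * g (z h)) ->
  (forall g, {in S, g =1 id} -> z g = 1) ->
  exists2 b : subfield E, b != 0 & forall g, z g = g b / b.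
Proof.
move=> z0 zM zS; have [Hs [uHs HsP]] := galg_seq_orbit (fun=> True) S.
have Hmap g : map g S \in Hs by apply/HsP; exists g.
have zS2 g h : map g S = map h S -> z g = z h.
  move=> gh; have -> : g = (h * (h^-1 * g))%g by rewrite mulgA mulgV mul1g.
  rewrite zM (zS (h^-1 * g)%g) ?rmorph1 ?mulr1 // => x xS.
  move/eq_in_map: gh => /(_ x xS) ghx.
  by rewrite galg_mulE ghx -galg_mulE mulVg.
(* [z g] depends only on [map g S]; [w] records this dependence. Its default 0 lies outside [Hs],
   over which all sums run. *)
have [w wE] : exists w : seq (subfield E) -> subfield E, forall g, w (map g S) = z g.
  exists (fun v => if pselect (exists g, v = map g S) is left ex
    then z (projT1 (cid ex)) else 0) => g.
  case: pselect => [ex|[]]; last by exists g.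
  by apply: zS2; case: cid.
have z1 : z 1%g = 1.
  by apply: (mulfI (z0 1%g)); rewrite mulr1 -[in RHS](mulg1 (1%g : galg E K)) zM.
pose B k i := \sum_(v <- Hs) w v * ((Poly v) ^+ k)`_i.
have [k [i Bki]] : exists k i, B k i != 0.
  apply: contrapT => Ball.
  have B0 k : \sum_(v <- Hs) (w v)%:P * (Poly v) ^+ k = 0.
    apply/polyP => i; rewrite coef_sum coef0.
    transitivity (B k i); first by apply: eq_bigr => v _; rewrite coefCM.
    by apply/eqP; apply: contra_notT Ball => Bki; exists k, i.
  have BR (R : {poly {poly subfield E}}) : \sum_(v <- Hs) (w v)%:P * R.[Poly v] = 0.
    under eq_bigr do rewrite horner_coef mulr_sumr.
    rewrite exchange_big /= big1 // => k _.
    under eq_bigr do rewrite mulrCA.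
    by rewrite -mulr_sumr B0 mulr0.
  have SHs : S \in Hs by apply/HsP; exists 1%g => //; rewrite (eq_map (g := id)) ?map_id.
  (* This product vanishes at [Poly v] for every v in the orbit other than [S], so only the term of
     [S] survives, with weight [z 1 = 1]. *)
  have := BR (\prod_(v <- Hs | v != S) ('X - (Poly v)%:P)).
  rewrite (bigD1_seq S) //= [X in _ + X]big1_seq ?addr0; last first.
    move=> v /andP[vS vHs]; rewrite horner_prod -big_filter (bigD1_seq v) /=;
      rewrite ?mem_filter ?vS ?filter_uniq //.
    by rewrite hornerXsubC subrr mul0r mulr0.
  move/eqP; rewrite mulf_eq0 polyC_eq0.
  have -> : w S = 1 by rewrite -z1 -wE (eq_map (g := id)) ?map_id.
  rewrite oner_eq0 /= horner_prod; apply/negP; rewrite prodf_seq_neq0.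
  apply/allP => v vHs; apply/implyP => vS; rewrite hornerXsubC subr_eq0.
  apply: contraNneq vS => SV; apply/eqP/esym/Poly_inj_size => //.
  by have [h _ ->] := (HsP v).1 vHs; rewrite size_map.
have gB g : g (B k i) = (z g)^-1 * B k i.
  have BE : B k i = \sum_(v <- map (map g) Hs) w v * ((Poly v) ^+ k)`_i.
    apply/esym/perm_big.
    have uh : uniq (map (map g) Hs).
      rewrite map_inj_uniq //; apply: inj_map; exact: fmorph_inj.
    have sub : {subset map (map g) Hs <= Hs}.
      by move=> _ /mapP[v + ->] => /HsP[h _ ->]; rewrite -map_comp; exact: (Hmap (g * h)%g).
    apply: uniq_perm => //.
    by have [|_ E1] := uniq_min_size uh sub; [rewrite size_map | exact: E1].
  rewrite [in RHS]BE big_map mulr_sumr raddf_sum /= big_seq [RHS]big_seq.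
  apply: eq_bigr => v /HsP[h _ ->].
  rewrite rmorphM /= wE -map_comp -[map (g \o h) S]/(map (g * h)%g S) wE zM mulrA.
  rewrite mulKf //.
  rewrite -[map (g * h)%g S]/(map (g \o h) S) map_comp -(map_poly_Poly g).
  by rewrite -(rmorphXn (map_poly g)) coef_map.
exists (B k i)^-1; first by rewrite invr_eq0.
move=> g; rewrite (fmorphV g) -[_ (B k i)]/(g (B k i)) (gB g).
by rewrite invrK invfM invrK -mulrA mulVf ?mulr1.
Qed.

End FiniteOrbits.

(** * The tower over [F] *)

Section EqualizerField.
Variables (E Omega : fieldType) (f g : {rmorphism E -> Omega}).

(** Being a subfield, it allows agreement of two morphisms on an adjunction to be checked on
    generators. *)
Definition equalizer_pred : {pred E} := fun x => f x == g x.

Fact equalizer_closed : divring_closed equalizer_pred.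
Proof.
split=> [|x y|x y]; rewrite /in_mem /= /equalizer_pred ?rmorph1 //.
  by rewrite !rmorphB => /eqP -> /eqP ->.
by rewrite !fmorph_div => /eqP -> /eqP ->.
Qed.

HB.instance Definition _ := GRing.isDivringClosed.Build E equalizer_pred equalizer_closed.

Definition equalizer : divringClosed E := equalizer_pred.

End EqualizerField.

Section PeriodicField.
Variables (p : nat) (E : closedFieldType) (h : {rmorphism E -> E}).

Definition periodic_pred : {pred E} := fun x => `[< exists r, iter (p ^ r) h x = x >].

Lemma iter_expn_fix (T : eqType) (f : T -> T) k r r' x : (r <= r')%N ->
  iter (p ^ r * k) f x = x -> iter (p ^ r' * k) f x = x.
Proof.
by move=> /subnKC <- fx; rewrite expnD mulnAC; exact: iter_pow_fix.
Qed.

Fact periodic_closed : divring_closed periodic_pred.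
Proof.
have two x y : x \in periodic_pred -> y \in periodic_pred ->
    exists r, iter (p ^ r) h x = x /\ iter (p ^ r) h y = y.
  move=> /asboolP[r rx] /asboolP[s sy]; exists (maxn r s).
  split; rewrite -[(_ ^ _)%N]muln1.
    by apply: iter_expn_fix (leq_maxl _ _) _; rewrite muln1.
  by apply: iter_expn_fix (leq_maxr _ _) _; rewrite muln1.
split=> [|x y xP yP|x y xP yP]; apply/asboolP.
- by exists 0; rewrite /= rmorph1.
- have [r [rx ry]] := two x y xP yP; exists r.
  by have [g gE] := iter_rmorphism (p ^ r) h; rewrite -gE rmorphB !gE rx ry.
- have [r [rx ry]] := two x y xP yP; exists r.
  by have [g gE] := iter_rmorphism (p ^ r) h; rewrite -gE fmorph_div !gE rx ry.
Qed.

HB.instance Definition _ := GRing.isDivringClosed.Build E periodic_pred periodic_closed.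

Definition periodic_field : divringClosed E := periodic_pred.

End PeriodicField.

Lemma iter_fix (T : Type) (f : T -> T) m x : f x = x -> iter m f x = x.
Proof. by move=> fx; elim: m => //= m ->. Qed.

Lemma rmorph_root_unity (Omega : fieldType) (h : {rmorphism Omega -> Omega}) p w :
  prime p -> w ^+ p = 1 -> exists u, coprime u p /\ h w = w ^+ u.
Proof.
move=> pr_p wp; have [->|w1] := eqVneq w 1.
  by exists 1%N; rewrite coprime1n rmorph1 expr1n.
have [m mw mp] := prim_order_exists (prime_gt0 pr_p) wp.
have mE : m = p.
  have /primeP[_ /(_ m mp)/orP[/eqP m1|/eqP //]] := pr_p.
  by move/eqP: w1; have := prim_expr_order mw; rewrite m1 expr1.
rewrite {}mE in mw.
have [u hwE] : exists u : 'I_p, h w = w ^+ u.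
  have := prim_rootP mw (x := h w); rewrite -rmorphXn wp rmorph1 => /(_ erefl)[u ->].
  by exists u.
exists u; split=> //; rewrite coprime_sym prime_coprime //; apply/negP => pu.
have : h w = h 1 by rewrite rmorph1 hwE -(prim_expr_mod mw) (eqP pu) expr0.
by move/fmorph_inj/eqP; apply/negP.
Qed.

Section Tower.
Variables (Omega : closedFieldType) (F : divringClosed Omega) (p : nat).
Hypothesis algF : forall x, algebraicOver (val : subfield F -> Omega) x.
Hypothesis pr_p : prime p.
Hypothesis p0 : p%:R != 0 :> Omega.
Let Fp := max_pext p F.
Let L := field_L p F.
Let J := field_J p F.
Let Lp := field_Lp p F.
Let GG := galg Lp F.
Implicit Types (s h : {rmorphism Omega -> Omega}) (g t : GG) (K : divringClosed Omega).

Lemma sub_F_L : {subset F <= L}. Proof. exact: adjoin_sub. Qed.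
Lemma sub_F_Fp : {subset F <= Fp}. Proof. exact: adjoin_sub. Qed.
Lemma sub_L_Lp : {subset L <= Lp}. Proof. exact: adjoin_sub. Qed.
Lemma sub_F_Lp : {subset F <= Lp}. Proof. by move=> x /sub_F_L /sub_L_Lp. Qed.
Lemma sub_Fp_J : {subset Fp <= J}. Proof. exact: adjoin_sub. Qed.
Lemma sub_L_J : {subset L <= J}.
Proof. by apply: adjoin_mu_sub => x; exact: sub_F_Fp. Qed.

Lemma mu_in_L (w : Omega) : w ^+ p = 1 -> w \in L.
Proof. by move=> wp; exact: mem_adjoin. Qed.

Let algL := algebraicOver_ext algF sub_F_L.

Lemma root_in_Lp k (x : Omega) : x != 0 -> x ^+ (p ^ k) \in L -> x \in Lp.
Proof.
move=> x0 xL; apply: mem_adjoin; apply: (closed_galois_pext algL pr_p).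
by apply: root_p_closed xL => //; exact: mu_in_L.
Qed.

Lemma sub_Fp_Lp : {subset Fp <= Lp}.
Proof.
apply: adjoin_subset; first exact: sub_F_Lp.
move=> x /galois_pext_closed/(p_closed_subfield sub_F_L) xL.
by apply: mem_adjoin; exact: (closed_galois_pext algL pr_p).
Qed.

Lemma sub_J_Lp : {subset J <= Lp}.
Proof.
apply: adjoin_subset; first exact: sub_Fp_Lp.
by move=> w /mu_in_L; exact: sub_L_Lp.
Qed.

Lemma stable_L : stable F L.
Proof. by apply: adjoin_mu_conj_stable; exact: stable_base. Qed.
Lemma stable_Fp : stable F Fp.
Proof. by apply: max_pext_stable => //; exact: stable_base. Qed.
Lemma stable_J : stable F J.
Proof. by apply: adjoin_mu_conj_stable; exact: stable_Fp. Qed.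
Lemma stable_Lp : stable F Lp.
Proof. by apply: max_pext_stable => //; [exact: sub_F_L | exact: stable_L]. Qed.

Lemma sub_Lp_separable : {subset Lp <= adjoin F [set y | separable_over F y]%classic}.
Proof.
have LS : {subset L <= adjoin F [set y | separable_over F y]%classic}.
  apply: adjoin_subset => [|w wp]; first exact: adjoin_sub.
  apply: mem_adjoin => /=; apply: (@separable_root _ _ p) => //.
    by apply: contra_eq_neq wp => ->; rewrite expr0n gtn_eqF ?prime_gt0 // eq_sym oner_eq0.
  by rewrite wp rpred1.
apply: adjoin_subset => // x /galois_pext_closed[xsep _].
apply: mem_adjoin; apply: separable_tower xsep => //; last exact: stable_L.
move=> w wp; apply: (@separable_root _ _ p) => //.
  by apply: contra_eq_neq wp => ->; rewrite expr0n gtn_eqF ?prime_gt0 // eq_sym oner_eq0.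
by rewrite wp rpred1.
Qed.

Lemma fixed_in K y : {subset F <= K} -> y \in Lp ->
  (forall h, {in K, h =1 id} -> h y = y) -> y \in K.
Proof.
move=> FK yLp; apply: (fixed_mem (algebraicOver_ext algF FK)
    (S := [set y | separable_over F y]%classic)).
  by move=> x; exact: separable_over_subfield.
have /asboolP := sub_Lp_separable yLp; apply; last by move=> x; exact: mem_adjoin.
by move=> x /FK; exact: adjoin_sub.
Qed.

Lemma separable_Lp y : y \in Lp -> separable_over F y.
Proof.
move=> yLp; have [rs [urs yrs rsO rsh]] := orbit_list algF y.
exists rs; split=> //; apply/polyOverP => i; apply: fixed_in => //; last first.
  by move=> h hF; rewrite -coef_map rsh.
suff /polyOverP : \prod_(r <- rs) ('X - r%:P) \is a polyOver Lp by apply.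
rewrite big_seq rpred_prod // => r /rsO[s sF <-]; rewrite polyOverXsubC.
exact: stable_Lp.
Qed.

Lemma extendG g : exists s, {in F, s =1 id} /\ forall x, s (val x) = val (g x).
Proof. by apply: (galg_extend algF) => //; exact: sub_F_Lp. Qed.

Lemma restrictG s : {in F, s =1 id} -> exists g, forall x, val (g x) = s (val x).
Proof.
move=> sF; apply: galg_of_rmorphism => //; first exact: sub_F_Lp.
exact: stable_Lp.
Qed.

Lemma stableG K g (x : subfield Lp) : stable F K -> val x \in K -> val (g x) \in K.
Proof. by move=> stK xK; have [s [sF <-]] := extendG g; exact: stK. Qed.

Lemma galois_Lp K (y : subfield Lp) : {subset F <= K} ->
  (forall g, fixes g K -> g y = y) -> val y \in K.
Proof.
move=> FK yfix; apply: fixed_in => //; first exact: (valP y).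
move=> h hK; have [|g gE] := @restrictG h; first by move=> a /FK; exact: hK.
by rewrite -gE yfix // => x xK; apply/val_inj; rewrite gE; exact: hK.
Qed.

Lemma restr_FpE g (x : subfield Fp) (y : subfield Lp) :
  val x = val y -> val (restr Fp g x) = val (g y).
Proof.
apply: restrP; first exact: sub_Fp_Lp.
by move=> g' z; exact: stableG stable_Fp.
Qed.

Lemma restr_Fp_ext g (c : galg Fp F) :
  (forall x y, val x = val y -> val (c x) = val (g y)) -> restr Fp g = c.
Proof.
move=> cE; apply: galg_eqP => x; apply/val_inj.
pose y : subfield Lp := Subfield (sub_Fp_Lp (valP x)).
by rewrite (@restr_FpE g x y) ?(cE x y).
Qed.

Lemma lift_Fp (c : galg Fp F) : exists g, restr Fp g = c.
Proof.
have [s [sF sE]] := galg_extend algF c (fun x => id) sub_F_Fp.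
have [g gE] := restrictG sF; exists g; apply: restr_Fp_ext => x y xy.
by rewrite gE -xy sE.
Qed.

Lemma galg_expE g m x : (g ^+ m)%g x = iter m g x.
Proof. by elim: m => // m IH; rewrite expgS galg_mulE IH. Qed.

Lemma fixes_mul g t K : fixes g K -> fixes t K -> fixes (g * t)%g K.
Proof. by move=> gK tK x xK; rewrite galg_mulE tK // gK. Qed.

Lemma fixes_inv g K : fixes g K -> fixes (g^-1)%g K.
Proof. by move=> gK x xK; rewrite -{1}(gK x xK) -galg_mulE mulVg. Qed.

Lemma fixes_conj g t K : stable F K -> fixes t K -> fixes (g * t * g^-1)%g K.
Proof.
move=> stK tK x xK; rewrite !galg_mulE tK; last exact: stableG.
by rewrite -galg_mulE mulgV.
Qed.

Lemma fixes_exp g m K : fixes g K -> fixes (g ^+ m)%g K.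
Proof. by move=> gK x xK; rewrite galg_expE iter_fix // gK. Qed.

(** An endomorphism raises each p-th root of unity to a power prime to p, and the (p-1)-th power of
    that exponent is 1 modulo p. *)
Lemma exp_pred_L h : {in F, h =1 id} -> {in L, forall x, iter p.-1 h x = x}.
Proof.
move=> hF; have [k kE] := iter_rmorphism p.-1 h.
suff sub : {subset L <= equalizer k idfun} by move=> x /sub /eqP; rewrite kE.
apply: adjoin_subset => [a Fa|w /= wp]; apply/eqP; rewrite /= kE.
  exact/iter_fix/hF.
have [u [up hw]] := rmorph_root_unity h pr_p wp.
have itE m : iter m h w = w ^+ (u ^ m).
  elim: m => [|m IH]; first by rewrite expn0 expr1.
  by rewrite /= IH rmorphXn /= hw -exprM expnS.
rewrite itE -(expr_mod _ wp) -(totient_prime pr_p).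
by rewrite Euler_exp_totient // (expr_mod _ wp) expr1.
Qed.

Lemma abelian_L g t (x : subfield Lp) : val x \in L -> g (t x) = t (g x).
Proof.
have [h [hF hE]] := extendG g; have [s [sF sE]] := extendG t.
suff sub : {subset L <= equalizer (h \o s) (s \o h)}.
  by move=> /sub /eqP /= e; apply/val_inj; rewrite -hE -!sE -hE.
apply: adjoin_subset => [a Fa|w /= wp]; apply/eqP; first by rewrite /= sF // !hF // sF.
have [u [_ hw]] := rmorph_root_unity h pr_p wp.
have [v [_ sw]] := rmorph_root_unity s pr_p wp.
by rewrite /= hw sw !rmorphXn /= hw sw -!exprM mulnC.
Qed.

Lemma exp_pred_fixes g : fixes (g ^+ p.-1)%g L.
Proof.
move=> x xL; have [h [hF hE]] := extendG g; apply/val_inj; rewrite galg_expE.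
rewrite -[RHS](exp_pred_L hF xL); elim: p.-1 => //= m IH.
by rewrite -IH hE.
Qed.

Lemma periodic_Fp g (x : subfield Lp) : val x \in Fp -> exists r, iter (p ^ r) g x = x.
Proof.
have [h [hF hE]] := extendG g => xFp.
suff sub : {subset Fp <= periodic_field p h}.
  have /asboolP[r rx] := sub _ xFp; exists r; apply/val_inj; rewrite -[RHS]rx.
  by elim: (p ^ r)%N => //= m <-; rewrite hE.
apply: adjoin_subset => [a Fa|y /galois_pext_closed[_ yper]]; apply/asboolP.
  by exists 0; rewrite /= hF.
by have [r] := yper h idfun hF (fun _ _ => erefl); exists r.
Qed.

(** The (p-1)-th iterate fixes L, and over L every generator of L(p) has p-power period. *)
Lemma periodic_Lp g (x : subfield Lp) : exists r, iter (p ^ r * p.-1) g x = x.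
Proof.
have [h [hF hE]] := extendG g; have [k kE] := iter_rmorphism p.-1 h.
have kL : {in L, k =1 id} by move=> y yL; rewrite kE; exact: exp_pred_L.
suff sub : {subset Lp <= periodic_field p k}.
  have /asboolP[r rx] := sub _ (valP x); exists r; apply/val_inj; rewrite -[RHS]rx.
  rewrite (eq_iter kE) -iterM.
  by elim: (p ^ r * p.-1)%N => //= m <-; rewrite hE.
apply: adjoin_subset => [a La|y /galois_pext_closed[_ yper]]; apply/asboolP.
  by exists 0; rewrite /= kL.
by have [r] := yper k idfun kL (fun _ _ => erefl); exists r.
Qed.

(* [t] is the p'-part of [g]: the pointwise limit of the powers [g ^+ (p ^ k)]. *)
Lemma prime_part g : exists t : GG, [/\ fixes t Fp, (t ^+ p.-1 = 1)%g,
  forall x, val x \in L -> t x = g x & forall x, exists r, iter (p ^ r) g x = t x].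
Proof.
pose R x := projT1 (cid (periodic_Lp g x)).
pose f x := iter (p ^ R x) g x.
(* As p^(k+1) = p^k + p^k (p - 1), the values g^(p^k) x stop changing once p^k (p - 1) is a period
   of x. *)
have powE r k x : iter (p ^ r * p.-1) g x = x -> (r <= k)%N ->
    iter (p ^ k) g x = iter (p ^ r) g x.
  move=> rx /subnKC <-; elim: (k - r)%N => [|m IH]; first by rewrite addn0.
  rewrite addnS -IH; have -> : (p ^ (r + m).+1 = p ^ (r + m) + p ^ (r + m) * p.-1)%N.
    by rewrite expnSr -[X in (_ * X)%N = _](prednK (prime_gt0 pr_p)) mulnS.
  by rewrite iterD (iter_expn_fix (leq_addr m r) rx).
have RP x : iter (p ^ R x * p.-1) g x = x by rewrite /R; case: cid.
have fE r x : iter (p ^ r * p.-1) g x = x ->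
    forall k, (r <= k)%N -> iter (p ^ k) g x = f x.
  move=> rx k rk; rewrite (powE _ _ _ rx rk) -(powE _ _ _ rx (leq_maxl r (R x))).
  by rewrite (powE _ _ _ (RP x) (leq_maxr r (R x))).
have fR k x : (R x <= k)%N -> (g ^+ (p ^ k))%g x = f x.
  by rewrite galg_expE; exact: fE.
have fB : zmod_morphism f.
  move=> x y; pose k := maxn (R (x - y)) (maxn (R x) (R y)).
  rewrite -!(fR k) ?raddfB // /k ?leq_max ?leqnn ?orbT //.
have fM : GRing.monoid_morphism f.
  split=> [|x y]; first by rewrite -(fR _ _ (leqnn _)) rmorph1.
  pose k := maxn (R (x * y)) (maxn (R x) (R y)).
  by rewrite -!(fR k) ?rmorphM // /k ?leq_max ?leqnn ?orbT.
pose fRm : {rmorphism subfield Lp -> subfield Lp} :=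
  HB.pack f (GRing.isZmodMorphism.Build _ _ f fB) (GRing.isMonoidMorphism.Build _ _ f fM).
have fF x : val x \in F -> f x = x by move=> xF; rewrite -(fR _ _ (leqnn _)) galg_fix.
have [i iE] := subfield_inclusion sub_F_Lp.
have fbij : bijective f.
  apply: (@endo_bij _ _ i fRm) => [a|x]; first by apply: fF; rewrite iE; exact: (valP a).
  have [q q0 qx] := algF (val x); exists q => //.
  rewrite -(fmorph_root (val : {rmorphism subfield Lp -> Omega})) -map_poly_comp.
  by rewrite (eq_map_poly (g := val)).
have fP : `[< is_kaut F f >] by apply/asboolP.
exists (GalG fP : GG); split.
- move=> x xFp /=; have [r rx] := periodic_Fp g xFp.
  have fx k : iter (p ^ (r + k)) g x = x by rewrite expnD; exact: iter_pow_fix.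
  by rewrite -(fR (r + R x)%N) ?leq_addl // galg_expE fx.
- apply: galg_eqP => x; rewrite galg_expE.
  (* For large k each of the p - 1 applications of [f] equals g^(p^k), so together they amount to
     p^k (p - 1) applications of [g], a period of [x]. *)
  have [k0 k0P] : exists k0, forall k, (k0 <= k)%N ->
      iter p.-1 f x = iter (p ^ k * p.-1) g x.
    elim: p.-1 => [|m [k0 k0P]]; first by exists 0 => k _; rewrite muln0.
    exists (maxn k0 (R (iter m f x))) => k; rewrite geq_max => /andP[k0k Rk].
    by rewrite mulnS iterD /= -(fR _ _ Rk) galg_expE (k0P _ k0k).
  rewrite [LHS](k0P _ (leq_maxl k0 (R x))).
  exact: (iter_expn_fix (leq_maxr k0 (R x)) (RP x)).
(* On L the number p - 1 is already a period, so the sequence is constant from k = 0 on, where the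
   power is [g] itself. *)
- move=> x xL /=; rewrite -(fE 0 x _ 0) // expn0 mul1n -galg_expE.
  exact: exp_pred_fixes.
- by move=> x; exists (R x).
Qed.

(** An arbitrary lift is divided by its p'-part, which agrees with it on L and is trivial on
    F(p). *)
Lemma lift_Fp_L (c : galg Fp F) : exists2 g : GG, fixes g L & restr Fp g = c.
Proof.
have [g gc] := lift_Fp c; have [t [tFp _ tL _]] := prime_part g.
have tVFp := fixes_inv tFp.
exists (g * t^-1)%g => [x xL|].
  rewrite galg_mulE -tL ?galg_Kinv //; exact: stableG stable_L xL.
apply: restr_Fp_ext => x y xy; rewrite galg_mulE tVFp; last by rewrite -xy; exact: (valP x).
by rewrite -gc (restr_FpE g xy).
Qed.

(** If t is the p'-part of g, then u^-1 t u also fixes F(p) and has order dividing p - 1, so t fixes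
    u y. Since t u y = g^(p^r) u y for some r, every conjugate u y has p-power period under g. *)
Lemma fixed_prime_part (y : subfield Lp) :
  (forall t, fixes t Fp -> (t ^+ p.-1 = 1)%g -> t y = y) -> val y \in Fp.
Proof.
move=> yfix; apply: mem_adjoin; apply: closed_galois_pext => //; split.
  by apply: separable_Lp; exact: (valP y).
move=> h s hF sF; have [g gE] := restrictG hF; have [u uE] := restrictG sF.
have [t [tFp tp _ /(_ (u y))[r rE]]] := prime_part g; exists r.
have itE m z : iter m h (val z) = val (iter m g z) by elim: m => //= m ->; rewrite gE.
rewrite -uE itE rE; congr val.
have : (u^-1 * t * u)%g y = y.
  apply: yfix; first by rewrite -{2}(invgK u); exact: fixes_conj stable_Fp tFp.
  have cE m : ((u^-1 * t * u) ^+ m = u^-1 * t ^+ m * u)%g.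
    elim: m => [|m IH]; first by rewrite mulg1 mulVg.
    by rewrite !expgS IH !mulgA mulgK.
  by rewrite cE tp mulg1 mulVg.
by rewrite !galg_mulE => /(congr1 u); rewrite galg_Kinv.
Qed.

(** L is generated over F by finitely many roots of unity, so fixing L is an open condition. *)
Lemma mu_list : exists s : seq (subfield Lp), forall g, {in s, g =1 id} -> fixes g L.
Proof.
have [rs rsE] := closed_field_poly_normal ('X^p - 1 : {poly Omega}).
pose ms := [seq x <- rs | x ^+ p == 1].
have msLp : {in ms, forall x, x \in Lp}.
  by move=> x; rewrite mem_filter => /andP[/eqP/mu_in_L/sub_L_Lp].
exists (pmap (fun x => if pselect (x \in Lp) is left xL then Some (Subfield xL) else None) ms).
move=> g gs x xL; have [h [hF hE]] := extendG g; apply/val_inj; rewrite -hE.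
suff sub : {subset L <= equalizer h idfun} by exact/eqP/sub.
apply: adjoin_subset => [a Fa|w /= wp]; apply/eqP; first exact: hF.
have wms : w \in ms.
  rewrite mem_filter wp eqxx -root_prod_XsubC.
  have := rsE; rewrite (eqP (monicXnsubC 1 (prime_gt0 pr_p))) scale1r => <-.
  by rewrite /root !hornerE wp subrr.
have wLp := msLp w wms.
have /gs gw : Subfield wLp \in
    pmap (fun x => if pselect (x \in Lp) is left xL then Some (Subfield xL) else None) ms.
  rewrite mem_pmap; apply/mapP; exists w => //.
  by case: pselect => // wLp'; congr Some; exact: val_inj.
by have := hE (Subfield wLp); rewrite gw.
Qed.

(** This is openness of G_L -> G_F: automorphisms near 1 lift to automorphisms near 1. A lift that
    fixes [s'] agrees on [S] and on the p-th roots of unity with some [n] in N, and dividing by [n]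
    corrects it. *)
Lemma lift_Fp_near (S : seq (subfield Lp)) : exists s : seq (subfield Fp),
  forall c : galg Fp F, {in s, c =1 id} ->
    exists g : GG, [/\ fixes g L, {in S, g =1 id} & restr Fp g = c].
Proof.
have [M ML] := mu_list.
have algLp (x : subfield Lp) : algebraicOver (val : subfield F -> Omega) (val x) by [].
have [||s' [s'fix s'P]] := galg_closure sub_F_Lp algLp (H := fun g => fixes g Fp) (S ++ M).
- by [].
- by move=> g h; exact: fixes_mul.
have s'Fp y : y \in s' -> val y \in Fp.
  by move=> ys; apply: galois_Lp => [|g gFp]; [exact: sub_F_Fp | exact: s'fix].
exists (pmap (fun y : subfield Lp =>
  if pselect (val y \in Fp) is left yFp then Some (Subfield yFp) else None) s').
move=> c cs; have [g gc] := lift_Fp c.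
have [|n nFp gn] := s'P g.
  move=> y ys; have yFp := s'Fp y ys; apply/val_inj.
  rewrite -(restr_FpE g (erefl : val (Subfield yFp) = val y)) gc cs //.
  rewrite mem_pmap; apply/mapP; exists y => //.
  by case: pselect => // yFp'; congr Some; exact: val_inj.
have fixS : {in S ++ M, (n^-1 * g)%g =1 id}.
  by move=> x xS; rewrite galg_mulE gn // galg_invK.
exists (n^-1 * g)%g; split.
- by apply: ML => x xM; apply: fixS; rewrite mem_cat xM orbT.
- by move=> x xS; apply: fixS; rewrite mem_cat xS.
- apply: restr_Fp_ext => x y xy; rewrite galg_mulE (fixes_inv nFp).
    by rewrite -gc (restr_FpE g xy).
  by rewrite -(restr_FpE g xy); exact: (valP _).
Qed.

(** * Vanishing of N-invariant homomorphisms on Gal(L(p)/J) *)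

Section InvariantHom.
Variables (A : zmodType) (f : GG -> A) (S : seq (subfield Lp)).
Let N g := fixes g Fp.
Let N' g := fixes g Fp /\ fixes g L.
Hypothesis tors : forall a : A, a *+ p.-1 = 0 -> a = 0.
Hypothesis fM : forall x y, N' x -> N' y -> f (x * y)%g = f x + f y.
Hypothesis fJ : forall t x, N t -> N' x -> f (t * x * t^-1)%g = f x.
Hypothesis fS : forall x, N' x -> {in S, x =1 id} -> f x = 0.

Let N'1 : N' 1%g. Proof. by []. Qed.
Let N'M x y : N' x -> N' y -> N' (x * y)%g.
Proof. by move=> [xF xL] [yF yL]; split; exact: fixes_mul. Qed.
Let N'V x : N' x -> N' (x^-1)%g.
Proof. by move=> [xF xL]; split; exact: fixes_inv. Qed.
Let N'J t x : N' x -> N' (t * x * t^-1)%g.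
Proof.
by move=> [xF xL]; split; apply: fixes_conj => //; [exact: stable_Fp | exact: stable_L].
Qed.
Let f1 : f 1%g = 0.
Proof. by have := fM N'1 N'1; rewrite mulg1 -{1}[f 1%g]addr0 => /addrI. Qed.
Let fV x : N' x -> f (x^-1)%g = - f x.
Proof. by move=> xN; apply/eqP; rewrite -addr_eq0 -fM ?mulVg ?f1 //; exact: N'V. Qed.
Let N_exp x : N x -> N' (x ^+ p.-1)%g.
Proof. by move=> xN; split; [exact: fixes_exp | exact: exp_pred_fixes]. Qed.

Let comm x y : GG := (x * y * x^-1 * y^-1)%g.

Let N'_comm x y : N x -> N y -> N' (comm x y).
Proof.
move=> xN yN; split.
  exact: fixes_mul (fixes_mul (fixes_mul xN yN) (fixes_inv xN)) (fixes_inv yN).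
move=> z zL; rewrite /comm !galg_mulE.
have tL t w : val w \in L -> val (t w) \in L by exact: stableG stable_L.
rewrite (abelian_L x y); last by apply/tL/tL.
by rewrite galg_Kinv galg_Kinv.
Qed.

(* Conjugation-invariance makes [k |-> f (comm (x ^+ k) y)] additive, and
   [x ^+ p.-1] lies in the domain of [f]. *)
Let f_comm x y : N x -> N y -> f (comm x y) = 0.
Proof.
move=> xN yN; have fk k : f (comm (x ^+ k)%g y) = f (comm x y) *+ k.
  elim: k => [|k IH]; first by rewrite /comm expg0 mul1g invg1 mulg1 mulgV f1 mulr0n.
  have -> : comm (x ^+ k.+1)%g y = (x * comm (x ^+ k) y * x^-1 * comm x y)%g.
    by rewrite /comm expgS invMg !mulgA !mulgKV.
  have kN : N' (comm (x ^+ k)%g y) by apply: N'_comm => //; exact: fixes_exp.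
  by rewrite fM ?fJ ?IH -?mulrSr //; [exact: N'J | exact: N'_comm].
apply: tors; rewrite -fk.
have xp := N_exp xN; rewrite /comm -!mulgA fM //; last first.
  by rewrite mulgA; apply: N'J; exact: N'V.
by rewrite mulgA fJ ?fV ?subrr //; exact: N'V.
Qed.

(** The error term [w] is a product of conjugates of commutators, all of which [f] kills. *)
Let f_expM x y k : N x -> N y -> exists w,
  [/\ N' w, f w = 0 & ((x * y) ^+ k = x ^+ k * y ^+ k * w)%g].
Proof.
move=> xN yN; elim: k => [|k [w [wN fw wE]]].
  by exists 1%g; rewrite !expg0 !mulg1.
(* This commutator moves [x] across [y ^+ k]; it and the old error term are then conjugated to the
   right end. *)
pose c := comm (y ^- k)%g (x^-1)%g.
have xyN : N (x * y)%g by exact: fixes_mul.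
have ykN : N (y ^- k)%g by apply/fixes_inv/fixes_exp.
have xVN : N (x^-1)%g by exact: fixes_inv.
have yVN : N (y^-1)%g by exact: fixes_inv.
have cN : N' c by exact: N'_comm.
exists (y^-1 * c * y * ((x * y)^-1 * w * (x * y)))%g.
have J1 : N' (y^-1 * c * y)%g by rewrite -{2}(invgK y); exact: N'J.
have J2 : N' ((x * y)^-1 * w * (x * y))%g by rewrite -{2}(invgK (x * y)%g); exact: N'J.
split; first exact: N'M.
  rewrite fM // -{2}(invgK y) fJ // f_comm // add0r.
  by rewrite -{2}(invgK (x * y)%g) fJ //; exact: fixes_inv.
rewrite !expgSr wE /c /comm !invgK invMg !mulgA.
by rewrite !(mulgK, mulgKV) -!mulgA.
Qed.

Let V g := N g /\ f (g ^+ p.-1)%g = 0.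

(* The subgroup [V] contains the p'-part of every automorphism, so its fixed field is
   contained in F(p); hence [V] is dense in [N]. *)
Lemma invariant_hom_trivial x : N' x -> f x = 0.
Proof.
move=> xN; have [M ML] := mu_list.
have algLp (z : subfield Lp) : algebraicOver (val : subfield F -> Omega) (val z) by [].
(* The roots of unity [M] are added so that [v^-1 * x] below fixes L as well and lies in N', where
   smallness on [S] makes [f] vanish. *)
have [||s [sfix sP]] := galg_closure sub_F_Lp algLp (H := V) (S ++ M).
- by split; rewrite ?expg1n.
- move=> g h [gN fg] [hN fh]; split; first exact: fixes_mul.
  have [w [wN fw ->]] := f_expM p.-1 gN hN.
  by rewrite !fM ?fg ?fh ?fw ?addr0 //; do ?[apply: N'M]; exact: N_exp.
have [|v [vN fv] xv] := sP x.
  move=> y ys; apply: (proj1 xN); apply: fixed_prime_part => t tN tp.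
  by apply: sfix ys _ _; split=> //; rewrite tp f1.
have ufix : {in S ++ M, (v^-1 * x)%g =1 id}.
  by move=> y yS; rewrite galg_mulE xv // galg_invK.
have uN : N' (v^-1 * x)%g.
  split; first by apply: fixes_mul; [exact: fixes_inv | exact: (proj1 xN)].
  by apply: ML => y yM; apply: ufix; rewrite mem_cat yM orbT.
(* As [v] differs from [x] by an element of N', it lies in N' itself; there [f] is additive on
   powers of [v], and f(v^(p-1)) = 0 forces f(v) = 0. *)
have vE : v = (x * (v^-1 * x)^-1)%g by rewrite invMg invgK mulKVg.
have vN' : N' v by rewrite vE; apply: N'M => //; exact: N'V.
have fexp k : f (v ^+ k)%g = f v *+ k.
  elim: k => [|k IH]; first by rewrite expg0 f1.
  have vkN : N' (v ^+ k)%g by split; apply: fixes_exp; case: vN'.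
  by rewrite expgS fM // IH mulrS.
have fv0 : f v = 0 by apply: tors; rewrite -fexp.
have -> : x = (v * (v^-1 * x))%g by rewrite mulKVg.
rewrite fM // fv0 add0r; apply: fS => // y yS.
by apply: ufix; rewrite mem_cat yS.
Qed.

End InvariantHom.
End Tower.

(** * Cochains and inner conjugation *)

Section Cohomology.
Variables (G : topGroupType) (A : zmodType) (M : gmodule G A).

Definition coh_class i (z : cocycle M i) : coh M i :=
  \pi_(zquot (coboundary_pred M i))%qT z.

Lemma coh_classB i : zmod_morphism (@coh_class i).
Proof. by move=> y z; exact: raddfB. Qed.

HB.instance Definition _ i :=
  GRing.isZmodMorphism.Build (cocycle M i) (coh M i) (@coh_class i) (@coh_classB i).

Lemma coh_repr i (c : coh M i) : exists z : cocycle M i, c = coh_class z.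
Proof. by exists (repr c); rewrite /coh_class reprK. Qed.

Lemma coh_eqP i (y z : cocycle M i) :
  coh_class y = coh_class z <-> is_coboundary M (val y - val z).
Proof.
split=> [/eqP|H].
  by rewrite -Quotient.idealrBE => /asboolP.
by apply/eqP; rewrite -Quotient.idealrBE; apply/asboolP.
Qed.

Lemma coh_eq0P i (z : cocycle M i) : coh_class z = 0 <-> is_coboundary M (val z).
Proof.
have := coh_eqP z 0; have -> : coh_class (0 : cocycle M i) = 0 by exact: raddf0.
by have -> : val z - val (0 : cocycle M i) = val z by exact: subr0.
Qed.

Lemma cocycleP i (z : cocycle M i) : locally_constant (val z) /\ coboundary M (val z) = 0.
Proof. by have /asboolP := zsub_valP z. Qed.

End Cohomology.

Lemma ptws_continuous (X G : topologicalType) i (phi : X -> {ptws 'I_i -> G}) :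
  (forall k, continuous (fun x => phi x k)) -> continuous phi.
Proof.
move=> phik x; apply/cvg_sup => k.
apply: (continuous_comp_initial (w := fun z : {ptws 'I_i -> G} => z k) (f := phi)).
exact: phik.
Qed.

Lemma ptws_proj_continuous (G : topologicalType) i (k : 'I_i) :
  continuous (fun x : {ptws 'I_i -> G} => x k).
Proof. exact: (@proj_continuous _ (fun=> G) k). Qed.

Section LocallyConstant.
Variables (G : topGroupType) (A : zmodType).

Lemma locally_constant_comp (G' : topGroupType) i j (f : ('I_i -> G) -> A)
    (phi : ('I_j -> G') -> 'I_i -> G) :
  continuous (phi : {ptws 'I_j -> G'} -> {ptws 'I_i -> G}) ->
  locally_constant f -> locally_constant (f \o phi).
Proof.
move=> phic /locally_constantP fc; apply/locally_constantP => x.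
exact: phic x _ (fc (phi x)).
Qed.

Lemma locally_constant_sum i n (f : nat -> ('I_i -> G) -> A) :
  (forall k, locally_constant (f k)) ->
  locally_constant (fun x => \sum_(k < n) f k x *~ (-1) ^+ k).
Proof.
move=> fc; elim: n => [|n IH].
  have -> : (fun x => \sum_(k < 0) f k x *~ (-1) ^+ k) = 0.
    by apply/funext => x; rewrite big_ord0.
  exact: locally_constant0.
have fN k : locally_constant (- f k).
  rewrite -[X in locally_constant X]sub0r.
  by apply: locally_constantB; [exact: locally_constant0 | exact: fc].
have -> : (fun x => \sum_(k < n.+1) f k x *~ (-1) ^+ k) =
    (fun x => \sum_(k < n) f k x *~ (-1) ^+ k) - (if odd n then f n else - f n).
  apply/funext => x; rewrite big_ord_recr /= -signr_odd.
  case: (odd n); rewrite ?mulrN1z //.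
  by rewrite opprK.
apply: locally_constantB => //; case: (odd n) => //; exact: fN.
Qed.

End LocallyConstant.

Lemma conjg_continuous (G : topGroupType) (g : G) : continuous (fun x : G => (g^-1 * x * g)%g).
Proof.
move=> x.
apply: (@continuous_comp G (G * G)%type G (fun x => (g^-1 * x, g)%g)
  (fun z => (z.1 * z.2)%g) x); last exact: mulg_continuous.
apply: cvg_pair; last exact: cvg_cst.
apply: (@continuous_comp G (G * G)%type G (fun x => (g^-1, x)%g)
  (fun z => (z.1 * z.2)%g) x); last exact: mulg_continuous.
by apply: cvg_pair; [exact: cvg_cst|exact: cvg_id].
Qed.

(* The double sum attached to the prism operator: the diagonal terms telescope
   and the others are the faces of the homotopy. *)
Lemma prism_sum (A : zmodType) m (a : nat -> A) (D T : nat -> nat -> A) :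
  (forall k, T k k = a k) -> (forall k, T k k.+1 = a k.+1) ->
  (forall k j, (j < k)%N -> T k j = D j k.-1) ->
  (forall k j, (k < j)%N -> T k j.+1 = D j k) ->
  \sum_(0 <= k < m.+1) \sum_(0 <= j < m.+2) T k j *~ ((-1) ^+ k * (-1) ^+ j) =
  a 0%N - a m.+1 -
  \sum_(0 <= j < m.+1) \sum_(0 <= k < m) D j k *~ ((-1) ^+ k * (-1) ^+ j).
Proof.
move=> T1 T2 T3 T4.
have sgn2 k : (-1) ^+ k * (-1) ^+ k = 1 :> int by rewrite -expr2 sqrr_sign.
have inner k : (k < m.+1)%N ->
  \sum_(0 <= j < m.+2) T k j *~ ((-1) ^+ k * (-1) ^+ j) =
  (a k - a k.+1) +
  (\sum_(0 <= j < k) D j k.-1 *~ ((-1) ^+ k * (-1) ^+ j) -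
   \sum_(k.+1 <= j < m.+1) D j k *~ ((-1) ^+ k * (-1) ^+ j)).
  move=> km; rewrite (big_cat_nat (n := k)) //=; last by rewrite ltnW // ltnW.
  rewrite (@big_ltn _ _ _ k) // ; last by rewrite ltnW.
  rewrite (@big_ltn _ _ _ k.+1) // big_add1 /= T1 T2 sgn2 exprS mulrCA sgn2.
  rewrite mulr1 mulrN1z mulr1z addrCA [X in _ + X]addrCA addrA.
  congr (_ + (_ + _)).
    by apply: eq_big_nat => j jk; rewrite T3 //; case/andP: jk.
  rewrite -sumrN; apply: eq_big_nat => j /andP[kj _].
  by rewrite T4 // exprS mulN1r mulrN mulrNz.
have innerP k : (0 <= k < m.+1)%N -> _ := fun km => inner k (proj2 (andP km)).
rewrite (eq_big_nat _ _ innerP) big_split /=.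
rewrite (@telescope_sumr_eq A 0 m.+1 (fun k => - a k)) //; last first.
  by move=> k _; rewrite opprK addrC.
rewrite opprK [- a _ + _]addrC; congr (_ + _); rewrite sumrB.
rewrite [X in X - _ = _]big_nat_recl // [X in X + _ - _]big_geq // add0r.
rewrite [X in _ - X = _]big_nat_recr //= [X in _ - (_ + X)]big_geq // addr0 -sumrB.
rewrite exchange_big /= -sumrN; apply: eq_big_nat => k /andP[_ km].
rewrite [in RHS](big_cat_nat (n := k.+1)) //= ?(leqW km) // opprD; congr (_ + _).
by rewrite -sumrN; apply: eq_bigr => j _; rewrite exprS mulN1r mulNr mulrNz.
Qed.

Lemma coh_map_class (G G' : topGroupType) (A A' : zmodType) (M : gmodule G A)
    (M' : gmodule G' A') phi psi (c : compatible M M' phi psi) i (z : cocycle M i) :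
  coh_map c i (coh_class z) = coh_class (cocycle_map c z).
Proof.
exact: (quot_map_pi (cocycle_mapB c (i := i)) (@cocycle_map_coboundary _ _ _ _ _ _ _ _ c i)).
Qed.

Section ModuleAction.
Variables (G : topGroupType) (A : zmodType) (M : gmodule G A).

Definition gact_fun (x : G) : A -> A := M x.

HB.instance Definition _ (x : G) :=
  GRing.isZmodMorphism.Build A A (gact_fun x) (gactB M x).

Lemma gact_sum x (n : nat) (F : nat -> A) (P : nat -> int) :
  M x (\sum_(0 <= k < n) F k *~ P k) = \sum_(0 <= k < n) M x (F k) *~ P k.
Proof.
rewrite -[M x]/(gact_fun x) raddf_sum; by apply: eq_bigr => k _; rewrite raddfMz.
Qed.

End ModuleAction.

Section InnerConjugationTrivial.
Variables (G : topGroupType) (A : zmodType) (M : gmodule G A) (g : G).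
Implicit Types (u v w : nat -> G).

(** Tuples are treated as sequences over [nat], padded with 1, so that insertions and faces compose
    without changing index types. *)
Let res i u : 'I_i -> G := fun j => u j.
Let ext i (x : 'I_i -> G) : nat -> G := fun n => if insub n is Some o then x o else 1%g.
Let conj (a : G) : G := (g^-1 * a * g)%g.
Let nface k u : nat -> G := fun n => if (n.+1 < k)%N then u n
  else if n.+1 == k then (u n * u n.+1)%g else u n.+1.
(** The k-th simplex of the prism between a tuple and its conjugate: read as a path, it follows [u],
    crosses along [g], and continues on the conjugated side. *)
Let nins k u : nat -> G := fun n => if (n < k)%N then u n
  else if n == k then g else conj (u n.-1).

Let resK i (x : 'I_i -> G) : res (ext x) = x.
Proof. by apply/funext => j; rewrite /res /ext valK. Qed.

Let extK i u n : (n < i)%N -> ext (res u : 'I_i -> G) n = u n.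
Proof. by move=> ni; rewrite /ext insubT. Qed.

Let ext_continuous i n : continuous (fun x : {ptws 'I_i -> G} => ext x n).
Proof.
by rewrite /ext; case: insubP => [o _ _|_] x; [exact: ptws_proj_continuous | exact: cvg_cst].
Qed.

Let eq_res i u v : (forall n, (n < i)%N -> u n = v n) -> res u = res v :> ('I_i -> G).
Proof. by move=> uv; apply/funext => j; apply: uv. Qed.

Let nface_nins_lt j k u : (j < k)%N -> nface j (nins k u) = nins k.-1 (nface j u).
Proof.
move=> jk; apply/funext => n; rewrite /nface /nins /conj.
do 12?[case: ifP => ?]; try lia; try by [].
all: have E : n.-1.+1 = n by lia.
all: rewrite ?E //; lia.
Qed.

Let nface_nins_diag k u : nface k.+1 (nins k.+1 u) = nface k.+1 (nins k u).
Proof.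
apply/funext => n; rewrite /nface /nins /conj.
do 12?[case: ifP => ?]; try lia; try by [].
all: by rewrite ?mulgA ?mulgV ?mul1g.
Qed.

Let nface_nins_gt j k u : (k < j)%N -> nface j.+1 (nins k u) = nins k (nface j u).
Proof.
move=> kj; apply/funext => n; rewrite /nface /nins /conj.
do 12?[case: ifP => ?]; try lia; try by [].
all: have E : n.-1.+1 = n by lia.
all: rewrite ?E //; try lia.
all: by rewrite !mulgA mulgK.
Qed.

Let term i (f : ('I_i -> G) -> A) j w : A :=
  if j is j'.+1 then f (res (nface j w)) else M (w 0) (f (res (nface 0 w))).

Let coboundary_res i (f : ('I_i -> G) -> A) w :
  coboundary M f (res w) = \sum_(0 <= j < i.+2) term f j w *~ (-1) ^+ j.
Proof. by rewrite big_mkord big_ord_recl. Qed.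

Let homotopy i (f : ('I_i -> G) -> A) j k u : A :=
  if j is j'.+1 then f (res (nins k (nface j u))) else M (u 0) (f (res (nins k (nface 0 u)))).

Let prism i (f : ('I_i -> G) -> A) (y : 'I_i -> G) : coboundary M f = 0 ->
  M g (f (conj \o y)) - f y =
  \sum_(0 <= j < i.+1) \sum_(0 <= k < i) homotopy f j k (ext y) *~ ((-1) ^+ k * (-1) ^+ j).
Proof.
move=> f0; set u := ext y.
(* [a k] is the face shared by the simplices k - 1 and k of the prism; the two ends [a 0] and
   [a i.+1] are the conjugated and the original value. *)
pose a k := if k is k'.+1 then term f k (nins k' u) else term f 0 (nins 0 u).
have T1 k : term f k (nins k u) = a k by case: k => //= k; rewrite nface_nins_diag.
have T2 k : term f k.+1 (nins k u) = a k.+1 by [].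
have T3 k j : (j < k)%N -> term f j (nins k u) = homotopy f j k.-1 u.
  by case: j => [|j] jk; rewrite /homotopy /= nface_nins_lt //; case: k jk.
have T4 k j : (k < j)%N -> term f j.+1 (nins k u) = homotopy f j k u.
  by case: j => // j kj; rewrite /= nface_nins_gt.
have := prism_sum (T := fun k j => term f j (nins k u)) i T1 T2 T3 T4.
under eq_bigr => k _.
  under eq_bigr do rewrite mulrC mulrzA.
  rewrite -mulrz_suml -coboundary_res f0 mul0rz.
  over.
rewrite big1 // => /esym/eqP; rewrite subr_eq0 => /eqP <-.
congr (_ - _).
  by rewrite /a /= -[in LHS](resK y).
rewrite /a /= -[in LHS](resK y); congr f; apply: eq_res => n ni.
by rewrite /nface /nins ltnS ni.
Qed.

(** The alternating sum of a cocycle over the insertions of [g] is a primitive of the difference; in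
    degree 0 the sum is empty and the two cochains coincide. *)
Lemma inner_conj_id i (c : coh M i) : inner_conj M g i c = c.
Proof.
have [z ->] := coh_repr c; rewrite [LHS]coh_map_class; apply/coh_eqP.
have [zc z0] := cocycleP z.
have zE : val (cocycle_map (inner_compatible M g) z) - val z =
    (fun y => M g (val z (conj \o y)) - val z y) by [].
rewrite zE {zE}; move: (val z) zc z0 => {c z} f fc f0.
under [X in is_coboundary M X]funext do rewrite prism //.
case: i f fc f0 => [|m] f fc f0.
  by apply/funext => y; rewrite /= big1 // => j _; rewrite big_geq.
exists (fun x : 'I_m -> G => \sum_(k < m.+1) f (res (nins k (ext x))) *~ (-1) ^+ k).
  apply: (locally_constant_sum (f := fun k x => f (res (nins k (ext x))))) => k.
  apply: (locally_constant_comp (phi := fun x => res (nins k (ext x)))) fc.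
  apply: ptws_continuous => l; rewrite /res /nins.
  case: (l < k)%N; first exact: ext_continuous.
  case: (_ == _) => x; first exact: cvg_cst.
  apply: (@continuous_comp {ptws 'I_m -> G} G G (fun z => ext z l.-1) conj x).
    exact: ext_continuous.
  exact: conjg_continuous.
apply/funext => y; rewrite -[in RHS](resK y) coboundary_res.
have hE v : \sum_(k < m.+1) f (res (nins k (ext (res v : 'I_m -> G)))) *~ (-1) ^+ k =
    \sum_(0 <= k < m.+1) f (res (nins k v)) *~ (-1) ^+ k.
  rewrite big_mkord; apply: eq_bigr => k _; congr (f _ *~ _).
  apply: eq_res => n nm; rewrite /nins.
  have km := ltn_ord k.
  have [nk|nk|//] := ltngtP n k; rewrite extK //; lia.
apply: eq_bigr => -[|j] _; rewrite /= hE ?gact_sum mulrz_suml;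
  by apply: eq_bigr => k _; rewrite -mulrzA.
Qed.

End InnerConjugationTrivial.

(** * Transport of quotients, eigenmodules and cohomology *)

Lemma zmod_iso_sym (A B : zmodType) : zmod_iso A B -> zmod_iso B A.
Proof.
case=> f [h fK hK].
have hB : zmod_morphism h by move=> x y; apply: (can_inj fK); rewrite raddfB !hK.
exists (HB.pack h (GRing.isZmodMorphism.Build _ _ h hB) : {additive B -> A}).
by exists f.
Qed.

Section QuotientIso.
Variables (A B : zmodType) (I : zmodClosed A) (f : {additive A -> B}).
Hypothesis fI : forall x, (f x == 0) = (x \in I).
Hypothesis f_surj : forall y, exists x, f x = y.

Lemma quotient_iso : exists h : {additive zquot I -> B},
  bijective h /\ forall x, h (\pi_(zquot I)%qT x) = f x.
Proof.
pose h (c : zquot I) := f (repr c).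
have hE x : h (\pi_(zquot I)%qT x) = f x.
  apply/eqP; rewrite /h -subr_eq0 -raddfB fI.
  by rewrite Quotient.idealrBE reprK.
have hB : zmod_morphism h.
  by move=> c d; rewrite -[c]reprK -[d]reprK -raddfB !hE raddfB.
exists (HB.pack h (GRing.isZmodMorphism.Build _ _ h hB) : {additive zquot I -> B}).
split=> //.
exists (fun y => \pi_(zquot I)%qT (projT1 (cid (f_surj y)))) => [c|y] /=; last first.
  by rewrite hE; case: cid.
case: cid => x /= xc; rewrite -[RHS]reprK; apply/eqP.
by rewrite -Quotient.idealrBE -fI raddfB xc subrr.
Qed.

End QuotientIso.

Section EigenmoduleMaps.
Variables (G : topGroupType) (m : nat) (A B : zmodType).
Variables (actA : G -> {additive A -> A}) (actB : G -> {additive B -> B}).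
Variable (chi : G -> {unit 'Z_m}).

Lemma eigenmodule_embeds (f : {additive A -> B}) :
  injective f -> (forall x, f x \in eigen_pred actB chi) ->
  zmod_embeds A (eigenmodule actB chi).
Proof.
move=> f_inj fE; pose h x : eigenmodule actB chi := ZSub (fE x).
have hB : zmod_morphism h by move=> x y; apply/val_inj; rewrite /= raddfB.
exists (HB.pack h (GRing.isZmodMorphism.Build _ _ h hB) :
  {additive A -> eigenmodule actB chi}).
by move=> x y /(congr1 val) /f_inj.
Qed.

Lemma eigenmodule_iso (f : {additive A -> B}) :
  injective f -> (forall x, f x \in eigen_pred actB chi) ->
  (forall y, y \in eigen_pred actB chi -> exists x, f x = y) ->
  zmod_iso A (eigenmodule actB chi).
Proof.
move=> f_inj fE f_surj; pose h x : eigenmodule actB chi := ZSub (fE x).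
have hB : zmod_morphism h by move=> x y; apply/val_inj; rewrite /= raddfB.
exists (HB.pack h (GRing.isZmodMorphism.Build _ _ h hB) :
  {additive A -> eigenmodule actB chi}).
have sy (y : eigenmodule actB chi) : exists x, f x = val y by apply: f_surj; exact: zsub_valP.
exists (fun y => projT1 (cid (sy y))) => [x|y] /=; case: cid => /= z.
  exact: f_inj.
by move=> zE; apply/val_inj.
Qed.

Lemma eigenmodule_equivariant (f : {additive A -> B}) : bijective f ->
  (forall g x, f (actA g x) = actB g (f x)) ->
  zmod_iso (eigenmodule actA chi) (eigenmodule actB chi).
Proof.
move=> [h fK hK] fact.
have eigf x : (f x \in eigen_pred actB chi) = (x \in eigen_pred actA chi).
  apply/asboolP/asboolP => xE g.
    by apply: (can_inj fK); rewrite fact xE /unit_scale raddfMn.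
  by rewrite -fact xE /unit_scale raddfMn.
have fP (x : eigenmodule actA chi) : f (val x) \in eigen_pred actB chi.
  by rewrite eigf; exact: zsub_valP.
pose k x : eigenmodule actB chi := ZSub (fP x).
have kB : zmod_morphism k by move=> x y; apply/val_inj; rewrite /= raddfB.
exists (HB.pack k (GRing.isZmodMorphism.Build _ _ k kB) :
  {additive eigenmodule actA chi -> eigenmodule actB chi}).
have hP (y : eigenmodule actB chi) : h (val y) \in eigen_pred actA chi.
  by rewrite -eigf hK; exact: zsub_valP.
by exists (fun y => ZSub (hP y)) => x; apply/val_inj => /=.
Qed.

End EigenmoduleMaps.

Lemma cocycle_mulrn (G : topGroupType) (A : zmodType) (M : gmodule G A) i
    (z : cocycle M i) u x : val (z *+ u) x = val z x *+ u.
Proof. by elim: u => [|u IH]; rewrite ?mulr0n // !mulrS -IH. Qed.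

Section CohomologyMaps.
Variables (G G' : topGroupType) (A A' : zmodType).
Variables (M : gmodule G A) (M' : gmodule G' A') (phi : G' -> G) (psi : A -> A').
Hypothesis c : compatible M M' phi psi.

Lemma coh_map_bij phi' psi' (c' : compatible M' M phi' psi') i :
  cancel phi phi' -> cancel phi' phi -> cancel psi psi' -> cancel psi' psi ->
  bijective (coh_map c i).
Proof.
move=> phiK phi'K psiK psi'K.
exists (coh_map c' i) => x; have [z ->] := coh_repr x; rewrite !coh_map_class;
  congr coh_class; apply/val_inj/funext => y; rewrite /= /cochain_map.
  rewrite psiK; have -> // : phi \o (phi' \o y) = y.
  by apply/funext => j /=; rewrite phi'K.
rewrite psi'K; have -> // : phi' \o (phi \o y) = y.
by apply/funext => j /=; rewrite phiK.
Qed.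

Lemma compatible_inverse phi' psi' : continuous phi' ->
  cancel phi phi' -> cancel phi' phi -> cancel psi psi' -> cancel psi' psi ->
  compatible M' M phi' psi'.
Proof.
move=> phi'c phiK phi'K psiK psi'K; split=> // [x y|a b|x a].
- by apply: (can_inj phiK); rewrite (compatibleM c) !phi'K.
- by apply: (can_inj psiK); rewrite (compatibleB c) !psi'K.
- apply: (can_inj psiK); rewrite psi'K.
  by have := compatible_act c (phi' x) (psi' a); rewrite phi'K psi'K.
Qed.

(* Naturality with respect to conjugation by [gamma]; as inner conjugations act
   trivially on cohomology, only the scalar [u] remains. *)
Lemma coh_map_twist gamma phi' psi' (c' : compatible M' M' phi' psi') u i (x : coh M i) :
  (forall y, phi (phi' y) = (gamma^-1 * phi y * gamma)%g) ->
  (forall a, psi' (psi a) = psi (M gamma a) *+ u) ->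
  coh_map c' i (coh_map c i x) = coh_map c i x *+ u.
Proof.
move=> phiE psiE; rewrite -{2}(inner_conj_id gamma x).
have [z ->] := coh_repr x; rewrite /inner_conj !coh_map_class -raddfMn.
congr coh_class; apply/val_inj/funext => y; rewrite cocycle_mulrn /= /cochain_map /=.
have -> : phi \o (phi' \o y) = (fun x => gamma^-1 * x * gamma)%g \o (phi \o y).
  by apply/funext => j; exact: phiE.
exact: psiE.
Qed.

End CohomologyMaps.

(** * Cochains in degrees 0, 1 and 2 *)

Section LowDegree.
Variables (G : topGroupType) (A : zmodType) (M : gmodule G A).

Definition single (x : G) : 'I_1 -> G := fun=> x.
Definition couple (x y : G) : 'I_2 -> G := fun j => if val j == 0%N then x else y.
Definition empty_family : 'I_0 -> G := fun=> 1%g.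

Lemma singleK (y : 'I_1 -> G) : single (y ord0) = y.
Proof. by apply/funext => j; rewrite [j]ord1. Qed.

Lemma coupleK (y : 'I_2 -> G) : couple (y ord0) (y ord_max) = y.
Proof.
by apply/funext => -[[|[|//]] jlt]; congr (y _); apply/val_inj.
Qed.

Lemma empty_familyE (y : 'I_0 -> G) : y = empty_family.
Proof. by apply/funext => -[]. Qed.

Lemma coboundary_single (h : ('I_0 -> G) -> A) x :
  coboundary M h (single x) = M x (h empty_family) - h empty_family.
Proof. by rewrite /coboundary big_ord1 expr1 mulrN1z !(empty_familyE (face _ _)). Qed.

Lemma coboundary_couple (f : ('I_1 -> G) -> A) x y :
  coboundary M f (couple x y) =
  M x (f (single y)) - f (single (x * y)%g) + f (single x).
Proof.
have E0 : face 0 (couple x y) = single y by rewrite -[LHS]singleK.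
have E1 : face 1 (couple x y) = single (x * y)%g by rewrite -[LHS]singleK.
have E2 : face 2 (couple x y) = single x by rewrite -[LHS]singleK.
rewrite /coboundary big_ord_recl big_ord1 /= E0 E1 E2 expr1 mulrN1z addrA.
by rewrite sqrrN expr1n mulr1z.
Qed.

Lemma cocycle1P (f : ('I_1 -> G) -> A) : coboundary M f = 0 ->
  forall x y, f (single (x * y)%g) = f (single x) + M x (f (single y)).
Proof.
move=> f0 x y; have /eqP := coboundary_couple f x y.
by rewrite f0 addrAC eq_sym subr_eq0 addrC => /eqP ->.
Qed.

Lemma locally_constant_single (f : ('I_1 -> G) -> A) :
  locally_constant f <-> forall x, \forall y \near x, f (single y) = f (single x).
Proof.
split=> [/locally_constantP fc x|fc].
  have sc : continuous (single : G -> {ptws 'I_1 -> G}).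
    by apply: ptws_continuous => k x'; exact: cvg_id.
  exact: sc x _ (fc (single x)).
apply/locally_constantP => x.
have near_x : \forall y \near (x : {ptws 'I_1 -> G}),
    f (single (y ord0)) = f (single (x ord0)).
  exact: (@ptws_proj_continuous G 1 ord0 x _ (fc (x ord0))).
by apply: filterS near_x => y; rewrite !singleK.
Qed.

Lemma locally_constant_empty_family (h : ('I_0 -> G) -> A) : locally_constant h.
Proof.
apply/locally_constantP => x; apply: filterE => y.
by rewrite (empty_familyE y) (empty_familyE x).
Qed.

End LowDegree.

(** * Inflation *)

Section UnitScale.
Variables (A : zmodType) (m : nat).
Hypotheses (m_gt1 : (1 < m)%N) (Am : forall a : A, a *+ m = 0).
Implicit Types (u v : {unit 'Z_m}) (a : A).

Lemma mulrn_modn k a : a *+ (k %% m) = a *+ k.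
Proof. by rewrite [in RHS](divn_eq k m) mulrnDr mulnC mulrnA Am mul0rn add0r. Qed.

Lemma unit_scale1 a : unit_scale (1%g : {unit 'Z_m}) a = a.
Proof. by rewrite /unit_scale /= modn_small ?Zp_cast // mulr1n. Qed.

Lemma unit_scaleM u v a : unit_scale (u * v)%g a = unit_scale u (unit_scale v a).
Proof. by rewrite /unit_scale /= [X in (_ %% X)%N]Zp_cast // mulrn_modn mulnC mulrnA. Qed.

Lemma unit_scaleVK u a : unit_scale (u^-1)%g (unit_scale u a) = a.
Proof. by rewrite -unit_scaleM mulVg unit_scale1. Qed.

Lemma unit_scaleKV u a : unit_scale u (unit_scale (u^-1)%g a) = a.
Proof. by rewrite -unit_scaleM mulgV unit_scale1. Qed.

End UnitScale.

Lemma mu_mulrn (K : fieldType) m (a : mu K m) : a *+ m = 0.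
Proof.
apply/val_inj; rewrite raddfMn raddf0 /=.
by have /eqP := zsub_valP a.
Qed.

Section Restriction.
Variables (Omega : fieldType) (E E' K : divringClosed Omega).
Hypothesis E'E : {subset E' <= E}.
Hypothesis stab : forall (g : galg E K) x, val x \in E' -> val (g x) \in E'.
Implicit Types g h : galg E K.

Lemma restr_val g (x : subfield E') : val (restr E' g x) = val (g (Subfield (E'E (valP x)))).
Proof. exact: restrP. Qed.

Lemma restrM g h : restr E' (g * h)%g = (restr E' g * restr E' h)%g.
Proof.
apply: galg_eqP => x; apply/val_inj; rewrite restr_val !galg_mulE restr_val.
by congr (val (g _)); apply/val_inj; rewrite /= restr_val.
Qed.

Lemma restr1 : restr E' (1%g : galg E K) = 1%g.
Proof. by apply: galg_eqP => x; apply/val_inj; rewrite restr_val. Qed.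

Lemma restrV g : restr E' (g^-1)%g = ((restr E' g)^-1)%g.
Proof.
apply: (mulgI (restr E' g)); rewrite -restrM !mulgV; exact: restr1.
Qed.

Lemma restr_continuous : continuous (restr E' : galg E K -> galg E' K).
Proof.
move=> g U /galg_nbhsP[s sU]; apply/galg_nbhsP.
exists [seq Subfield (E'E (valP x)) | x <- s] => h hg; apply: sU => x xs.
by apply/val_inj; rewrite !restr_val hg //; apply/mapP; exists x.
Qed.

End Restriction.

Section BaseChange.
Variables (Omega : fieldType) (E K L : divringClosed Omega).
Hypothesis KL : {subset K <= L}.

Fact galg_base_subproof (x : galg E L) : `[< is_kaut K x >].
Proof.
apply/asboolP; have [xB xM xbij xL] := galgP x; split=> // y /KL; exact: xL.
Qed.

Definition galg_base (x : galg E L) : galg E K := GalG (galg_base_subproof x).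

Lemma galg_baseM : {morph galg_base : x y / (x * y)%g}.
Proof. by move=> x y; exact: galg_eqP. Qed.

Lemma galg_base_inj : injective galg_base.
Proof.
by move=> x y xy; apply: galg_eqP => z; exact: (congr1 (fun g : galg E K => g z) xy).
Qed.

Lemma galg_base_fixes x : fixes (galg_base x) L.
Proof. by move=> y yL; exact: (galg_fix x). Qed.

Lemma galg_base_surj (g : galg E K) : fixes g L -> exists x, galg_base x = g.
Proof.
move=> gL; have gP : `[< is_kaut L g >].
  by apply/asboolP; have [gB gM gbij _] := galgP g.
by exists (GalG gP); exact: galg_eqP.
Qed.

Lemma galg_base_continuous : continuous galg_base.
Proof.
move=> x U /galg_nbhsP[s sU]; apply/galg_nbhsP; exists s => y yx.
by apply: sU => z zs; exact: yx.
Qed.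

End BaseChange.

Lemma mu_val_mulrn (Omega : fieldType) (E : divringClosed Omega) m (a : mu (subfield E) m) k :
  val (val (a *+ k)) = val (val a) ^+ k.
Proof. by elim: k => [|k IH]; rewrite ?expr0 // mulrS exprS -IH. Qed.

(** * The twisted module of G_F and its inflation to G_L *)

Section Main.
Variables (Omega : closedFieldType) (F : divringClosed Omega) (p n : nat).
Hypothesis algF : forall x, algebraicOver (val : subfield F -> Omega) x.
Hypotheses (pr_p : prime p) (n_gt0 : (0 < n)%N) (p0 : p%:R != 0 :> Omega).
Let Fp := max_pext p F.
Let L := field_L p F.
Let J := field_J p F.
Let Lp := field_Lp p F.
Let m := (p ^ n)%N.
Let GG := galg Lp F.
Let GF := galg Fp F.
Let GL := galg Lp L.
Let A := mu (subfield Lp) m.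
Variables alpha theta : character GG m.
Hypothesis alphaE : forall (g : GG) (w : subfield Lp), w ^+ m = 1 ->
  g w = w ^+ (FinRing.uval (alpha g) : 'Z_m).
Hypothesis theta_N : forall g : GG, fixes g Fp -> theta g = alpha g.
Hypothesis theta_L : forall g : GG, fixes g L -> theta g = 1%g.
Implicit Types (g t : GG) (a : A) (c : GF) (x y : GL).

Let FL : {subset F <= L} := @sub_F_L Omega F p.
Let FpLp : {subset Fp <= Lp} := sub_Fp_Lp algF pr_p.
Let stab_Fp g (z : subfield Lp) : val z \in Fp -> val (g z) \in Fp.
Proof. by apply: stableG => //; exact: stable_Fp. Qed.
Let stab_J g (z : subfield Lp) : val z \in J -> val (g z) \in J.
Proof. by apply: stableG => //; exact: stable_J. Qed.
Let stab_L := @field_L_stable_Lp Omega p F.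

Let m_gt1 : (1 < m)%N.
Proof. by rewrite -(expn0 p) ltn_exp2l ?prime_gt1. Qed.
Let A_m a : a *+ m = 0. Proof. exact: mu_mulrn. Qed.

Let act g a : A := galg_mu g a.

Let actB g : zmod_morphism (act g). Proof. exact: galg_muB. Qed.

Let act_mulrn g a k : act g (a *+ k) = act g a *+ k.
Proof. by rewrite -[act g]/(gact_fun (mu_module Lp F m) g) raddfMn. Qed.

Let character1 (chi : character GG m) : chi 1%g = 1%g.
Proof. by apply: (mulgI (chi 1%g)); rewrite -characterM !mulg1. Qed.

Let characterV (chi : character GG m) g : chi (g^-1)%g = ((chi g)^-1)%g.
Proof. by apply: (mulgI (chi g)); rewrite -characterM !mulgV character1. Qed.

Lemma alpha_act g a : act g a = unit_scale (alpha g) a.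
Proof.
apply/val_inj/val_inj; rewrite mu_val_mulrn /= alphaE //.
have /eqP/(congr1 val) /= := zsub_valP a.
have -> k : mulgrp_val (zsub_val a *+ k) = mulgrp_val (zsub_val a) ^+ k; last by [].
by elim: k => [|k IH]; rewrite ?expr0 // mulrS exprS -IH.
Qed.

Definition mu_twist : GG -> A -> A :=
  twist (mu_module Lp F m) (fun g => (theta g)^-1%g).

Lemma mu_twistE g a : mu_twist g a = unit_scale (theta g)^-1%g (act g a).
Proof. by []. Qed.

(** On N the inverse of [theta] cancels the cyclotomic action. *)
Lemma mu_twist_N g a : fixes g Fp -> mu_twist g a = a.
Proof. by move=> gN; rewrite mu_twistE alpha_act theta_N // unit_scaleVK. Qed.

Lemma mu_twist_L g a : fixes g L -> mu_twist g a = act g a.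
Proof. by move=> gL; rewrite mu_twistE theta_L // invg1 unit_scale1. Qed.

Lemma act_twist g a : act g a = unit_scale (theta g) (mu_twist g a).
Proof. by rewrite mu_twistE unit_scaleKV. Qed.

Lemma mu_twistM g t a : mu_twist (g * t)%g a = mu_twist g (mu_twist t a).
Proof.
rewrite !mu_twistE characterM invMg unit_scaleM //.
rewrite [act g (unit_scale _ _)]act_mulrn -[act g _ *+ _]/(unit_scale _ _).
rewrite [act (g * t)%g a]galg_muM.
by rewrite -!unit_scaleM //; congr unit_scale; apply/val_inj; exact: mulrC.
Qed.

Let lift c : GG := projT1 (cid2 (lift_Fp_L algF pr_p c)).
Let liftL c : fixes (lift c) L. Proof. by rewrite /lift; case: cid2. Qed.
Let liftK c : restr Fp (lift c) = c. Proof. by rewrite /lift; case: cid2. Qed.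

Let restr_FpM g t : restr Fp (g * t)%g = (restr Fp g * restr Fp t)%g :> GF.
Proof. exact: (restrM FpLp stab_Fp). Qed.
Let restr_FpV g : restr Fp (g^-1)%g = ((restr Fp g)^-1)%g :> GF.
Proof. exact: (restrV FpLp stab_Fp). Qed.

Let restr_Fp1 g : (restr Fp g = 1%g :> GF) <-> fixes g Fp.
Proof.
split=> [g1 z zFp|gFp].
  apply/val_inj.
  by rewrite -(restr_FpE algF pr_p g (erefl : val (Subfield zFp) = val z)) -/Fp g1.
by apply: (restr_Fp_ext algF pr_p) => z w zw; rewrite gFp -?zw //; exact: (valP z).
Qed.

(** The lift is taken in G_L, where the twist is trivial, so the untwisted action suffices here;
    [act_FE] gives the formula for arbitrary lifts. *)
Definition act_F c a : A := act (lift c) a.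

(** The chosen lift and [g] differ by an element of N, which acts trivially after the twist. *)
Lemma act_FE g a : act_F (restr Fp g) a = mu_twist g a.
Proof.
rewrite /act_F -mu_twist_L //; set g' := lift _.
have -> : g = (g' * (g'^-1 * g))%g by rewrite mulKVg.
rewrite mu_twistM [mu_twist (g'^-1 * g)%g a]mu_twist_N //; apply: (proj1 (restr_Fp1 _)).
by rewrite restr_FpM restr_FpV liftK mulVg.
Qed.

Fact act_F1 a : act_F 1%g a = a.
Proof. by rewrite -(restr1 FpLp stab_Fp) act_FE mu_twist_N. Qed.

Fact act_FM c d a : act_F (c * d)%g a = act_F c (act_F d a).
Proof. by rewrite -[c]liftK -[d]liftK -restr_FpM !act_FE mu_twistM. Qed.

Fact act_FB c : zmod_morphism (act_F c). Proof. exact: actB. Qed.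

Fact act_F_open a : open [set c | act_F c a = a]%classic.
Proof.
have [s sP] := lift_Fp_near algF pr_p p0 [:: val (val a)].
suff : krull_open [set c : GF | act_F c a = a]%classic by [].
move=> c ca; exists s => d dc; rewrite /=.
have [z zs|g [gL ga gE]] := sP (c^-1 * d)%g.
  by rewrite galg_mulE dc // galg_invK.
have -> : d = (c * (c^-1 * d))%g by rewrite mulKVg.
rewrite act_FM -gE act_FE mu_twist_L //; have -> // : act g a = a.
by apply/val_inj/val_inj/ga; exact: mem_head.
Qed.

Definition module_F : gmodule GF A := GModule act_F1 act_FM act_FB act_F_open.

Let base : GL -> GG := galg_base FL.

Definition proj_F x : GF := restr Fp (base x).

Lemma proj_FM : {morph proj_F : x y / (x * y)%g}.
Proof. by move=> x y; rewrite /proj_F [base _]galg_baseM restr_FpM. Qed.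

Lemma proj_F_surj c : exists x, proj_F x = c.
Proof.
have [x xE] := galg_base_surj FL (@liftL c).
by exists x; rewrite /proj_F [base x]xE liftK.
Qed.

Lemma act_proj_F x a : act_F (proj_F x) a = galg_mu x a.
Proof.
rewrite act_FE mu_twist_L; last exact: galg_base_fixes.
exact/val_inj/val_inj.
Qed.

Fact inflation_compatible : compatible module_F (mu_module Lp L m) proj_F id.
Proof.
split=> //; last by move=> x a; exact: act_proj_F.
- move=> x; apply: (@continuous_comp GL GG GF base (restr Fp) x).
    exact: galg_base_continuous.
  exact: (restr_continuous FpLp stab_Fp).
- exact: proj_FM.
Qed.

Definition inflation i : {additive coh module_F i -> coh (mu_module Lp L m) i} :=
  coh_map inflation_compatible i.

Let conj_L := coh_conj m stab_L.

Lemma proj_F_conj g x :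
  proj_F (galg_conj stab_L g x) = ((restr Fp g)^-1 * proj_F x * restr Fp g)%g.
Proof.
rewrite /proj_F -restr_FpV -!restr_FpM; congr restr; exact: galg_eqP.
Qed.

Lemma inflation_eigen i (x : coh module_F i) :
  inflation i x \in eigen_pred (conj_L i) theta.
Proof.
apply/asboolP => g; apply: (@coh_map_twist _ _ _ _ _ _ _ _ _ (restr Fp g)) => [y|a].
  exact: proj_F_conj.
by rewrite /= act_FE; exact: act_twist.
Qed.

(* The subgroup Gal(L(p)/J), i.e. the intersection of [N] and [GL]. *)
Let kernel x := fixes (base x) Fp.

Let kernelE x : proj_F x = 1%g <-> kernel x. Proof. exact: restr_Fp1. Qed.

(** On the kernel [alpha] equals [theta], because it lies in N, and [theta] is 1, because it lies in
    G_L. *)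
Let kernel_act x a : kernel x -> galg_mu x a = a.
Proof.
move=> xN; have xE : galg_mu x a = act (base x) a by exact/val_inj/val_inj.
rewrite xE alpha_act -theta_N // theta_L ?unit_scale1 //; exact: galg_base_fixes.
Qed.

Let kernel_conj t x : kernel x -> kernel (galg_conj stab_L t x).
Proof.
move=> /kernelE xN; apply/kernelE.
by rewrite proj_F_conj xN mulg1 mulVg.
Qed.

(** p - 1 divides p^n - 1, so [a] is killed by p^n - 1 as well as by p^n. *)
Let torsion_pred a : a *+ p.-1 = 0 -> a = 0.
Proof.
move=> ap; have dvd : (p.-1 %| m.-1)%N by rewrite /m predn_exp dvdn_mulr.
have := A_m a; rewrite -(prednK (ltnW m_gt1)) mulrS -(divnK dvd) mulnC mulrnA ap mul0rn.
by rewrite addr0.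
Qed.

Lemma kernel_hom_trivial (f : GL -> A) :
  (forall x y, kernel x -> kernel y -> f (x * y)%g = f x + f y) ->
  (forall t x, fixes t Fp -> kernel x -> f (galg_conj stab_L t x) = f x) ->
  (forall x, \forall y \near x, f y = f x) ->
  forall x, kernel x -> f x = 0.
Proof.
move=> fM fJ fc x xN.
(* An inverse of [base] on the automorphisms that fix L, with value 1 elsewhere. *)
pose down g : GL := xget 1%g [set y | base y = g]%classic.
have downK g : fixes g L -> base (down g) = g.
  by move=> /(galg_base_surj FL)[y yE]; rewrite /down; case: xgetP => // /(_ y)[].
have baseK y : down (base y) = y.
  by apply: (galg_base_inj (KL := FL)); rewrite [LHS]downK //; exact: galg_base_fixes.
have /galg_nbhsP[S fS] : \forall y \near (1%g : GL), f y = f 1%g := fc 1%g.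
have f1 : f 1%g = 0.
  have N1 : kernel 1%g by [].
  by have := fM _ _ N1 N1; rewrite mulg1 -{1}[f 1%g]addr0 => /addrI.
have := @invariant_hom_trivial _ _ _ algF pr_p p0 A (f \o down) S torsion_pred.
move=> /(_ _ _ _ (base x)); rewrite /= baseK; apply.
- move=> g h [gF gL] [hF hL]; rewrite -fM /kernel ?downK //; congr f.
  apply: (galg_base_inj (KL := FL)); rewrite [RHS]galg_baseM -/base !downK //.
  exact: fixes_mul.
- move=> t g tF [gF gL].
  (* [galg_conj t] sends x to t^-1 x t, hence the inverse. *)
  rewrite -(fJ (t^-1)%g (down g)) /kernel ?downK //; last exact: fixes_inv.
  congr f; apply: (galg_base_inj (KL := FL)); rewrite -/base downK.
    apply: galg_eqP => z; rewrite !galg_mulE /= -[galg_fun (down g) _]/(base (down g) _).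
    by rewrite downK // invgK.
  by apply: fixes_conj => //; exact: stable_L.
- move=> g [gF gL] gS; rewrite -f1; apply: fS => z zS.
  by rewrite -[down g z]/(base (down g) z) downK // gS.
- by split=> //; exact: galg_base_fixes.
Qed.

(** The factor through G_F is locally constant because elements of G_F near 1 lift to elements of
    G_L near 1. *)
Lemma descend (h : GL -> A) : (forall x, \forall y \near x, h y = h x) ->
  (forall x y, kernel y -> h (x * y)%g = h x) ->
  exists hF : GF -> A, (forall c, \forall d \near c, hF d = hF c) /\
    forall x, h x = hF (proj_F x).
Proof.
move=> hc hN; pose s c := projT1 (cid (proj_F_surj c)).
have sE c : proj_F (s c) = c by rewrite /s; case: cid.
have hE x y : proj_F x = proj_F y -> h x = h y.
  move=> xy; rewrite -(mulKVg y x) hN //; apply/kernelE.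
  have -> : (y^-1 * x)%g = (y^-1 * (y * (y^-1 * x)))%g by rewrite mulKVg.
  rewrite mulKVg; apply: (mulgI (proj_F y)).
  by rewrite -proj_FM mulKVg mulg1.
exists (h \o s); split=> [c|x]; last by apply: hE; rewrite sE.
have /galg_nbhsP[S hS] : \forall y \near s c, h y = h (s c) := hc (s c).
have [s' s'P] := lift_Fp_near algF pr_p p0 S.
apply/galg_nbhsP; exists s' => d dc.
have [z zs|g [gL gS gE]] := s'P (c^-1 * d)%g.
  by rewrite galg_mulE dc // galg_invK.
have [u uE] := galg_base_surj FL gL.
rewrite /= -(hS (s c * u)%g).
  by apply: hE; rewrite proj_FM !sE /proj_F [base u]uE gE mulKVg.
by move=> z zS; rewrite galg_mulE -[u z]/(base u z) [base u]uE gS.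
Qed.

Lemma cocycle_F_eq (f g : ('I_2 -> GF) -> A) :
  (forall x y, f (couple (proj_F x) (proj_F y)) = g (couple (proj_F x) (proj_F y))) -> f = g.
Proof.
move=> fg; apply/funext => y; rewrite -(coupleK y).
have [x0 <-] := proj_F_surj (y ord0); have [x1 <-] := proj_F_surj (y ord_max).
exact: fg.
Qed.

(** * Inflation in degree 1 *)

(** A 0-cochain is just an element of the module, which is the same group on both sides, so a
    primitive on G_L is one on G_F. *)
Lemma inflation1_inj : injective (inflation 1).
Proof.
apply: raddf_inj => x; have [z ->] := coh_repr x.
rewrite /inflation coh_map_class => /coh_eq0P[h _ hE]; apply/coh_eq0P.
exists (fun=> h (@empty_family GL)); first exact: locally_constant_empty_family.
apply/funext => y; rewrite -(singleK y).
have [x0 <-] := proj_F_surj (y ord0).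
rewrite coboundary_single [module_F _ _]act_proj_F.
have := congr1 (fun f : ('I_1 -> GL) -> A => f (single x0)) hE.
by rewrite coboundary_single.
Qed.

Lemma inflation1_surj (c : coh (mu_module Lp L m) 1) :
  c \in eigen_pred (conj_L 1%N) theta -> exists b, inflation 1 b = c.
Proof.
have [z ->] := coh_repr c => {c} /asboolP zE.
have [zc z0] := cocycleP z; pose f x := val z (single x).
have fM x y : f (x * y)%g = f x + galg_mu x (f y) by exact: (cocycle1P z0).
have fc : forall x, \forall y \near x, f y = f x := proj1 (locally_constant_single _) zc.
have fN : forall x, kernel x -> f x = 0.
  apply: kernel_hom_trivial => // [x y xN _|t x tN xN]; first by rewrite fM kernel_act.
  (* At [x] in the kernel every coboundary of degree 1 vanishes, so the eigenvalue equation between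
     classes holds for the values; the equal scalars alpha(t) and theta(t) then cancel. *)
  have := zE t; rewrite /unit_scale -raddfMn [LHS]coh_map_class => /coh_eqP[h _ hE].
  have := congr1 (fun f : ('I_1 -> GL) -> A => f (single x)) hE.
  rewrite coboundary_single [X in _ = X]/= kernel_act // subrr.
  move=> /eqP; rewrite subr_eq0 cocycle_mulrn => /eqP.
  rewrite -[LHS]/(act t (f (galg_conj stab_L t x))) alpha_act -theta_N //.
  rewrite -[RHS]/(unit_scale (theta t) (f x)).
  by move=> /(congr1 (unit_scale (theta t)^-1%g)); rewrite !unit_scaleVK.
have [|hF [hFc hFE]] := descend fc.
  by move=> x y yN; rewrite fM (fN _ yN) (zmod_morphism0 (galg_muB x)) addr0.
pose k (y : 'I_1 -> GF) := hF (y ord0).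
have kP : k \in cocycle_pred module_F 1.
  apply/asboolP; split; first exact/locally_constant_single.
  apply: cocycle_F_eq => x y; rewrite coboundary_couple /k /single -proj_FM.
  rewrite [module_F _ _]act_proj_F -!hFE fM addrAC [_ - (_ + _)]addrC.
  by rewrite opprD addrA addrNK addNr.
exists (coh_class (ZSub kP)); rewrite /inflation coh_map_class; congr coh_class.
by apply/val_inj/funext => y; rewrite -(singleK y) /= /cochain_map /k /= -hFE.
Qed.

(** * Inflation in degree 2 *)

Let kernelM x y : kernel x -> kernel y -> kernel (x * y)%g.
Proof. by move=> /kernelE x1 /kernelE y1; apply/kernelE; rewrite proj_FM x1 y1 mulg1. Qed.

Let kernelV x : kernel x -> kernel (x^-1)%g.
Proof.
move=> /kernelE x1; apply/kernelE; apply: (mulgI (proj_F x)).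
by rewrite -proj_FM mulgV x1 mulg1; apply/kernelE.
Qed.

(** The action factors through [alpha], whose values commute. *)
Let act_conj t x a : galg_mu (galg_conj stab_L t x) a = galg_mu x a.
Proof.
have xE y : galg_mu y a = unit_scale (alpha (base y)) a.
  by rewrite -alpha_act; exact/val_inj/val_inj.
rewrite !xE; congr unit_scale.
have -> : base (galg_conj stab_L t x) = (t^-1 * base x * t)%g by exact: galg_eqP.
rewrite !characterM characterV; apply/val_inj => /=.
by rewrite mulrAC mulVr ?mul1r //; exact: (valP (alpha t)).
Qed.

Let muB x : zmod_morphism (galg_mu x : A -> A). Proof. exact: galg_muB. Qed.

Let mu_sum x (I : Type) (r : seq I) (P : pred I) (f : I -> A) :
  galg_mu x (\sum_(i <- r | P i) f i) = \sum_(i <- r | P i) galg_mu x (f i).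
Proof. by rewrite -[galg_mu x]/(gact_fun (mu_module Lp L m) x) raddf_sum. Qed.

Let mu_mulrn_act x a k : galg_mu x (a *+ k) = galg_mu x a *+ k.
Proof. by rewrite -[galg_mu x]/(gact_fun (mu_module Lp L m) x) raddfMn. Qed.

Let conjM t x y :
  galg_conj stab_L t (x * y)%g = (galg_conj stab_L t x * galg_conj stab_L t y)%g.
Proof. exact: (compatibleM (galg_conj_compatible m stab_L t)). Qed.

Let conj_comp s t x : galg_conj stab_L (s * t)%g x = galg_conj stab_L t (galg_conj stab_L s x).
Proof.
apply: (galg_base_inj (KL := FL)); apply: galg_eqP => z.
rewrite -[LHS]/((s * t)^-1%g (x (s (t z)))) invMg galg_mulE.
by [].
Qed.

(** As n > 0, the p-th roots of unity, which generate L over F, are among the p^n-th ones. *)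
Let alpha_kernel g : fixes g Fp -> alpha g = 1%g -> fixes g L.
Proof.
move=> gN g1; have [M ML] := mu_list algF pr_p.
have [h [hF hE]] := extendG algF g => z zL; apply/val_inj; rewrite -hE.
suff sub : {subset L <= equalizer h idfun} by exact/eqP/sub.
apply: adjoin_subset => [b Fb|w /= wp]; apply/eqP; first exact: hF.
have wLp : w \in Lp by apply: sub_L_Lp; exact: mu_in_L.
rewrite -[h w]/(h (val (Subfield wLp))) hE alphaE ?g1.
  have -> : (FinRing.uval (1%g : {unit 'Z_m}) : 'Z_m) = 1%N :> nat.
    by rewrite /= modn_small ?Zp_cast.
  by rewrite expr1.
apply/val_inj; rewrite rmorphXn rmorph1 /= /m.
by rewrite -(prednK n_gt0) expnS exprM wp expr1n.
Qed.

(* [alpha] identifies [N] modulo [kernel] with [B]. *)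
Let B : {set {unit 'Z_m}} := [set u | `[< exists2 t, fixes t Fp & alpha t = u >]].
Let rep (u : {unit 'Z_m}) : GG := xget 1%g [set t | fixes t Fp /\ alpha t = u]%classic.

Let rep_fixes u : fixes (rep u) Fp.
Proof. by rewrite /rep; case: xgetP => // t _ []. Qed.

Let alpha_rep u : u \in B -> alpha (rep u) = u.
Proof.
rewrite inE => /asboolP[t tN tu].
by rewrite /rep; case: xgetP => [s _ []|/(_ t)[]].
Qed.

Let alpha_B t : fixes t Fp -> alpha t \in B.
Proof. by move=> tN; rewrite inE; apply/asboolP; exists t. Qed.

Let B_group : group_set B.
Proof.
apply/group_setP; split; first by rewrite -(character1 alpha); exact: alpha_B.
move=> u v /alpha_rep <- /alpha_rep <-; rewrite -characterM; apply: alpha_B.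
exact: fixes_mul.
Qed.

(** For t in N the power t^(p-1) fixes L, so alpha takes the value theta = 1 on it; hence every
    element of [B] has order dividing p - 1. *)
Let coprime_B : coprime #|B| m.
Proof.
rewrite coprime_sym /m coprimeXl // prime_coprime //; apply/negP => pB.
have [u uB up] := Cauchy pr_p (pB : (p %| #|Group B_group|)%N).
have : (#[u]%g %| p.-1)%N.
  rewrite order_dvdn -(alpha_rep uB).
  have -> : (alpha (rep u) ^+ p.-1 = alpha (rep u ^+ p.-1))%g.
    elim: p.-1 => [|k IH]; first by rewrite !expg0 character1.
    by rewrite !expgS characterM IH.
  rewrite -theta_N ?theta_L //; last exact/fixes_exp/rep_fixes.
  exact: exp_pred_fixes.
by have p_gt1 := prime_gt1 pr_p; rewrite up gtnNdvd //; lia.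
Qed.

Let near_sum (I : Type) (r : seq I) (P : pred I) (f : I -> GL -> A) x :
  (forall i, \forall y \near x, f i y = f i x) ->
  \forall y \near x, \sum_(i <- r | P i) f i y = \sum_(i <- r | P i) f i x.
Proof.
move=> fc; elim: r => [|i r IH].
  by apply: filterE => y; rewrite !big_nil.
by apply: filterS2 (fc i) IH => y fy sy; rewrite !big_cons fy sy.
Qed.

Let shift_cocycle (a b c d e : A) : a - b + c - d = (a - d) - (b - e) + (c - e).
Proof.
rewrite -[RHS]addrA opprB [e - b + _]addrC subrKA [RHS]addrACA [- d - b]addrC addrA.
by rewrite [a - b + c]addrAC.
Qed.

Let solve_cocycle (a b c d : A) : d = a - b + c -> b = a + c - d.
Proof. by move=> ->; rewrite [a - b + c]addrAC opprB [RHS]addrC subrK. Qed.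

(* If a cocycle on [GF] becomes the coboundary of [k] on [GL], then the average of the
   conjugates of [k] by [N] modulo [kernel] is another primitive; by
   [kernel_hom_trivial] it vanishes on [kernel], so it descends to [GF]. *)
Lemma inflation2_inj : injective (inflation 2).
Proof.
apply: raddf_inj => b; have [z ->] := coh_repr b => {b}.
rewrite /inflation coh_map_class => /coh_eq0P[h hc hE]; apply/coh_eq0P.
pose f c d := val z (couple c d); pose k0 x := h (single x).
have fE x y : f (proj_F x) (proj_F y) = galg_mu x (k0 y) - k0 (x * y)%g + k0 x.
  have := congr1 (fun q : ('I_2 -> GL) -> A => q (couple x y)) hE.
  rewrite coboundary_couple => <-; congr (val z _); apply/funext => j.
  by rewrite /couple /=; case: ifP.
have k0c := proj1 (locally_constant_single _) hc.
(* The cocycle need not be normalised. Subtracting the constant [a0], whose coboundary is x |-> x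
   a0, makes the primitive vanish at 1. *)
pose a0 := k0 1%g; pose k x := k0 x - a0.
have mu1 a : galg_mu (1%g : GL) a = a by exact: galg_mu1.
have cobk x y : f (proj_F x) (proj_F y) - galg_mu x a0 = galg_mu x (k y) - k (x * y)%g + k x.
  by rewrite fE /k muB; exact: shift_cocycle.
(* [u] and 1 have the same image in G_F, so the inflated cocycle takes the same value at (u, y) and
   (1, y); comparing the two gives additivity. The next fact compares (x, u) with (x, 1). *)
have kl u y : kernel u -> k (u * y)%g = k u + k y.
  move=> uN; have := fE u y; rewrite (proj2 (kernelE u) uN).
  have <- : proj_F 1%g = 1%g by apply/kernelE.
  rewrite fE mu1 mul1g subrr add0r kernel_act // -/a0 => /solve_cocycle E1.
  by rewrite /k E1 [RHS]addrC addrACA addrA.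
have kr x u : kernel u -> k (x * u)%g = k x + galg_mu x (k u).
  move=> uN; have := fE x u; rewrite (proj2 (kernelE u) uN).
  have <- : proj_F 1%g = 1%g by apply/kernelE.
  rewrite fE mulg1 subrK -/a0 => /solve_cocycle E1.
  by rewrite /k E1 muB [RHS]addrC addrACA addrA.
have kc x : \forall y \near x, k y = k x.
  by apply: filterS (k0c x) => y ky; rewrite /k /k0 ky.
pose kt t x := k (galg_conj stab_L t x).
have ktc t x : \forall y \near x, kt t y = kt t x.
  exact: (compatible_continuous (galg_conj_compatible m stab_L t) (kc _)).
(* Conjugation by [t] preserves the images in G_F and the action on the coefficients, so the
   conjugate of [k] has the coboundary of [k]. *)
have cobkt t x y : fixes t Fp ->
    f (proj_F x) (proj_F y) - galg_mu x a0 = galg_mu x (kt t y) - kt t (x * y)%g + kt t x.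
  move=> tN; rewrite /kt conjM -(act_conj t x (k _)) -cobk act_conj !proj_F_conj.
  by rewrite (proj2 (restr_Fp1 t) tN) invg1 !mul1g !mulg1.
pose K x := \sum_(u in B) kt (rep u) x.
have KM x u : kernel u -> K (x * u)%g = K x + galg_mu x (K u).
  move=> uN; rewrite /K mu_sum -big_split /=; apply: eq_bigr => v _.
  by rewrite /kt conjM kr ?act_conj //; exact: kernel_conj.
have kn u x : kernel u -> kernel x -> k (u^-1 * x * u)%g = k x.
  move=> uN xN; have uVN := kernelV uN.
  rewrite kl; last exact: kernelM.
  by rewrite kl // addrAC -kl // mulVg [k 1%g]subrr add0r.
(* Conjugating by [t] permutes the summands through u |-> alpha(t) u. The product of [t] with a
   representative and the chosen representative differ by an element of the kernel, and conjugation
   by it does not change [k] on the kernel. *)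
have KJ t x : fixes t Fp -> kernel x -> K (galg_conj stab_L t x) = K x.
  move=> tN xN; rewrite /K [RHS](reindex_inj (mulgI (alpha t))) /=.
  have tB : alpha t \in Group B_group by exact: alpha_B.
  apply: eq_big => [u|u uB]; first exact: (esym (groupMl u tB)).
  rewrite /kt -conj_comp.
  have tuB : (alpha t * u)%g \in B by rewrite (groupMl u tB : (_ \in B) = (_ \in B)).
  set r := rep _; have r'N := rep_fixes (alpha t * u)%g.
  have uN : fixes ((rep (alpha t * u))^-1 * (t * r))%g Fp.
    exact: fixes_mul (fixes_inv (rep_fixes _)) (fixes_mul tN (rep_fixes _)).
  have [w wE] : exists w, base w = ((rep (alpha t * u))^-1 * (t * r))%g.
    apply: galg_base_surj; apply: alpha_kernel => //.
    by rewrite !characterM characterV !alpha_rep // mulVg.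
  have -> : (t * r = rep (alpha t * u) * base w)%g by rewrite wE mulKVg.
  rewrite conj_comp; set y := galg_conj _ _ x.
  have wN : kernel w by rewrite /kernel wE.
  have -> : galg_conj stab_L (base w) y = (w^-1 * y * w)%g.
    apply: (galg_base_inj (KL := FL)); rewrite !galg_baseM.
    have -> : galg_base FL (w^-1)%g = ((base w)^-1)%g.
      by apply: (mulgI (base w)); rewrite -galg_baseM !mulgV; exact: galg_eqP.
    exact: galg_eqP.
  by apply: kn => //; exact: kernel_conj.
have Kc x : \forall y \near x, K y = K x by apply: near_sum => u; exact: ktc.
have K0 : forall x, kernel x -> K x = 0.
  apply: kernel_hom_trivial => // x y xN yN.
  by rewrite KM // kernel_act.
(* The inverse of #|B| modulo m, by Euler's theorem. *)
pose e := (#|B| ^ (totient m).-1)%N.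
have Be a : a *+ #|B| *+ e = a.
  rewrite -mulrnA -expnS prednK ?totient_gt0 ?(ltnW m_gt1) //.
  by rewrite -(mulrn_modn (m := m)) // Euler_exp_totient // modn_small.
(* Adding [a0] back undoes the normalisation, so that [hh] is a primitive of the inflated cocycle
   itself. *)
pose hh x := K x *+ e + a0.
have [||hF [hFc hFE]] := @descend hh.
- by move=> x; apply: filterS (Kc x) => y Ky; rewrite /hh Ky.
- by move=> x y yN; rewrite /hh KM // (K0 y yN) (zmod_morphism0 (muB x)) addr0.
exists (fun y : 'I_1 -> GF => hF (y ord0)).
  exact: (proj2 (locally_constant_single _)).
apply: cocycle_F_eq => x y; rewrite coboundary_couple [module_F _ _]act_proj_F.
rewrite /single -proj_FM -!hFE -/(f _ _) /hh.
have xD a b : galg_mu x (a + b) = galg_mu x a + galg_mu x b.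
  by rewrite -[galg_mu x]/(gact_fun (mu_module Lp L m) x) raddfD.
rewrite xD mu_mulrn_act mu_sum.
have : \sum_(u in B) (f (proj_F x) (proj_F y) - galg_mu x a0) =
    \sum_(u in B) galg_mu x (kt (rep u) y) - K (x * y)%g + K x.
  rewrite /K -sumrB -big_split /=; apply: eq_bigr => u _; apply: cobkt.
  exact: rep_fixes.
rewrite sumr_const => /(congr1 (fun a => a *+ e)); rewrite Be.
move=> /eqP; rewrite subr_eq => /eqP ->.
rewrite mulrnDl mulrnBl.
have := shift_cocycle (\sum_(u in B) galg_mu x (kt (rep u) y) *+ e) (K (x * y)%g *+ e)
  (K x *+ e) (- galg_mu x a0) (- a0).
by rewrite !opprK sumrMnl.
Qed.

(** * Kummer theory *)

Let LLp : {subset L <= Lp} := @sub_L_Lp Omega F p.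

Let fixed_GL (z : subfield Lp) : (forall x, x z = z) -> val z \in L.
Proof.
move=> zfix; apply: (galois_Lp algF pr_p p0) => [|g gL]; first exact: sub_F_L.
by have [x <-] := galg_base_surj FL gL; exact: zfix.
Qed.

Let mulgrp_val_mulrn (E : fieldType) (b : mulgrp E) k : val (b *+ k) = val b ^+ k.
Proof. by elim: k => [|k IH]; rewrite ?expr0 // mulrS exprS -IH. Qed.

Let subr_swap (V : zmodType) (a b c d : V) : a - b = c - d -> a - c = b - d.
Proof.
move=> /eqP; rewrite subr_eq => /eqP ->.
by rewrite addrAC [c - d - c]addrAC subrr add0r addrC.
Qed.

Let mulgrp_valB (E : divringClosed Omega) (u v : mulgrp (subfield E)) :
  val (val (u - v)) = val (val u) / val (val v).
Proof. exact: (fmorph_div (val : {rmorphism subfield E -> Omega})). Qed.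

Let mulgrp_val_neq0 (E : divringClosed Omega) (u : mulgrp (subfield E)) : val (val u) != 0.
Proof. by rewrite fmorph_eq0; exact: mulgrp_valP. Qed.

Let subfield_neq0 (E : divringClosed Omega) (z : subfield E) : val z != 0 -> z != 0.
Proof. by apply: contraNneq => ->; rewrite rmorph0. Qed.

Section KummerCocycle.
Variable b : mulgrp (subfield Lp).
Hypothesis bL : val (val (b *+ m)) \in L.

Fact kummer_mu x : galg_mulgrp x b - b \in mu_pred m.
Proof.
apply/eqP; rewrite mulrnBl -raddfMn; apply/eqP; rewrite subr_eq0; apply/eqP.
by apply/val_inj; exact: (galg_fix x).
Qed.

Definition kummer_cochain (y : 'I_1 -> GL) : A := ZSub (kummer_mu (y ord0)).

Fact kummer_cocycle : kummer_cochain \in cocycle_pred (mu_module Lp L m) 1.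
Proof.
apply/asboolP; split.
  apply: (proj2 (locally_constant_single _)) => x.
  apply/galg_nbhsP; exists [:: val b] => y yx; apply/val_inj => /=; congr (_ - _).
  by apply/val_inj; exact: yx (mem_head _ _).
apply/funext => y; rewrite -(coupleK y) coboundary_couple.
move: (y ord0) (y ord_max) => x x'.
apply/val_inj; rewrite -[LHS]/(galg_mulgrp x (galg_mulgrp x' b - b) -
  (galg_mulgrp (x * x')%g b - b) + (galg_mulgrp x b - b)).
rewrite raddfB (_ : galg_mulgrp (x * x')%g b = galg_mulgrp x (galg_mulgrp x' b)).
  by rewrite opprB [X in X + _]addrC subrKA subrKA subrr.
exact/val_inj.
Qed.

Definition kummer_class : coh (mu_module Lp L m) 1 := coh_class (ZSub kummer_cocycle).

(** The class vanishes when x |-> x(b)/b equals x |-> x(w)/w for a root of unity [w], that is, when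
    b/w is fixed by G_L. *)
Lemma kummer_class_eq0 :
  kummer_class = 0 <-> exists w : A, val (val (b - val w)) \in L.
Proof.
split=> [/coh_eq0P[h _ hE]|[w wL]].
  exists (h (@empty_family GL)); apply: fixed_GL => x.
  have := congr1 (fun f : ('I_1 -> GL) -> A => val (f (single x))) hE.
  rewrite coboundary_single => E1; set w := h _ in E1 *.
  suff /(congr1 val) : galg_mulgrp x (b - val w) = b - val w by [].
  have E2 : galg_mulgrp x b - b = galg_mulgrp x (val w) - val w by exact: E1.
  by rewrite galg_mulgrpB; exact: subr_swap E2.
apply/coh_eq0P; exists (fun=> w); first exact: locally_constant_empty_family.
apply/funext => y; rewrite -(singleK y) coboundary_single.
move: (y ord0) => x; apply/val_inj.
rewrite -[LHS]/(galg_mulgrp x b - b) -[RHS]/(galg_mulgrp x (val w) - val w).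
have : galg_mulgrp x (b - val w) = b - val w by apply/val_inj; exact: (galg_fix x).
by rewrite galg_mulgrpB; exact: subr_swap.
Qed.

End KummerCocycle.

Lemma kummer_classB (b b' : mulgrp (subfield Lp))
    (bL : val (val (b *+ m)) \in L) (b'L : val (val (b' *+ m)) \in L)
    (cL : val (val ((b - b') *+ m)) \in L) :
  kummer_class cL = kummer_class bL - kummer_class b'L.
Proof.
rewrite /kummer_class -raddfB; congr coh_class; apply/val_inj/funext => y.
apply/val_inj; rewrite -[LHS]/(galg_mulgrp (y ord0) (b - b') - (b - b')).
rewrite -[RHS]/((galg_mulgrp (y ord0) b - b) - (galg_mulgrp (y ord0) b' - b')).
by rewrite galg_mulgrpB !opprB addrACA [RHS]addrACA; congr (_ + _); exact: addrC.
Qed.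

(** Two m-th roots of the same element differ by a root of unity, whose Kummer class is zero. *)
Lemma kummer_class_mulrn_eq (b b' : mulgrp (subfield Lp)) (bL : val (val (b *+ m)) \in L)
    (b'L : val (val (b' *+ m)) \in L) : b *+ m = b' *+ m -> kummer_class bL = kummer_class b'L.
Proof.
move=> bb'; have d0 : (b - b') *+ m = 0 by rewrite mulrnBl bb' subrr.
have dL : val (val ((b - b') *+ m)) \in L by rewrite d0 rpred1.
apply/eqP; rewrite -subr_eq0 -(kummer_classB bL b'L dL); apply/eqP.
apply/kummer_class_eq0.
have dmu : (b - b') \in mu_pred m by apply/eqP.
by exists (ZSub dmu); rewrite subrr rpred1.
Qed.

Lemma kummer_root (a : mulgrp (subfield L)) :
  exists b : mulgrp (subfield Lp), val (val (b *+ m)) = val (val a).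
Proof.
have a0 := mulgrp_val_neq0 a.
have /closed_rootP[x] : size ('X^m - (val (val a))%:P) != 1%N.
  by rewrite size_XnsubC ?(ltnW m_gt1) // eqSS gtn_eqF // ltnW.
rewrite /root !hornerE subr_eq0 => /eqP xa.
have x0 : x != 0 by apply: contraNneq a0 => x0; rewrite -xa x0 expr0n gtn_eqF // ltnW.
have xLp : x \in Lp.
  by apply: (root_in_Lp algF pr_p p0 (k := n)) => //; rewrite xa; exact: (valP (val a)).
have x0' : Subfield xLp != 0 by exact: subfield_neq0.
by exists (MulGrp x0'); rewrite mulgrp_val_mulrn rmorphXn.
Qed.

Let rootL (a : mulgrp (subfield L)) := projT1 (cid (kummer_root a)).
Let rootLE (a : mulgrp (subfield L)) : val (val (rootL a *+ m)) = val (val a).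
Proof. by rewrite /rootL; case: cid. Qed.
Let rootLP (a : mulgrp (subfield L)) : val (val (rootL a *+ m)) \in L.
Proof. by rewrite rootLE; exact: (valP (val a)). Qed.

Definition kummer_fun (a : mulgrp (subfield L)) : coh (mu_module Lp L m) 1 :=
  kummer_class (rootLP a).

Lemma kummer_fun_class (a : mulgrp (subfield L)) (b : mulgrp (subfield Lp))
    (bL : val (val (b *+ m)) \in L) :
  val (val (b *+ m)) = val (val a) -> kummer_fun a = kummer_class bL.
Proof.
move=> ba; apply: kummer_class_mulrn_eq; apply/val_inj/val_inj.
by rewrite [LHS]rootLE.
Qed.

Fact kummer_fun_zmod_morphism : zmod_morphism kummer_fun.
Proof.
move=> a a'.
have E1 : val (val ((rootL a - rootL a') *+ m)) = val (val (a - a')).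
  by rewrite mulrnBl !mulgrp_valB !rootLE.
have dL : val (val ((rootL a - rootL a') *+ m)) \in L by rewrite E1; exact: (valP (val _)).
by rewrite (kummer_fun_class dL E1) (kummer_classB (rootLP a) (rootLP a')).
Qed.

HB.instance Definition _ := GRing.isZmodMorphism.Build
  (mulgrp (subfield L)) (coh (mu_module Lp L m) 1) kummer_fun kummer_fun_zmod_morphism.

Lemma kummer_fun_eq0 (a : mulgrp (subfield L)) : (kummer_fun a == 0) = (a \in power_pred m).
Proof.
apply/eqP/asboolP => [/kummer_class_eq0[w wL]|[c ->]].
  have c0 : Subfield wL != 0 by exact: subfield_neq0 (mulgrp_val_neq0 _).
  exists (MulGrp c0); apply/val_inj/val_inj; rewrite mulgrp_val_mulrn rmorphXn /=.
  rewrite -rootLE; have -> : rootL a *+ m = (rootL a - val w) *+ m.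
    by rewrite mulrnBl; have /eqP -> := zsub_valP w; rewrite subr0.
  by rewrite mulgrp_val_mulrn rmorphXn.
have c0 : Subfield (LLp (valP (val c))) != 0 by exact: subfield_neq0 (mulgrp_val_neq0 _).
have cE : val (val (MulGrp c0 *+ m)) = val (val (c *+ m)).
  by rewrite !mulgrp_val_mulrn !rmorphXn.
have cL : val (val (MulGrp c0 *+ m)) \in L by rewrite cE; exact: (valP (val _)).
rewrite (kummer_fun_class cL cE); apply/kummer_class_eq0; exists 0.
by rewrite subr0; exact: (valP (val c)).
Qed.

(** By Hilbert 90 a cocycle with values in the roots of unity has the form x |-> x(b)/b; its values
    have m-th power 1, so b^m is fixed by G_L and lies in L. *)
Lemma kummer_fun_surj (c : coh (mu_module Lp L m) 1) :
  exists a : mulgrp (subfield L), kummer_fun a = c.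
Proof.
have [z ->] := coh_repr c => {c}; have [zc z0] := cocycleP z.
pose w x : subfield Lp := val (val (val z (single x))).
have zM := cocycle1P z0.
have w0 x : w x != 0 by exact: mulgrp_valP.
have wM x y : w (x * y)%g = w x * x (w y).
  by rewrite /w zM.
have /galg_nbhsP[S wS] := proj1 (locally_constant_single _) zc 1%g.
have w1 : w 1%g = 1.
  have := wM 1%g 1%g; rewrite mulg1 galg_oneE -{1}[w 1%g]mulr1.
  by move/(mulfI (w0 _)).
have algLp (u : subfield Lp) : algebraicOver (val : subfield L -> Omega) (val u).
  exact: algebraicOver_ext.
have [|b b0 bE] := galg_hilbert90 LLp algLp (S := S) w0 wM.
  by move=> x xS; rewrite -w1 /w; congr (val (val _)); apply: wS => s sS; exact: xS.
pose b' := MulGrp b0.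
have wm x : w x ^+ m = 1.
  rewrite /w -mulgrp_val_mulrn; have /eqP -> := zsub_valP (val z (single x)).
  by [].
have bmL : val (val (b' *+ m)) \in L.
  apply: fixed_GL => x; rewrite mulgrp_val_mulrn rmorphXn /=.
  have -> : x b = w x * b by rewrite bE divfK.
  by rewrite exprMn wm mul1r.
have a0 : Subfield bmL != 0 by exact: subfield_neq0 (mulgrp_val_neq0 _).
exists (MulGrp a0); rewrite (kummer_fun_class bmL) //.
congr coh_class; apply/val_inj/funext => y; rewrite -(singleK y).
by apply/val_inj/val_inj; rewrite -[RHS]/(w (y ord0)) bE.
Qed.

(** If b is an m-th root of a, then g(b) is one of g(a), and the Kummer class does not depend on the
    root. *)
Lemma kummer_fun_conj g (a : mulgrp (subfield L)) :
  kummer_fun (galg_mulgrp (restr L g) a) = conj_L 1%N g (kummer_fun a).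
Proof.
have gE : val (val (galg_mulgrp g (rootL a) *+ m)) = val (val (galg_mulgrp (restr L g) a)).
  rewrite -raddfMn -[LHS]/(val (g (val (rootL a *+ m)))).
  rewrite -[RHS]/(val (restr L g (val a))).
  by apply/esym/restrP.
have gL : val (val (galg_mulgrp g (rootL a) *+ m)) \in L.
  by rewrite gE; exact: (valP (val _)).
rewrite (kummer_fun_class gL gE) /conj_L /coh_conj coh_map_class; congr coh_class.
apply/val_inj/funext => y; apply/val_inj.
rewrite -[RHS]/(galg_mulgrp g (galg_mulgrp (galg_conj stab_L g (y ord0)) (rootL a) - rootL a)).
rewrite galg_mulgrpB.
rewrite -[LHS]/(galg_mulgrp (y ord0) (galg_mulgrp g (rootL a)) - galg_mulgrp g (rootL a)).
by congr (_ - _); apply/val_inj; rewrite /= galg_Kinv.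
Qed.

Lemma kummer_eigenmodule : zmod_iso (eigenmodule (conj_L 1%N) theta)
  (eigenmodule (fun g => galg_mod_powers m (restr L g)) theta).
Proof.
apply: zmod_iso_sym.
have [k [kbij kE]] := quotient_iso kummer_fun_eq0 kummer_fun_surj.
apply: (@eigenmodule_equivariant GG m (mod_powers (subfield L) m) _
  (fun g => galg_mod_powers m (restr L g)) (conj_L 1%N) theta k kbij) => g x.
have kx : k x = kummer_fun (repr x) by rewrite -[X in k X]reprK kE.
rewrite kx; apply: etrans (kummer_fun_conj g (repr x)).
by apply: etrans (kE _); congr (k _); rewrite -[X in galg_mod_powers _ _ X]reprK.
Qed.

(** * Restriction to [Gamma_F] *)

Let GJ := galg J L.
Let AJ := mu (subfield J) m.
Let LJ : {subset L <= J} := @sub_L_J Omega F p.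
Let JLp : {subset J <= Lp} := sub_J_Lp algF pr_p.
Let FpJ : {subset Fp <= J} := @sub_Fp_J Omega F p.

Let fixes_J g : fixes g Fp -> fixes g L -> fixes g J.
Proof.
move=> gFp gL z zJ; have [h [hF hE]] := extendG algF g; apply/val_inj; rewrite -hE.
suff sub : {subset J <= equalizer h idfun} by exact/eqP/sub.
apply: adjoin_subset => [w wFp|w /= wp]; apply/eqP.
  by have := hE (Subfield (FpLp wFp)); rewrite gFp.
have wL := mu_in_L F wp.
by have := hE (Subfield (LLp wL)); rewrite gL.
Qed.

(** J is generated by F(p) and roots of unity in L, so an element of G_L is determined on J by its
    restriction to F(p). *)
Let agree_J x y : proj_F x = proj_F y -> forall z, val z \in J -> x z = y z.
Proof.
move=> xy z zJ; have N1 : kernel (y^-1 * x)%g.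
  apply/kernelE; apply: (mulgI (proj_F y)).
  by rewrite -proj_FM mulKVg mulg1.
have := fixes_J N1 (galg_base_fixes FL _) zJ.
by rewrite -[base _ z]/((y^-1 * x)%g z) galg_mulE => /(congr1 y); rewrite galg_Kinv.
Qed.

Let lift_J_ex (s : GJ) : exists x, forall (y : subfield J) (z : subfield Lp),
  val y = val z -> val (s y) = val (x z).
Proof.
have [h [hL hE]] := galg_extend algF s FL LJ.
have hLp := stable_Lp algF pr_p (fun b Fb => hL b (FL Fb)).
have [x xE] := galg_of_rmorphism algF FL LLp hL hLp.
by exists x => y z yz; rewrite xE -yz hE.
Qed.

Let lift_J (s : GJ) := projT1 (cid (lift_J_ex s)).
Let lift_JE (s : GJ) (y : subfield J) (z : subfield Lp) :
  val y = val z -> val (s y) = val (lift_J s z).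
Proof. by rewrite /lift_J; case: cid => x /= xE; exact: xE. Qed.

Let restr_J_ex x : exists s : GJ, forall (y : subfield J) (z : subfield Lp),
  val y = val z -> val (s y) = val (x z).
Proof.
have xL : fixes (restr J (base x)) L.
  move=> z zL; apply/val_inj; rewrite (restr_val JLp stab_J).
  by rewrite (galg_base_fixes FL).
have [s sE] := galg_base_surj FL xL; exists s => y z yz.
have -> : s y = restr J (base x) y by rewrite -sE.
exact: (restrP JLp stab_J).
Qed.

(** Going through a lift to G_L lets the action formula for [proj_F] carry over; [proj_JE] shows
    that the result is plain restriction. *)
Definition proj_J (s : GJ) : GF := proj_F (lift_J s).

Lemma proj_JE (s : GJ) (y : subfield Fp) (z : subfield J) :
  val y = val z -> val (proj_J s y) = val (s z).
Proof.
move=> yz; pose w : subfield Lp := Subfield (JLp (valP z)).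
rewrite (lift_JE s (erefl : val z = val w)); exact: (restrP FpLp stab_Fp).
Qed.

Lemma proj_J_inj : injective proj_J.
Proof.
move=> s t st; apply: galg_eqP => y; apply/val_inj.
pose w : subfield Lp := Subfield (JLp (valP y)).
rewrite !(lift_JE _ (erefl : val y = val w)).
by rewrite (agree_J st) //; exact: (valP y).
Qed.

Lemma proj_J_surj c : exists s, proj_J s = c.
Proof.
have [x <-] := proj_F_surj c; have [s sE] := restr_J_ex x; exists s.
apply: galg_eqP => y; apply/val_inj.
pose z : subfield J := Subfield (FpJ (valP y)).
rewrite (proj_JE s (erefl : val y = val z)) (sE z (Subfield (FpLp (valP y)))) //.
exact/esym/(restrP FpLp stab_Fp).
Qed.

(** On Gal(L(p)/J) the cyclotomic character is [theta], and [theta] is 1 there. *)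
Let mu_in_J (w : subfield Lp) : w ^+ m = 1 -> val w \in J.
Proof.
move=> wm; apply: (galois_Lp algF pr_p p0) => [z /sub_F_Fp/FpJ //|g gJ].
have gFp : fixes g Fp by move=> z /FpJ; exact: gJ.
have gL : fixes g L by move=> z /LJ; exact: gJ.
rewrite alphaE // -theta_N // theta_L //.
Qed.

Let mu_eq (E : divringClosed Omega) (a b : mu (subfield E) m) :
  val (val (val a)) = val (val (val b)) -> a = b.
Proof. by move=> ab; apply/val_inj/val_inj/val_inj. Qed.

Let mu_exp (E : divringClosed Omega) (a : mu (subfield E) m) : val (val a) ^+ m = 1.
Proof. by rewrite -mulgrp_val_mulrn; have /eqP -> := zsub_valP a. Qed.

Let mu_exp_val (E : divringClosed Omega) (a : mu (subfield E) m) :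
  val (val (val a)) ^+ m = 1.
Proof. by rewrite -rmorphXn mu_exp rmorph1. Qed.

Let mu_of (E : divringClosed Omega) (w : subfield E) : w ^+ m = 1 ->
  exists a : mu (subfield E) m, val (val a) = w.
Proof.
move=> wm; have w0 : w != 0.
  by apply: contra_eq_neq wm => ->; rewrite expr0n gtn_eqF 1?ltnW // eq_sym oner_eq0.
have aP : MulGrp w0 \in mu_pred m.
  by apply/eqP/val_inj; rewrite mulgrp_val_mulrn.
by exists (ZSub aP).
Qed.

Let to_J_ex a : exists b : AJ, val (val (val b)) = val (val (val a)).
Proof.
have aJ := mu_in_J (mu_exp a).
have [|b bE] := @mu_of J (Subfield aJ); last by exists b; rewrite bE.
by apply/val_inj; rewrite rmorphXn rmorph1; exact: mu_exp_val.
Qed.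

Let of_J_ex (b : AJ) : exists a : A, val (val (val a)) = val (val (val b)).
Proof.
have [|a aE] := @mu_of Lp (Subfield (JLp (valP (val (val b))))); last by exists a; rewrite aE.
by apply/val_inj; rewrite rmorphXn rmorph1; exact: mu_exp_val.
Qed.

Definition to_J a : AJ := projT1 (cid (to_J_ex a)).
Let to_JE a : val (val (val (to_J a))) = val (val (val a)).
Proof. by rewrite /to_J; case: cid. Qed.

Definition of_J (b : AJ) : A := projT1 (cid (of_J_ex b)).
Let of_JE b : val (val (val (of_J b))) = val (val (val b)).
Proof. by rewrite /of_J; case: cid. Qed.

Let to_JK : cancel to_J of_J. Proof. by move=> a; apply: mu_eq; rewrite of_JE to_JE. Qed.
Let of_JK : cancel of_J to_J. Proof. by move=> a; apply: mu_eq; rewrite to_JE of_JE. Qed.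

Let mu_valB (E : divringClosed Omega) (a b : mu (subfield E) m) :
  val (val (val (a - b))) = val (val (val a)) / val (val (val b)).
Proof. exact: mulgrp_valB. Qed.

Fact restriction_compatible : compatible module_F (mu_module J L m) proj_J to_J.
Proof.
split.
- move=> s U /galg_nbhsP[S SU]; apply/galg_nbhsP.
  exists [seq Subfield (FpJ (valP y)) | y : subfield Fp <- S] => t ts; apply: SU => y yS.
  apply/val_inj; rewrite !(@proj_JE _ y (Subfield (FpJ (valP y)))) // ts //.
  by apply/mapP; exists y.
- move=> s t; apply: galg_eqP => y; apply/val_inj.
  pose z : subfield J := Subfield (FpJ (valP y)).
  rewrite (proj_JE _ (erefl : val y = val z)) !galg_mulE.
  by apply/esym/proj_JE; exact: proj_JE.
- by move=> a b; apply: mu_eq; rewrite mu_valB !to_JE mu_valB.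
- move=> s a; apply: mu_eq; rewrite to_JE [module_F _ _]act_proj_F.
  apply/esym; rewrite -[LHS]/(val (s (val (val (to_J a))))).
  by rewrite -[RHS]/(val (lift_J s (val (val a)))); apply: lift_JE; exact: to_JE.
Qed.

Let section_J c : GJ := projT1 (cid (proj_J_surj c)).
Let section_JK : cancel section_J proj_J.
Proof. by move=> c; rewrite /section_J; case: cid. Qed.
Let proj_JK : cancel proj_J section_J.
Proof. by move=> s; apply: proj_J_inj; rewrite section_JK. Qed.

(** Elements of G_F near 1 lift to elements of G_L that fix a given finite part of J. *)
Let section_J_continuous : continuous section_J.
Proof.
move=> c U /galg_nbhsP[S SU].
have [s' s'P] := lift_Fp_near algF pr_p p0 [seq Subfield (JLp (valP y)) | y : subfield J <- S].
apply/galg_nbhsP; exists s' => d dc; apply: SU => y yS.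
have [z zs|g [gL gS gE]] := s'P (c^-1 * d)%g.
  by rewrite galg_mulE dc // galg_invK.
have [u uE] := galg_base_surj FL gL.
pose w : subfield Lp := Subfield (JLp (valP y)).
apply/val_inj; rewrite !(lift_JE _ (erefl : val y = val w)); congr val.
have dE : proj_F (lift_J (section_J d)) = proj_F (lift_J (section_J c) * u)%g.
  rewrite proj_FM -[LHS]/(proj_J (section_J d)) -[X in (X * _)%g]/(proj_J (section_J c)).
  by rewrite !section_JK /proj_F [base u]uE gE mulKVg.
rewrite (agree_J dE); last exact: (valP y).
rewrite galg_mulE -[u w]/(base u w) [base u]uE gS //.
by apply/mapP; exists y.
Qed.

Lemma restriction_bij i : bijective (coh_map restriction_compatible i).
Proof.
have c' := compatible_inverse restriction_compatible section_J_continuous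
  proj_JK section_JK to_JK of_JK.
exact: (coh_map_bij restriction_compatible c' i proj_JK section_JK to_JK of_JK).
Qed.

Let stab_LJ := @field_L_stable_J Omega p F.

(** By bijectivity every class on Gamma_F comes from G_F, so naturality under conjugation determines
    the action on all of them. *)
Lemma restriction_theta i :
  acts_via (fun g => coh_conj m stab_LJ i (restr J g)) theta.
Proof.
move=> c; have [b <-] : exists b, coh_map restriction_compatible i b = c.
  by have [k _ kK] := restriction_bij i; exists (k c); rewrite kK.
apply/asboolP => g; apply: (@coh_map_twist _ _ _ _ _ _ _ _ _ (restr Fp g)) => [s|a].
  apply: (mulgI (restr Fp g)); rewrite !mulgA mulgV mul1g.
  apply: galg_eqP => y; apply/val_inj; rewrite !galg_mulE.
  pose z : subfield J := Subfield (FpJ (valP y)).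
  pose w : subfield Lp := Subfield (FpLp (valP y)).
  have gzE : val (restr Fp g y) = val (restr J g z).
    rewrite (restrP FpLp stab_Fp g (erefl : val y = val w)).
    by rewrite (restrP JLp stab_J g (erefl : val z = val w)).
  rewrite (proj_JE s gzE).
  have cE := proj_JE (galg_conj stab_LJ (restr J g) s) (erefl : val y = val z).
  pose v : subfield Lp := Subfield (FpLp (valP (proj_J (galg_conj stab_LJ (restr J g) s) y))).
  rewrite (restrP FpLp stab_Fp g (erefl : val _ = val v)).
  rewrite -(restrP JLp stab_J g (esym cE : val _ = val v)).
  by rewrite /= galg_Kinv.
apply: mu_eq; rewrite [module_F _ _]act_FE.
rewrite -[to_J _ *+ _]/(unit_scale (theta g) (to_J (mu_twist g a))).
have -> : unit_scale (theta g) (to_J (mu_twist g a)) = to_J (act g a).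
  rewrite act_twist /unit_scale; apply: mu_eq.
  rewrite to_JE (mu_val_mulrn (to_J _)) (mu_val_mulrn (mu_twist g a)) !rmorphXn /=.
  by congr (_ ^+ _); exact: to_JE.
rewrite to_JE; apply: (restrP JLp stab_J); exact: to_JE.
Qed.

End Main.

(** * The theorem over the image of F in Omega *)

Lemma algebraicOver_image (F Omega : fieldType)
    (iota : {rmorphism F -> Omega}) x :
  algebraicOver iota x -> algebraicOver (val : subfield (image_field iota) -> Omega) x.
Proof.
have iotaP a : iota a \in image_field iota by apply/asboolP; exists a.
pose i a : subfield (image_field iota) := Subfield (iotaP a).
have iB : zmod_morphism i by move=> a b; apply/val_inj; exact: rmorphB.
have iM : GRing.monoid_morphism i.
  by split=> [|a b]; apply/val_inj; [exact: (rmorph1 iota) | exact: (rmorphM iota)].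
pose iR : {rmorphism F -> subfield (image_field iota)} :=
  HB.pack i (GRing.isZmodMorphism.Build _ _ i iB) (GRing.isMonoidMorphism.Build _ _ i iM).
by case=> q q0 qx; exists (map_poly iR q); rewrite ?map_poly_eq0 // -map_poly_comp.
Qed.

Theorem theorem2p3 (p n : nat) (F : fieldType) (Omega : closedFieldType)
    (iota : {rmorphism F -> Omega})
    (Omega_algebraic : forall x : Omega, algebraicOver iota x)
    (p_prime : prime p) (p_odd : odd p) (n_gt0 : (0 < n)%N)
    (char_F : p \notin [pchar F])
    (mu_p_notin_F : ~ (forall w : Omega, w ^+ p = 1 -> w \in image_field iota)) :
  let F0 := image_field iota in
  let Fp := max_pext p F0 in
  let L := field_L p F0 in
  let J := field_J p F0 in
  let Lp := field_Lp p F0 in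
  let GG := galg Lp F0 in
  forall (alpha theta : character GG (p ^ n)),
    (forall (g : GG) (w : subfield Lp), w ^+ (p ^ n) = 1 ->
       g w = w ^+ (FinRing.uval (alpha g) : 'Z_(p ^ n))) ->
    (forall g : GG, fixes g Fp -> theta g = alpha g) ->
    (forall g : GG, fixes g L -> theta g = 1%g) ->
  let mu_tw := twist (mu_module Lp F0 (p ^ n)) (fun g => (theta g)^-1%g) in
  let M_Gamma := mu_module J L (p ^ n) in
  let conj_L := coh_conj (p ^ n) (@field_L_stable_Lp Omega p F0) in
  let conj_Gamma := coh_conj (p ^ n) (@field_L_stable_J Omega p F0) in
  (forall g : GG, fixes g Fp -> forall a, mu_tw g a = a) /\
  exists M_F : gmodule (galg Fp F0) (mu (subfield Lp) (p ^ n)),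
    (forall (g : GG) a, M_F (restr Fp g) a = mu_tw g a) /\
    [/\ zmod_iso (coh M_F 1) (eigenmodule (conj_L 1%N) theta) /\
          zmod_iso (eigenmodule (conj_L 1%N) theta)
            (eigenmodule
               (fun g : GG => galg_mod_powers (p ^ n) (restr L g)) theta),
        zmod_embeds (coh M_F 2) (eigenmodule (conj_L 2%N) theta)
      & forall i : nat,
          [/\ zmod_iso (coh M_F i) (coh M_Gamma i),
              forall (g : GG) (c : coh M_F i),
                inner_conj M_F (restr Fp g) i c = c
            & acts_via (fun g : GG => conj_Gamma i (restr J g)) theta]].
Proof.
move=> F0 Fp L J Lp GG alpha theta alphaE theta_N theta_L mu_tw M_Gamma conj_L conj_Gamma.
have algF x := algebraicOver_image (Omega_algebraic x).
have p0 : p%:R != 0 :> Omega.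
  by rewrite -(rmorph_nat iota) fmorph_eq0; move: char_F; rewrite inE p_prime.
split; first by move=> g gN a; exact: (mu_twist_N p_prime n_gt0 alphaE theta_N).
exists (module_F algF p_prime n_gt0 p0 alphaE theta_N theta_L).
split; first by move=> g a; exact: (act_FE algF p_prime n_gt0 alphaE theta_N theta_L).
split=> [||i].
- split; last exact: kummer_eigenmodule.
  apply: (eigenmodule_iso (f := inflation algF p_prime n_gt0 p0 alphaE theta_N theta_L 1)).
  + exact: inflation1_inj.
  + exact: inflation_eigen.
  + exact: inflation1_surj.
- apply: (eigenmodule_embeds (f := inflation algF p_prime n_gt0 p0 alphaE theta_N theta_L 2)).
  + exact: inflation2_inj.
  + exact: inflation_eigen.
- split.
  + exists (coh_map (restriction_compatible algF p_prime n_gt0 p0 alphaE theta_N theta_L) i).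
    exact: restriction_bij.
  + by move=> g c; exact: inner_conj_id.
  + exact: (restriction_theta algF p_prime n_gt0 p0 alphaE theta_N theta_L (i := i)).
Qed.
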